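(* Assume that for each $i=1,2,3,4$ the following hold: (1) there are $L_i>0$ and a positive function $g_i$ on $E_i$ of at most polynomial growth such that $|a_i(x)-a_i(y)|\le L_i|x-y|$, $|c_i(x,z)-c_i(y,z)|\le g_i(z)|x-y|$ and $|c_i(x,z)|\le g_i(z)(1+|x|)$ for all $x,y\in\mathbb{R}^{d_i}$, $z\in E_i$; (2) $a_i$ is four times continuously differentiable and $a_i$ and all its derivatives up to order $4$ are of polynomial growth; (3) there are $\varrho_i>0$, $K_i>0$ with $f_i(z)\mathbf{1}_{\{|z|\le \varrho_i\}}\le K_i|z|^{1-d_i}$, and $\int |z|^l f_i(z)\,dz<\infty$ for every $l\ge 1$; (4) there is $c_{i,0}>0$ such that $\inf_{x}|c_i(x,z)|\ge c_{i,0}|z|$ for $z$ near the origin. Then, as $n\to\infty$, under $\mathbf{P}_{\Sigma_0}$, $$\hat\Sigma_n\overset{p}{\longrightarrow}\Sigma_0$$ and $$\sqrt{n}\,(\operatorname{vech}\hat\Sigma_n-\operatorname{vech}\Sigma_0)\overset{d}{\longrightarrow}N_{\bar p}\Bigl(0,\,2\mathbb{D}_p^{+}(\Sigma_0\otimes\Sigma_0)\mathbb{D}_p^{+\top}\Bigr).$$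
   Context: Model. Let $(\Omega,\mathcal{F},(\mathcal{F}_t)_{t\ge0},\mathbf{P})$ be a stochastic basis, $p_1,p_2,k_1,k_2$ positive integers with $k_1\le p_1$, $k_2\le p_2$; put $p=p_1+p_2$, $\bar p=p(p+1)/2$, $(d_1,d_2,d_3,d_4)=(k_1,p_1,p_2,k_2)$, $E_i=\mathbb{R}^{d_i}\setminus\{0\}$. The latent càdlàg $(\mathcal{F}_t)$-adapted processes $S^1=\xi$, $S^2=\delta$, $S^3=\varepsilon$, $S^4=\zeta$, with $S^i$ being $\mathbb{R}^{d_i}$-valued, satisfy $$dS^i_t=a_i(S^i_{t-})dt+\mathbf{S}_i\,dW_{i,t}+\int_{E_i}c_i(S^i_{t-},z)\,\mu_i(dt,dz),\qquad S^i_0=x_{i,0},$$ where $x_{i,0}\in\mathbb{R}^{d_i}$ is non-random, $a_i:\mathbb{R}^{d_i}\to\mathbb{R}^{d_i}$ and $c_i:\mathbb{R}^{d_i}\times E_i\to\mathbb{R}^{d_i}$ are (unknown) Borel functions, $\mathbf{S}_i\in\mathbb{R}^{d_i\times r_i}$ is constant, $W_i$ is an $r_i$-dimensional standard $(\mathcal{F}_t)$-Wiener process, and $\mu_i$ is a Poisson random measure on $\mathbb{R}_+\times E_i$ with compensator $f_i(z)\,dz\,dt$, $f_i=\lambda_{i,0}F_i$, $\lambda_{i,0}>0$, $F_i$ a probability density. For every $t\ge0$ the $\sigma$-fields $\mathcal{F}_t$, $\sigma(W_{i,u}-W_{i,t};u\ge t)$ and $\sigma(\mu_i(A\cap((t,\infty)\times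 E_i));A\subset\mathbb{R}_+\times E_i\text{ Borel})$, $i=1,2,3,4$, are independent. The observable processes are $X_{1,t}=\Lambda_1\xi_t+\delta_t\in\mathbb{R}^{p_1}$ and $X_{2,t}=\Lambda_2\eta_t+\varepsilon_t\in\mathbb{R}^{p_2}$, where the $k_2$-dimensional process $\eta$ satisfies $\eta_t=B_0\eta_t+\Gamma\xi_t+\zeta_t$; $X_t=(X_{1,t}^\top,X_{2,t}^\top)^\top$. Here $\Lambda_1\in\mathbb{R}^{p_1\times k_1}$, $\Lambda_2\in\mathbb{R}^{p_2\times k_2}$ have full column rank, $\Gamma\in\mathbb{R}^{k_2\times k_1}$, $B_0\in\mathbb{R}^{k_2\times k_2}$ has zero diagonal, and $\Psi=\mathbb{I}_{k_2}-B_0$ is non-singular. Put $\Sigma_{\xi\xi}=\mathbf{S}_1\mathbf{S}_1^\top$, $\Sigma_{\delta\delta}=\mathbf{S}_2\mathbf{S}_2^\top$, $\Sigma_{\varepsilon\varepsilon}=\mathbf{S}_3\mathbf{S}_3^\top$, $\Sigma_{\zeta\zeta}=\mathbf{S}_4\mathbf{S}_4^\top$, and $$\Sigma=\begin{pmatrix}\Sigma^{11}&\Sigma^{12}\\ \Sigma^{12\top}&\Sigma^{22}\end{pmatrix},\quad \Sigma^{11}=\Lambda_1\Sigma_{\xi\xi}\Lambda_1^\top+\Sigma_{\delta\delta},\quad \Sigma^{12}=\Lambda_1\Sigma_{\xi\xi}\Gamma^\top\Psi^{-1\top}\Lambda_2^\top,$$ $$\Sigma^{22}=\Lambda_2\Psi^{-1}(\Gamma\Sigma_{\xi\xi}\Gamma^\top+\Sigma_{\zeta\zeta})\Psi^{-1\top}\Lambda_2^\top+\Sigma_{\varepsilon\varepsilon}.$$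 $\Sigma$ is assumed positive definite. $\Sigma_0$ (with blocks $\Sigma_0^{11},\Sigma_0^{12},\Sigma_0^{22}$) denotes the value of $\Sigma$ at the true values of the model matrices, and $\mathbf{P}_{\Sigma_0}$ the corresponding law of $X$. Observations. $X_{t_i^n}$, $i=0,\dots,n$, with $t_i^n=ih_n$ and $T=nh_n$ fixed. $\Delta_i^nX=X_{t_i^n}-X_{t_{i-1}^n}$. The constants $D>0$ and $\rho\in[1/3,1/2)$ are fixed. Estimator. $N_n=\sum_{i=1}^n\mathbf{1}_{\{|\Delta_i^nX|\le Dh_n^\rho\}}$; $\tilde N_n=N_n$ if $N_n\ne0$ and $\tilde N_n=n$ if $N_n=0$; $$\hat\Sigma_n=\frac{1}{\tilde N_nh_n}\sum_{i=1}^n(\Delta_i^nX)(\Delta_i^nX)^\top\mathbf{1}_{\{|\Delta_i^nX|\le Dh_n^\rho\}}.$$ Notation. $\operatorname{vec}$ and $\operatorname{vech}$ are vectorization and half-vectorization; $\mathbb{D}_p$ is the $p^2\times\bar p$ duplication matrix, $\operatorname{vec}M=\mathbb{D}_p\operatorname{vech}M$ for symmetric $p\times p$ $M$; $\mathbb{D}_p^+=(\mathbb{D}_p^\top\mathbb{D}_p)^{-1}\mathbb{D}_p^\top$. $|\cdot|$ is the Euclidean (Frobenius) norm. $N_d(\mu,V)$ is the $d$-dimensional normal law. *)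

(* Defs.v *)
From HB Require Import structures.
From mathcomp Require Import all_boot all_order all_algebra.
From mathcomp Require Import all_classical all_reals all_analysis.
From mathcomp Require Import measurable_realfun mxtens.
Set Implicit Arguments.
Unset Strict Implicit.
Unset Printing Implicit Defensive.
Import Order.TTheory GRing.Theory Num.Theory.
Import numFieldNormedType.Exports.
Local Open Scope classical_set_scope.
Local Open Scope ring_scope.

Section measurable_mx.
Context {R : realType} {m n : nat}.

Definition mx_entry_system : set (set 'M[R]_(m, n)) :=
  [set A | exists i j, exists2 B : set R, measurable B &
    A = [set M : 'M[R]_(m, n) | B (M i j)]].

Let mx_set0 : <<s mx_entry_system >> set0.
Proof. exact: sigma_algebra0. Qed.
Let mx_setC A : <<s mx_entry_system >> A -> <<s mx_entry_system >> (~` A).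
Proof. exact: sigma_algebraC. Qed.
Let mx_bigcup (F : _^nat) : (forall i, <<s mx_entry_system >> (F i)) ->
  <<s mx_entry_system >> (\bigcup_i (F i)).
Proof. exact: sigma_algebra_bigcup. Qed.

HB.instance Definition _ := @isMeasurable.Build default_measure_display
  'M[R]_(m, n) <<s mx_entry_system >> mx_set0 mx_setC mx_bigcup.

Lemma measurable_entry i j :
  measurable_fun [set: 'M[R]_(m, n)] (fun M => M i j).
Proof.
move=> _ B mB; rewrite setTI; apply: sub_sigma_algebra.
by exists i, j, B.
Qed.

Lemma measurable_fun_mx d (T : measurableType d) (f : T -> 'M[R]_(m, n)) :
  (forall i j, measurable_fun setT (fun x => f x i j)) -> measurable_fun setT f.
Proof.
move=> mf; apply: (measurability mx_entry_system) => //.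
by move=> _ [_ [i [j [B mB ->]]] <-]; exact: mf.
Qed.

Lemma measurable_mxE :
  @measurable _ 'M[R]_(m, n) = <<s [set A : set 'M[R]_(m, n) | open A] >>.
Proof.
apply/seteqP; split; apply: smallest_sub; try exact: smallest_sigma_algebra.
  move=> _ [i [j [B mB ->]]].
  pose T := g_sigma_algebraType [set A : set 'M[R]_(m, n) | open A].
  suff : measurable_fun [set: T] (fun M : T => (M : 'M[R]_(m, n)) i j).
    by move=> /(_ measurableT B mB); rewrite setTI.
  apply: (measurability (@RGenOpens.G R)); first exact: RGenOpens.measurableE.
  move=> _ [_ [x [y ->]] <-]; rewrite setTI; apply: sub_sigma_algebra => /=.
  apply: open_comp; last exact: interval_open.
  by move=> M _; exact: coord_continuous.
move=> A /= oA.
pose box (qk : 'M[rat]_(m, n) * nat) : set 'M[R]_(m, n) :=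
  [set M | forall i j, `|ratr (qk.1 i j) - M i j| < qk.2.+1%:R^-1].
have mbox qk : measurable (box qk).
  have -> : box qk = \bigcap_(i in [set: 'I_m]) \bigcap_(j in [set: 'I_n])
      [set M : 'M[R]_(m, n) | `|ratr (qk.1 i j) - M i j| < qk.2.+1%:R^-1].
    apply/seteqP; split => M /=; first by move=> h i _ j _; exact: h.
    by move=> h i j; exact: (h i I j I).
  apply: fin_bigcap_measurable => // i _; apply: fin_bigcap_measurable => // j _.
  apply: sub_sigma_algebra; exists i, j.
  exists (ball (ratr (qk.1 i j) : R) qk.2.+1%:R^-1) => //.
  by apply: open_measurable; exact: ball_open.
have -> : A = \bigcup_(qk in [set qk | box qk `<=` A]) box qk.
  apply/seteqP; split => [M AM|M [qk]]; last exact.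
  have /nbhs_ballP[e /= e0 eA] : nbhs M A by exact: open_nbhs_nbhs.
  have [k ke] : exists k : nat, k.+1%:R^-1 < e / 2.
    have /ltr_add_invr[k] : 0 < e / 2 by rewrite divr_gt0.
    by rewrite add0r => ?; exists k.
  have hq i j : exists q : rat, `|ratr q - M i j| < k.+1%:R^-1.
    have /rat_in_itvoo[q] : M i j - k.+1%:R^-1 < M i j + k.+1%:R^-1.
      by rewrite ltrD2l gtrN // invr_gt0.
    by rewrite in_itv /= => qM; exists q; rewrite ltr_distl.
  pose Q := \matrix_(i, j) projT1 (cid (hq i j)).
  exists (Q, k) => /=; last by move=> i j; rewrite mxE; case: cid.
  move=> N NQ; apply: eA; split => // i j.
  have QM : `|M i j - ratr (Q i j)| < k.+1%:R^-1.
    by rewrite distrC mxE; case: cid.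
  rewrite /ball /= (le_lt_trans (ler_distD (ratr (Q i j)) _ _))//.
  by rewrite [e]splitr ltrD// (lt_trans _ ke)//; exact: NQ.
rewrite bigcup_mkcond; apply: countable_bigcupT_measurable => // qk.
by case: ifPn.
Qed.

End measurable_mx.

Section lebesgue_cV.
Context {R : realType}.

Definition cV_cons (d : nat) (xz : R * 'cV[R]_d) : 'cV[R]_d.+1 :=
  col_mx (xz.1%:M : 'cV[R]_1) xz.2.

Let cV_consEu d x z (k : 'I_1) j : @cV_cons d (x, z) (lshift d k) j = x.
Proof.
rewrite -[LHS]/(col_mx (x%:M : 'cV[R]_1) z (lshift d k) j) col_mxEu.
by rewrite mxE !ord1 eqxx mulr1n.
Qed.

Let cV_consEd d x z (k : 'I_d) j : @cV_cons d (x, z) (rshift 1 k) j = z k j.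
Proof.
by rewrite -[LHS]/(col_mx (x%:M : 'cV[R]_1) z (rshift 1 k) j) col_mxEd.
Qed.

Lemma measurable_cV_cons d : measurable_fun setT (@cV_cons d).
Proof.
apply: measurable_fun_mx => i j.
case: (@split_ordP 1 d i) => k ->.
  rewrite (_ : (fun _ => _) = fst) //; apply/funext => -[x z].
  exact: cV_consEu.
rewrite (_ : (fun _ => _) = (fun z : 'cV[R]_d => z k j) \o snd).
  by apply: measurableT_comp => //; exact: measurable_entry.
by apply/funext => -[x z]; exact: cV_consEd.
Qed.

Section step.
Variables (d : nat) (leb : {sigma_finite_measure set 'cV[R]_d -> \bar R}).
Local Open Scope ereal_scope.

Definition lebesgue_step : set 'cV[R]_d.+1 -> \bar R :=
  pushforward (@lebesgue_measure R \x leb) (@cV_cons d).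

Let push := measure_function_pushforward__canonical__measure_function_Measure
  (@lebesgue_measure R \x leb) (@measurable_cV_cons d).

HB.instance Definition _ := isMeasure.Build _ _ _ lebesgue_step
  (@measure0 _ _ _ push) (@measure_ge0 _ _ _ push)
  (@measure_semi_sigma_additive _ _ _ push).

Let step_sigma_finite : sigma_finite setT lebesgue_step.
Proof.
have /sigma_finiteP[F [TF ndF Foo]] := sigma_finiteT (@lebesgue_measure R).
have /sigma_finiteP[G [TG ndG Goo]] := sigma_finiteT leb.
pose h (v : 'cV[R]_d.+1) : R := v ord0 ord0.
pose u (v : 'cV[R]_d.+1) : 'cV[R]_d := \col_i v (lift ord0 i) ord0.
have mh : measurable_fun setT h by exact: measurable_entry.
have mu : measurable_fun setT u.
  apply: measurable_fun_mx => i j; rewrite /u.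
  by under eq_fun do rewrite mxE; exact: measurable_entry.
exists (fun k => h @^-1` F k `&` u @^-1` G k).
  rewrite predeqE => v; split => // _.
  have [k _ Fk] : (\bigcup_i F i) (h v) by rewrite -TF.
  have [l _ Gl] : (\bigcup_i G i) (u v) by rewrite -TG.
  exists (maxn k l) => //; split.
    have /subsetPset : (F k <= F (maxn k l))%O by apply/ndF/leq_maxl.
    exact.
  have /subsetPset : (G l <= G (maxn k l))%O by apply/ndG/leq_maxr.
  exact.
move=> k; have [mF Fk] := Foo k; have [mG Gk] := Goo k; split.
  apply: measurableI; rewrite -[X in measurable X]setTI.
    exact: mh.
  exact: mu.
rewrite /lebesgue_step /pushforward.
rewrite (_ : _ @^-1` _ = F k `*` G k).
  by rewrite product_measure1E// lte_mul_pinfty// ge0_fin_numE.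
have hK x z : h (cV_cons (x, z)) = x.
  rewrite /h -[RHS](cV_consEu x z ord0 ord0).
  by have -> : lshift d (ord0 : 'I_1) = ord0 :> 'I_d.+1 by apply/val_inj.
have uK x z : u (cV_cons (x, z)) = z.
  apply/colP => i; rewrite mxE -[RHS](cV_consEd x).
  by have -> : rshift 1 i = lift ord0 i :> 'I_d.+1 by apply/val_inj.
by apply/seteqP; split => -[x z] /=; rewrite hK uK.
Qed.

HB.instance Definition _ := Measure_isSigmaFinite.Build _ _ _ lebesgue_step
  step_sigma_finite.

End step.

(* Lebesgue measure on R^d as an iterated product measure. *)
Fixpoint lebesgue_cV (d : nat) : {sigma_finite_measure set 'cV[R]_d -> \bar R} :=
  if d is d'.+1 then lebesgue_step (lebesgue_cV d') else \d_(0 : 'cV[R]_0).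

End lebesgue_cV.

Section euclidean.
Context {R : realType}.

Definition enorm m n (A : 'M[R]_(m, n)) : R :=
  Num.sqrt (\sum_i \sum_j A i j ^+ 2).

Definition posdef n (A : 'M[R]_n) : Prop :=
  A^T = A /\ forall v : 'cV[R]_n, v != 0 -> 0 < (v^T *m A *m v) 0 0.

Definition punctured d : set 'cV[R]_d := ~` [set 0].

Definition mark_space d : set (R * 'cV[R]_d) := `[0, +oo[ `*` @punctured d.

Definition poly_growth_on d (D : set 'cV[R]_d) (h : 'cV[R]_d -> R) : Prop :=
  exists (C : R) (m : nat), forall x, D x -> `|h x| <= C * (1 + enorm x) ^+ m.

(* [partial [:: j1; ...; jk] a] is the iterated partial derivative of [a] with
   respect to the coordinates jk, ..., j1. *)
Definition partial d e (s : seq 'I_d) (a : 'cV[R]_d -> 'cV[R]_e) :=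
  foldr (fun j (h : 'cV[R]_d -> 'cV[R]_e) x => 'D_(delta_mx j 0) h x) a s.

Definition continuously_differentiable d e (k : nat)
    (a : 'cV[R]_d -> 'cV[R]_e) : Prop :=
  forall s : seq 'I_d, (size s <= k)%N ->
    continuous (partial s a) /\
    ((size s < k)%N ->
      forall j x, derivable (partial s a) x (delta_mx j 0)).

End euclidean.
Arguments punctured {R} d.
Arguments mark_space {R} d.

Section half_vectorization.

Lemma card_lower_triangle p :
  #|[pred ji : 'I_p * 'I_p | (ji.1 <= ji.2)%N]| = (p * p.+1)./2.
Proof.
transitivity (\sum_(j < p) \sum_(i < p | (j <= i)%N) 1)%N.
  by rewrite pair_big_dep -sum1_card; apply: eq_bigl => -[j i].
rewrite (eq_bigr (fun j : 'I_p => p - j)%N) => [|j _]; last first.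
  rewrite sum1_card -(card_ord (p - j)).
  have h (k : 'I_(p - j)) : (j + k < p)%N by rewrite -ltn_subRL.
  rewrite -(card_imset _ (f := fun k => Ordinal (h k))); last first.
    by move=> k l [] /addnI ?; exact/val_inj.
  apply: eq_card => i; rewrite unfold_in; apply/idP/imsetP => [ji|[k _ ->]] /=.
    have kp : (i - j < p - j)%N by rewrite ltn_sub2r // (leq_ltn_trans ji).
    by exists (Ordinal kp) => //; apply/val_inj; rewrite /= subnKC.
  exact: leq_addr.
rewrite -(big_mkord xpredT (fun j => p - j)%N) big_nat_rev /= add0n.
rewrite (eq_big_nat _ _ (F2 := fun j => j.+1)) => [|j /andP[_ jp]]; last first.
  by rewrite subKn.
transitivity (\sum_(0 <= j < p.+1) j)%N; first by rewrite big_nat_recl.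
by rewrite bin2_sum bin2 mulnC.
Qed.

(* (column, row) of the k-th entry of vech; [enum] lists the pairs
   lexicographically, so that columns are stacked one after the other. *)
Definition vech_index p (k : 'I_(p * p.+1)./2) : 'I_p * 'I_p :=
  enum_val (cast_ord (esym (card_lower_triangle p)) k).

Context {R : realType}.

(* The k-th entry of vec is in column k %/ m and row k %% m. *)
Definition vec m n (M : 'M[R]_(m, n)) : 'cV[R]_(n * m) :=
  \col_k M (mxtens_unindex k).2 (mxtens_unindex k).1.

Definition vech p (M : 'M[R]_p) : 'cV[R]_(p * p.+1)./2 :=
  \col_k M (vech_index k).2 (vech_index k).1.

Definition duplication p : 'M[R]_(p * p, (p * p.+1)./2) :=
  \matrix_(r, k) ((mxtens_unindex r == vech_index k) ||
                  (mxtens_unindex r == ((vech_index k).2, (vech_index k).1)))%:R.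

Lemma vec_duplication p (M : 'M[R]_p) :
  M^T = M -> vec M = duplication p *m vech M.
Proof.
move=> symM; apply/colP => r; rewrite !mxE.
set ji := mxtens_unindex r.
pose lo : 'I_p * 'I_p := if (ji.1 <= ji.2)%N then ji else (ji.2, ji.1).
have lolo : lo \in [pred ji : 'I_p * 'I_p | (ji.1 <= ji.2)%N].
  by rewrite inE /lo; case: ifPn => //=; rewrite -ltnNge => /ltnW.
pose k := cast_ord (card_lower_triangle p) (enum_rank_in lolo lo).
have ek : vech_index k = lo by rewrite /vech_index cast_ordK enum_rankK_in.
rewrite (bigD1 k) //= big1 ?addr0 => [|l lk]; last first.
  rewrite !mxE; case: (boolP (_ || _)) => [jil|_]; last by rewrite mul0r.
  have ll : ((vech_index l).1 <= (vech_index l).2)%N.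
    by have := enum_valP (cast_ord (esym (card_lower_triangle p)) l).
  suff : l = k by move/eqP; rewrite (negPf lk).
  suff : vech_index l = vech_index k by move=> /enum_val_inj /cast_ord_inj.
  rewrite ek /lo /ji; case/orP: jil => /eqP ->; first by rewrite ll; case: vech_index.
  rewrite /=; case: ifPn => [ll'|]; last by case: vech_index.
  have e : (vech_index l).1 = (vech_index l).2.
    by apply/val_inj/eqP; rewrite eqn_leq ll ll'.
  by rewrite e; case: vech_index e => ? ? /= ->.
rewrite !mxE ek /lo /ji; case: ifPn => _ /=; first by rewrite eqxx mul1r.
rewrite [X in _ || X](_ : _ = true) ?orbT ?mul1r; last exact/eqP.
by rewrite -[in LHS]symM mxE.
Qed.

Definition duplication_pinv p : 'M[R]_((p * p.+1)./2, p * p) :=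
  invmx ((duplication p)^T *m duplication p) *m (duplication p)^T.

End half_vectorization.

Section gaussian_law.
Context {R : realType}.

(* [normal_prob m 0] is not the Dirac measure at [m], hence the case split. *)
Definition normal1 (m v : R) (B : set R) : \bar R :=
  if v == 0 then \d_m B else normal_prob m (Num.sqrt v) B.

(* nu is the normal law N_d(m, V): every linear form u^T x is normal under nu
   with mean u^T m and variance u^T V u. *)
Definition is_normal_law d (nu : set 'cV[R]_d -> \bar R)
    (m : 'cV[R]_d) (V : 'M[R]_d) : Prop :=
  forall (u : 'cV[R]_d) (B : set R), measurable B ->
    nu [set x | B ((u^T *m x) 0 0)] =
    normal1 ((u^T *m m) 0 0) ((u^T *m V *m u) 0 0) B.

End gaussian_law.

Section convergence.
Context d (Omega : measurableType d) (R : realType) (P : probability Omega R).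

Definition cvg_in_probability m n (Y : nat -> Omega -> 'M[R]_(m, n))
    (y : 'M[R]_(m, n)) : Prop :=
  forall eps : R, 0 < eps ->
    P [set w | eps < enorm (Y k w - y)] @[k --> \oo] --> 0%E.

Definition cvg_in_law q (Z : nat -> Omega -> 'cV[R]_q)
    (nu : probability 'cV[R]_q R) : Prop :=
  forall f : 'cV[R]_q -> R, continuous f -> (exists M, forall x, `|f x| <= M) ->
    (\int[P]_w (f (Z k w))%:E)%E @[k --> \oo] --> (\int[nu]_x (f x)%:E)%E.

(* [is_normal_law] determines nu. *)
Definition cvg_in_law_normal q (Z : nat -> Omega -> 'cV[R]_q)
    (m : 'cV[R]_q) (V : 'M[R]_q) : Prop :=
  exists2 nu : probability 'cV[R]_q R, is_normal_law nu m V & cvg_in_law Z nu.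

End convergence.

Section stochastic_basis.
Context dsp (Omega : measurableType dsp) (R : realType) (P : probability Omega R).

Definition is_filtration (F : R -> set (set Omega)) : Prop :=
  (forall t, 0 <= t -> sigma_algebra setT (F t) /\ F t `<=` measurable) /\
  (forall s t, 0 <= s -> s <= t -> F s `<=` F t).

(* Sub-families need no separate treatment: setT belongs to every sigma-field. *)
Definition independent_sigma_fields (I : finType)
    (G : I -> set (set Omega)) : Prop :=
  forall A : I -> set Omega, (forall i, G i (A i)) ->
    P (\bigcap_(i in [set: I]) A i) = (\prod_(i : I) P (A i))%E.

Definition adapted d (F : R -> set (set Omega)) (Y : R -> Omega -> 'cV[R]_d) :=
  forall t, 0 <= t -> g_sigma_algebra_preimage (Y t) `<=` F t.

Record is_wiener r (F : R -> set (set Omega)) (W : R -> Omega -> 'cV[R]_r) :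
    Prop := {
  wiener_adapted : adapted F W ;
  wiener_start : {ae P, forall w, W 0 w = 0} ;
  wiener_continuous :
    {ae P, forall w, {within `[0, +oo[, continuous (fun t : R => W t w)}} ;
  wiener_increment : forall s t, 0 <= s -> s <= t ->
    is_normal_law (pushforward P (fun w => W t w - W s w)) 0 (t - s)%:M ;
  wiener_independent : forall s t, 0 <= s -> s <= t ->
    independent_sigma_fields (fun b : bool => if b then F s else
      g_sigma_algebra_preimage (fun w => W t w - W s w)) }.

Definition wiener_future r (W : R -> Omega -> 'cV[R]_r) (t : R) :
    set (set Omega) :=
  <<s \bigcup_(u in `[t, +oo[) g_sigma_algebra_preimage
        (fun w => W u w - W t w) >>.

Definition intensity d (f : 'cV[R]_d -> R) (A : set (R * 'cV[R]_d)) : \bar R :=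
  (\int[@lebesgue_measure R \x lebesgue_cV d]_(tz in A) (f tz.2)%:E)%E.

(* The nat argument of [poisson_prob] plays no role. *)
Record is_poisson_random_measure d (F : R -> set (set Omega))
    (mu : Omega -> {measure set (R * 'cV[R]_d) -> \bar R})
    (f : 'cV[R]_d -> R) : Prop := {
  prm_measurable : forall A : set (R * 'cV[R]_d), measurable A -> A `<=` mark_space d ->
    measurable_fun setT (fun w => mu w A) ;
  prm_adapted : forall (t : R) (A : set (R * 'cV[R]_d)), 0 <= t -> measurable A ->
    A `<=` `[0, t] `*` punctured d ->
    g_sigma_algebra_preimage (fun w => mu w A) `<=` F t ;
  prm_poisson : forall A : set (R * 'cV[R]_d), measurable A -> A `<=` mark_space d ->
    (intensity f A < +oo)%E -> forall k : nat,
    P [set w | mu w A = k%:R%:E] =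
    poisson_prob (fine (intensity f A)) 0%N [set k] ;
  prm_infinite : forall A : set (R * 'cV[R]_d), measurable A -> A `<=` mark_space d ->
    intensity f A = +oo%E -> {ae P, forall w, mu w A = +oo%E} ;
  prm_independent : forall (m : nat) (A : 'I_m -> set (R * 'cV[R]_d)),
    (forall j, measurable (A j)) -> (forall j, A j `<=` mark_space d) ->
    trivIset setT A ->
    independent_sigma_fields
      (fun j => g_sigma_algebra_preimage (fun w => mu w (A j))) }.

Definition poisson_future d
    (mu : Omega -> {measure set (R * 'cV[R]_d) -> \bar R}) (t : R) :
    set (set Omega) :=
  <<s \bigcup_(A in [set A : set (R * 'cV[R]_d) | measurable A /\ A `<=` mark_space d])
        g_sigma_algebra_preimage
          (fun w => mu w (A `&` (`]t, +oo[ `*` punctured d))) >>.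

Definition cadlag d (x : R -> 'cV[R]_d) : Prop :=
  forall t, 0 <= t ->
    (x s @[s --> t^'+] --> x t) /\ (0 < t -> cvg (x s @[s --> t^'-])).

Definition left_limit d (x : R -> 'cV[R]_d) (t : R) : 'cV[R]_d :=
  lim (x s @[s --> t^'-]).

(* dS_t = a(S_{t-}) dt + Sg dW_t + \int_E c(S_{t-}, z) mu(dt, dz), S_0 = x0.
   As Sg is constant, the Wiener integral is Sg W_t. Both other integrals are
   pathwise Lebesgue integrals, taken entrywise. *)
Definition solves_sde d r (a : 'cV[R]_d -> 'cV[R]_d) (Sg : 'M[R]_(d, r))
    (c : 'cV[R]_d -> 'cV[R]_d -> 'cV[R]_d) (x0 : 'cV[R]_d)
    (W : R -> Omega -> 'cV[R]_r)
    (mu : Omega -> {measure set (R * 'cV[R]_d) -> \bar R})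
    (S : R -> Omega -> 'cV[R]_d) : Prop :=
  {ae P, forall w, forall t, 0 <= t -> S t w = x0
    + \col_k (\int[@lebesgue_measure R]_(s in `[0%R, t])
                a (left_limit (S ^~ w) s) k 0)
    + Sg *m W t w
    + \col_k (\int[mu w]_(sz in `]0%R, t] `*` punctured d)
                c (left_limit (S ^~ w) sz.1) sz.2 k 0) }.

End stochastic_basis.

Section latent_processes.
Context dsp (Omega : measurableType dsp) (R : realType) (P : probability Omega R).

Record is_density d (f : 'cV[R]_d -> R) : Prop := {
  density_measurable : measurable_fun (punctured d) f ;
  density_ge0 : forall z, punctured d z -> 0 <= f z ;
  density_integral : (\int[lebesgue_cV d]_(z in punctured d) (f z)%:E)%E = 1%E }.

Record is_latent_process d r (F : R -> set (set Omega))
    (a : 'cV[R]_d -> 'cV[R]_d) (Sg : 'M[R]_(d, r))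
    (c : 'cV[R]_d -> 'cV[R]_d -> 'cV[R]_d) (lambda0 : R) (dens : 'cV[R]_d -> R)
    (x0 : 'cV[R]_d) (W : R -> Omega -> 'cV[R]_r)
    (mu : Omega -> {measure set (R * 'cV[R]_d) -> \bar R})
    (S : R -> Omega -> 'cV[R]_d) : Prop := {
  latent_drift : measurable_fun setT a ;
  latent_jump :
    measurable_fun ([set: 'cV[R]_d] `*` punctured d) (fun xz => c xz.1 xz.2) ;
  latent_rate : 0 < lambda0 ;
  latent_density : is_density dens ;
  latent_wiener : is_wiener P F W ;
  latent_poisson : is_poisson_random_measure P F mu (fun z => lambda0 * dens z) ;
  latent_adapted : adapted F S ;
  latent_cadlag : forall w, cadlag (S ^~ w) ;
  latent_sde : solves_sde P a Sg c x0 W mu S }.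

Definition noise_sigma_fields (d r : 'I_4 -> nat) (F : R -> set (set Omega))
    (W : forall i, R -> Omega -> 'cV[R]_(r i))
    (mu : forall i, Omega -> {measure set (R * 'cV[R]_(d i)) -> \bar R})
    (t : R) (k : option ('I_4 + 'I_4)) : set (set Omega) :=
  match k with
  | None => F t
  | Some (inl i) => wiener_future (W i) t
  | Some (inr i) => poisson_future (mu i) t
  end.

End latent_processes.

Section regularity_conditions.
Context {R : realType} {d : nat}.

Definition lipschitz_growth (a : 'cV[R]_d -> 'cV[R]_d)
    (c : 'cV[R]_d -> 'cV[R]_d -> 'cV[R]_d) : Prop :=
  exists (L : R) (g : 'cV[R]_d -> R),
    [/\ 0 < L,
        forall z, punctured d z -> 0 < g z,
        poly_growth_on (punctured d) g,
        forall x y, enorm (a x - a y) <= L * enorm (x - y) &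
        forall x y z, punctured d z ->
          enorm (c x z - c y z) <= g z * enorm (x - y) /\
          enorm (c x z) <= g z * (1 + enorm x)].

Definition smooth_drift (a : 'cV[R]_d -> 'cV[R]_d) : Prop :=
  continuously_differentiable 4 a /\
  forall s : seq 'I_d, (size s <= 4)%N ->
    poly_growth_on setT (fun x => enorm (partial s a x)).

Definition jump_intensity_bounds (f : 'cV[R]_d -> R) : Prop :=
  (exists rho K : R, [/\ 0 < rho, 0 < K &
     forall z, punctured d z -> enorm z <= rho ->
       f z <= K * enorm z ^ (1 - d%:Z)]) /\
  (forall l : nat, (1 <= l)%N ->
     (\int[lebesgue_cV d]_(z in punctured d) (enorm z ^+ l * f z)%:E < +oo)%E).

Definition jump_lower_bound (c : 'cV[R]_d -> 'cV[R]_d -> 'cV[R]_d) : Prop :=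
  exists2 c0 : R, 0 < c0 &
    \forall z \near (0 : 'cV[R]_d)^',
      c0 * enorm z <= inf [set enorm (c x z) | x in [set: 'cV[R]_d]].

End regularity_conditions.

(* Indices of xi, delta, epsilon and zeta in the family of latent processes. *)
Definition iXi : 'I_4 := @Ordinal 4 0 isT.
Definition iDelta : 'I_4 := @Ordinal 4 1 isT.
Definition iEpsilon : 'I_4 := @Ordinal 4 2 isT.
Definition iZeta : 'I_4 := @Ordinal 4 3 isT.

Definition latent_dim (k1 p1 p2 k2 : nat) (i : 'I_4) : nat :=
  nth 0%N [:: k1; p1; p2; k2] i.

Section structural_model.
Context {R : realType}.

Definition model_covariance p1 p2 k1 k2 (L1 : 'M[R]_(p1, k1))
    (L2 : 'M[R]_(p2, k2)) (G : 'M[R]_(k2, k1)) (Psi : 'M[R]_k2)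
    (Sxx : 'M[R]_k1) (Sdd : 'M[R]_p1) (See : 'M[R]_p2) (Szz : 'M[R]_k2) :
    'M[R]_(p1 + p2) :=
  let S11 := L1 *m Sxx *m L1^T + Sdd in
  let S12 := L1 *m Sxx *m G^T *m (invmx Psi)^T *m L2^T in
  let S22 := L2 *m invmx Psi *m (G *m Sxx *m G^T + Szz) *m (invmx Psi)^T *m L2^T
             + See in
  block_mx S11 S12 S12^T S22.

End structural_model.

Section estimator.
Context {Omega : Type} {R : realType} {p : nat}.
Variables (X : R -> Omega -> 'cV[R]_p) (T D rho : R) (n : nat) (w : Omega).

Definition mesh : R := T / n%:R.

Definition increment (i : nat) : 'cV[R]_p :=
  X (i%:R * mesh) w - X (i.-1%:R * mesh) w.

Definition below_threshold (i : nat) : bool :=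
  enorm (increment i) <= D * mesh `^ rho.

Definition kept_count : nat := (\sum_(1 <= i < n.+1) below_threshold i)%N.

Definition kept_count_or_n : nat := if kept_count == 0%N then n else kept_count.

Definition Sigma_hat : 'M[R]_p :=
  (kept_count_or_n%:R * mesh)^-1 *:
    \sum_(1 <= i < n.+1 | below_threshold i) increment i *m (increment i)^T.

End estimator.

(* Main.v *)
(* Away from its jumps, of which there are almost surely finitely many on
   [0, T], X moves by a pathwise bounded drift plus the Gaussian process
   G = \sum_i M_i S_i W_i, whose increments over the grid are independent with
   law N(0, h Sigma0). On the event that all increments of G are at most
   D h^rho / (2 (p + 1)), whose probability tends to 1 by high Gaussian moments,
   every jump-free interval is kept, and the estimator differs from the realised
   covariance Q_n of G by o(n^(-1/2)): the jump intervals that are kept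
   contribute O(h^(2 rho)), and the cross terms between drift and noise are
   treated by summation by parts against a Lipschitz regularisation of the
   drift.
   The central limit theorem for Q_n bounds E cos(t + S_n / sqrt n) recursively
   in the number of summands. Convergence of these expectations suffices because
   polynomials in sines, dense on boxes by Bernstein's theorem, are linear
   combinations of functions cos(t + u^T x).
   The stability and the moments of Gaussian laws are read off the increments of
   one coordinate of a Wiener process. *)
Require Import Defs.
From HB Require Import structures.
From mathcomp Require Import all_boot all_order all_algebra.
From mathcomp Require Import all_classical all_reals all_analysis.
From mathcomp Require Import measurable_realfun mxtens.
From mathcomp Require Import ring lra.
Set Implicit Arguments.
Unset Strict Implicit.
Unset Printing Implicit Defensive.
Import Order.TTheory GRing.Theory Num.Theory.
Import numFieldNormedType.Exports.
Local Open Scope classical_set_scope.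
Local Open Scope ring_scope.

(** * Independence and product laws *)

(** The cross terms between drift and noise are the main obstacle: there are n of them of size
    h^(3/2), so that after multiplication by sqrt n their absolute values add up to order 1, and
    only cancellation makes them vanish. The cancellation is found on each path separately: partial
    sums of increments of G are values of the path of G, hence bounded. The index from which such
    pathwise estimates hold depends on the path, and limsup sets turn them into estimates in
    probability. As the realised covariance is only tight, the pathwise estimates carry the factor 1
    + tr Q_n, which is absorbed afterwards. The condition rho < 1/2 lifts the threshold above all n
    Gaussian increments at once, whereas rho >= 1/3 makes sqrt n h^(2 rho) vanish. Real cosines with
    a free phase play the part of characteristic functions: the phase makes sines, and products of
    such functions, combinations of functions of the same type. A Wiener coordinate is available
    because a positive definite Sigma0 cannot arise without Gaussian noise. *)

Section independence.
Context dsp (Omega : measurableType dsp) (R : realType) (P : probability Omega R).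
Local Open Scope ereal_scope.

Definition indep (G H : set (set Omega)) : Prop :=
  forall A B, G A -> H B -> P (A `&` B) = P A * P B.

(** For fixed [A], the restriction of [P] to [A] and the multiple of [P] by [P A] are finite
    measures that agree on the pi-system [H] and on the whole space, hence on the sigma-algebra
    generated by [H]. *)
Lemma indep_generated (G H : set (set Omega)) :
  G `<=` measurable -> H `<=` measurable -> setI_closed H ->
  indep G H -> indep G <<s H >>.
Proof.
move=> Gm Hm HI GH A B GA HB; have mA := Gm _ GA.
pose m2 : {measure set Omega -> \bar R} :=
  mscale (NngNum (fine_ge0 (measure_ge0 P A))) P.
pose m1 : {measure set Omega -> \bar R} := mrestr P mA.
have key : forall X, <<s H >> X -> m1 X = m2 X.
  have -> : H = [set X | H X /\ X `<=` setT].
    by apply/seteqP; split => [X|X []].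
  apply: (g_sigma_algebra_measure_unique_trace H setT) => //.
  - by move=> X [/Hm].
  - by move=> X Y [HX _] [HY _]; split => //; exact: HI.
  - rewrite /m1 /m2 /= /mrestr /mscale /= setTI.
    by rewrite probability_setT mule1 fineK// fin_num_measure.
  - move=> X [HX _]; rewrite /m1 /m2 /= /mrestr /mscale /= fineK ?fin_num_measure//.
    by rewrite setIC; exact: GH.
  - by rewrite /m1 /= /mrestr (le_lt_trans (probability_le1 _ _)) ?ltry//; exact: measurableI.
have := key _ HB; rewrite /m1 /m2 /= /mrestr /mscale /= fineK ?fin_num_measure//.
by rewrite setIC.
Qed.

End independence.

Section product_law.
Context dsp (Omega : measurableType dsp) (R : realType) (P : probability Omega R).
Context d1 d2 (T1 : measurableType d1) (T2 : measurableType d2).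
Local Open Scope ereal_scope.

Definition indep_rv (U : Omega -> T1) (Y : Omega -> T2) : Prop :=
  forall A B, measurable A -> measurable B ->
    P (U @^-1` A `&` Y @^-1` B) = P (U @^-1` A) * P (Y @^-1` B).

Lemma indep_rv_law (U : {mfun Omega >-> T1}) (Y : {mfun Omega >-> T2}) X :
  indep_rv U Y -> measurable X ->
  P ((fun w => (U w, Y w)) @^-1` X) =
  (distribution P U \x distribution P Y) X.
Proof.
move=> UY mX.
have mUY : measurable_fun setT (fun w => (U w, Y w)) by exact/measurable_fun_pair.
pose m' := measure_function_pushforward__canonical__measure_function_Measure P mUY.
rewrite (@product_measure_unique _ _ _ _ _ _ _ m')// => A B mA mB.
Qed.
End product_law.

Section product_expectation.
Context dsp (Omega : measurableType dsp) (R : realType) (P : probability Omega R).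
Local Open Scope ereal_scope.

(** The joint law is the product of the marginals, so this is Fubini's theorem. Tonelli's theorem
    for |x y| comes first and yields the integrability of the product. *)
Lemma integral_indepM (U Y : Omega -> R) :
  indep_rv P U Y ->
  P.-integrable setT (EFin \o U) -> P.-integrable setT (EFin \o Y) ->
  P.-integrable setT (EFin \o (U \* Y)%R) /\
  (\int[P]_w (U w * Y w) = (\int[P]_w U w) * (\int[P]_w Y w))%R.
Proof.
move=> UY iU iY.
have mU : measurable_fun setT U by apply/measurable_EFinP; case/integrableP : iU.
have mY : measurable_fun setT Y by apply/measurable_EFinP; case/integrableP : iY.
pose U' : {mfun Omega >-> R} := HB.pack U (isMeasurableFun.Build _ _ _ _ U mU).
pose Y' : {mfun Omega >-> R} := HB.pack Y (isMeasurableFun.Build _ _ _ _ Y mY).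
pose m1 := distribution P U'; pose m2 := distribution P Y'.
pose f (x : R * R) : \bar R := (x.1 * x.2)%:E.
have mf : measurable_fun setT f.
  by apply/measurable_EFinP; apply: measurable_funM; [exact: measurable_fst|exact: measurable_snd].
have mUY : measurable_fun setT (fun w => (U' w, Y' w)) by exact/measurable_fun_pair.
pose m' : {measure set (R * R) -> \bar R} :=
  measure_function_pushforward__canonical__measure_function_Measure P mUY.
have E X : measurable X -> X `<=` setT -> m' X = (m1 \x m2) X.
  by move=> mX _; rewrite -indep_rv_law.
have mE : measurable_fun setT (@EFin R).
  by apply/measurable_EFinP; exact: measurable_id.
have mE1 : measurable_fun setT (fun x : R => `|x%:E|) by exact: measurableT_comp.
have iabs (V : {mfun Omega >-> R}) : P.-integrable setT (EFin \o V) ->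
    \int[distribution P V]_x `|x%:E| = (\int[P]_w `|V w|)%:E.
  move=> iV; rewrite ge0_integral_distribution//.
  by rewrite /Rintegral fineK //; apply: integrable_fin_num => //; exact: (integrable_abse iV).
have id (V : {mfun Omega >-> R}) : P.-integrable setT (EFin \o V) ->
    \int[distribution P V]_x x%:E = (\int[P]_w V w)%:E.
  move=> iV; rewrite integral_distribution//.
  by rewrite /Rintegral fineK //; apply: integrable_fin_num.
have i12 : (m1 \x m2).-integrable setT f.
  apply/integrable12ltyP => //.
  under eq_integral => x _.
    under eq_integral => y _ do rewrite /f/= normrM EFinM.
    rewrite ge0_integralZl//.
    rewrite (iabs Y' iY) muleC.
    over.
  rewrite ge0_integralZl//=; last by rewrite lee_fin; apply: Rintegral_ge0.
  by rewrite (iabs U' iU) -EFinM ltry.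
have i' : m'.-integrable setT f.
  by apply/integrableP; split => //; rewrite (eq_measure_integral (m1 \x m2)%E) //; case/integrableP : i12.
have iUY : P.-integrable setT (EFin \o (U \* Y)%R).
  apply/integrableP; split; first exact/measurable_EFinP/measurable_funM.
  case/integrableP : i' => _; rewrite ge0_integral_pushforward//.
  exact: measurableT_comp.
split=> //.
rewrite {1}/Rintegral.
have -> : \int[P]_w (U w * Y w)%:E = \int[m']_x f x.
  by rewrite integral_pushforward.
rewrite (eq_measure_integral (m1 \x m2)%E)//.
rewrite -integral12_prod_meas1//.
transitivity (fine (\int[m1]_x (x%:E * (\int[P]_w Y w)%R%:E))).
  congr fine; apply: eq_integral => x _; rewrite /fubini_F /f /=.
  under eq_integral do rewrite EFinM.
  rewrite integralZl//; first by rewrite (id Y').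
  apply/integrableP; split => //.
  by rewrite (iabs Y' iY) ltry.
rewrite integralZr//; last first.
  apply/integrableP; split => //.
  by rewrite (iabs U' iU) ltry.
by rewrite (id U').
Qed.

End product_expectation.

(** * Centred Gaussian variables and Brownian increments *)

Section law_transfer.
Context d1 d2 (O1 : measurableType d1) (O2 : measurableType d2) (R : realType).
Variables (P1 : probability O1 R) (P2 : probability O2 R).
Context d (T : measurableType d).
Local Open Scope ereal_scope.

Definition same_law (U : O1 -> T) (Y : O2 -> T) : Prop :=
  forall B, measurable B -> P1 (U @^-1` B) = P2 (Y @^-1` B).

(** The positive and the negative part of [f] are transported separately, so that [f] may fail to be
    integrable. *)
Lemma same_law_integral (U : O1 -> T) (Y : O2 -> T) (f : T -> \bar R) :
  measurable_fun setT U -> measurable_fun setT Y -> same_law U Y ->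
  measurable_fun setT f ->
  \int[P1]_w f (U w) = \int[P2]_w f (Y w).
Proof.
move=> mU mY UY mf.
have pos (g : T -> \bar R) : measurable_fun setT g -> (forall x, 0 <= g x) ->
    \int[P1]_w g (U w) = \int[P2]_w g (Y w).
  move=> mg g0.
  transitivity (\int[pushforward P1 U]_x g x).
    by rewrite ge0_integral_pushforward.
  rewrite (eq_measure_integral (pushforward P2 Y)); last by move=> A mA _; exact: UY.
  by rewrite ge0_integral_pushforward.
rewrite [LHS]integralE [RHS]integralE; congr (_ - _).
  under eq_integral do rewrite funeposE -(funeposE f).
  under [RHS]eq_integral do rewrite funeposE -(funeposE f).
  exact: (pos f^\+ (measurable_funepos mf) (funepos_ge0 _)).
under eq_integral do rewrite funenegE -(funenegE f).
under [RHS]eq_integral do rewrite funenegE -(funenegE f).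
exact: (pos f^\- (measurable_funeneg mf) (funeneg_ge0 _)).
Qed.

End law_transfer.

Lemma same_law_pair d1 d2 (O1 : measurableType d1) (O2 : measurableType d2)
    (R : realType) (P1 : probability O1 R) (P2 : probability O2 R)
    (U1 Y1 : O1 -> R) (U2 Y2 : O2 -> R) :
  measurable_fun setT U1 -> measurable_fun setT Y1 ->
  measurable_fun setT U2 -> measurable_fun setT Y2 ->
  indep_rv P1 U1 Y1 -> indep_rv P2 U2 Y2 ->
  same_law P1 P2 U1 U2 -> same_law P1 P2 Y1 Y2 ->
  same_law P1 P2 (fun w => (U1 w, Y1 w)) (fun w => (U2 w, Y2 w)).
Proof.
move=> mU1 mY1 mU2 mY2 i1 i2 sU sY X mX.
have mUY1 : measurable_fun setT (fun w => (U1 w, Y1 w)) by exact/measurable_fun_pair.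
pose U' : {mfun O2 >-> R} := HB.pack U2 (isMeasurableFun.Build _ _ _ _ U2 mU2).
pose Y' : {mfun O2 >-> R} := HB.pack Y2 (isMeasurableFun.Build _ _ _ _ Y2 mY2).
rewrite (@indep_rv_law _ _ _ P2 _ _ _ _ U' Y')//.
pose m' := measure_function_pushforward__canonical__measure_function_Measure P1 mUY1.
rewrite (@product_measure_unique _ _ _ _ _ _ _ m')// => A B mA mB /=.
change (P1 (U1 @^-1` A `&` Y1 @^-1` B) = P2 (U2 @^-1` A) * P2 (Y2 @^-1` B))%E.
by rewrite i1// sU// sY.
Qed.

Section gaussian.
Context dsp (Omega : measurableType dsp) (R : realType) (P : probability Omega R).

(** [v] is the variance, not the standard deviation; [v = 0] gives the Dirac mass at 0. *)
Definition gaussian (Y : Omega -> R) (v : R) : Prop :=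
  measurable_fun setT Y /\
  forall B, measurable B -> P (Y @^-1` B) = normal1 0 v B.

End gaussian.

Lemma gaussian_same_law d1 d2 (O1 : measurableType d1) (O2 : measurableType d2)
    (R : realType) (P1 : probability O1 R) (P2 : probability O2 R)
    (Y1 : O1 -> R) (Y2 : O2 -> R) v1 v2 :
  gaussian P1 Y1 v1 -> gaussian P2 Y2 v2 -> v1 = v2 -> same_law P1 P2 Y1 Y2.
Proof. by move=> [_ h1] [_ h2] e B mB; rewrite (h1 _ mB) (h2 _ mB) e. Qed.

(* A one-dimensional Brownian motion; on such a basis all centred Gaussian laws
   and their convolution identities can be read off the increments. *)
Record brownian dsp (Omega : measurableType dsp) (R : realType)
    (P : probability Omega R) (F : R -> set (set Omega)) (B : R -> Omega -> R) : Prop := {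
  brownian_measurable : forall t, 0 <= t -> measurable_fun setT (B t) ;
  brownian_adapted : forall t, 0 <= t -> forall A, measurable A -> F t (B t @^-1` A) ;
  brownian_gaussian : forall c s t, 0 <= s -> s <= t ->
    gaussian P (fun w => c * (B t w - B s w)) (c ^+ 2 * (t - s)) ;
  brownian_indep : forall s t, 0 <= s -> s <= t ->
    forall A C, F s A -> measurable C ->
    P (A `&` (fun w => B t w - B s w) @^-1` C) =
    (P A * P ((fun w => B t w - B s w)%R @^-1` C))%E }.

Section gaussian_sum.
Context dsp (Omega : measurableType dsp) (R : realType) (P : probability Omega R).
Variables (F : R -> set (set Omega)) (B : R -> Omega -> R).
Hypothesis filtF : is_filtration F.
Hypothesis brB : brownian P F B.

(** The pair has the law of two successive increments of [B], over [0, a] and [a, a + b], and these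
    add up to a single increment, which is normal. The variables may live on any space; [B] only
    lends its law. *)
Lemma gaussianD d2 (O2 : measurableType d2) (P2 : probability O2 R)
    (U Y : O2 -> R) (a b : R) : 0 <= a -> 0 <= b ->
  gaussian P2 U a -> gaussian P2 Y b -> indep_rv P2 U Y ->
  gaussian P2 (fun w => U w + Y w) (a + b).
Proof.
move=> a0 b0 [mU gU] [mY gY] UY; split; first exact: measurable_funD.
move=> C mC.
pose U' w := B a w - B 0 w; pose Y' w := B (a + b) w - B a w.
have ab : 0 <= a + b by rewrite addr_ge0.
have mU' : measurable_fun setT U' by apply: measurable_funB; apply: (brownian_measurable brB).
have mY' : measurable_fun setT Y' by apply: measurable_funB; apply: (brownian_measurable brB).
have gau s t v : 0 <= s -> s <= t -> t - s = v ->
    gaussian P (fun w => B t w - B s w) v.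
  move=> s0 st <-; have := brownian_gaussian brB 1 s0 st.
  by rewrite expr1n mul1r; under eq_fun do rewrite mul1r.
have [_ gU'] := gau 0 a a (lexx _) a0 (subr0 a).
have [_ gY'] : gaussian P Y' b.
  by apply: gau => //; rewrite ?lerDl// addrAC subrr add0r.
have ind' : indep_rv P U' Y'.
  move=> A1 A2 mA1 mA2; apply: (brownian_indep brB) => //; first by rewrite lerDl.
  have F0 := brownian_adapted brB (lexx 0); have Fa := brownian_adapted brB a0.
  have [sF _] := filtF.1 a a0.
  (* On the measurable type built from [F a], membership in [F a] becomes measurability, which
     differences preserve. *)
  pose T' := g_sigma_algebraType (F a).
  have FE : @measurable _ T' = F a by exact: (sigma_algebra_id sF).
  have m1 : measurable_fun [set: T'] (B a : T' -> R).
    by move=> _ D mD; rewrite setTI FE; exact: Fa.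
  have m0 : measurable_fun [set: T'] (B 0 : T' -> R).
    by move=> _ D mD; rewrite setTI FE; apply: (filtF.2 _ _ (lexx 0) a0); exact: F0.
  by have /(_ measurableT _ mA1) := measurable_funB m1 m0; rewrite setTI FE.
have := same_law_pair mU mY mU' mY' UY ind'.
have sU : same_law P2 P U U' by move=> D mD; rewrite gU// gU'//.
have sY : same_law P2 P Y Y' by move=> D mD; rewrite gY// gY'.
move=> /(_ sU sY) s.
have mS : measurable [set x : R * R | C (x.1 + x.2)].
  have := @measurable_funD _ _ R setT _ _ (@measurable_fst _ _ R R) (@measurable_snd _ _ R R).
  by move=> /(_ measurableT _ mC); rewrite setTI.
have /= := s _ mS; rewrite /preimage /= => ->.
have [_ <-//] := gau 0 (a + b) (a + b) (lexx _) ab (subr0 _).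
congr (P _); apply/seteqP; split => w /=; rewrite /U' /Y'.
  by rewrite addrC subrKA.
by rewrite [B a w - _ + _]addrC subrKA.
Qed.

End gaussian_sum.

Section normal_density_integral.
Context (R : realType).
Local Open Scope ereal_scope.

(** The density equals the Radon-Nikodym derivative almost everywhere, because both integrate to the
    normal law over every measurable set. *)
Lemma ge0_integral_normal_prob (s : R) (f : R -> \bar R) : s != 0%R ->
  measurable_fun setT f -> (forall x, 0 <= f x) ->
  \int[normal_prob 0%R s]_x f x =
  \int[lebesgue_measure]_x (f x * (normal_pdf 0%R s x)%:E).
Proof.
move=> s0 mf f0; pose mu := @lebesgue_measure R.
pose nu : {finite_measure set (measurableTypeR R) -> \bar R} := normal_prob 0%R s.
have numu : nu `<< mu by exact: normal_prob_dominates.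
rewrite -(Radon_Nikodym_SigmaFinite.change_of_variables numu)//.
have mpdf : measurable_fun setT (fun x : R => (normal_pdf 0%R s x)%:E).
  by apply/measurable_EFinP; exact: measurable_normal_pdf.
have iRN := Radon_Nikodym_SigmaFinite.f_integrable numu.
apply: ae_eq_integral => //.
- by apply: emeasurable_funM => //; exact: measurable_int iRN.
- exact: emeasurable_funM.
have : ae_eq mu setT (Radon_Nikodym_SigmaFinite.f nu mu) (fun x => (normal_pdf 0%R s x)%:E).
  apply: integral_ae_eq => // E _ mE.
  by rewrite -Radon_Nikodym_SigmaFinite.f_integral.
by apply: filterS => x h _ /=; rewrite h.
Qed.

Lemma normal_mgf (t : R) :
  \int[normal_prob 0%R 1%R]_x (expR (t * x))%:E = (expR (t ^+ 2 / 2))%:E.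
Proof.
have mexp : measurable_fun setT (fun x : R => (expR (t * x))%:E).
  have m1 : measurable_fun setT (fun x : R => t * x)%R by apply: measurable_funM.
  apply/measurable_EFinP.
  by apply: (@measurableT_comp _ _ _ _ _ _ (@expR R)) => //; exact: measurable_expR.
rewrite ge0_integral_normal_prob ?oner_neq0//.
(* Completing the square: the factor e^(t x) moves the centre of the density from 0 to [t], at the
   cost of the constant e^(t^2 / 2). *)
transitivity (\int[lebesgue_measure]_x
   ((expR (t ^+ 2 / 2))%:E * (normal_pdf t 1%R x)%:E)).
  apply: eq_integral => x _; rewrite -!EFinM !normal_pdfE ?oner_neq0//; congr EFin.
  rewrite /normal_fun mulrCA [RHS]mulrCA -!expRD; congr (_ * expR _)%R.
  by field.
rewrite ge0_integralZl//.
- by rewrite integral_normal_pdf mule1.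
- by apply/measurable_EFinP; exact: measurable_normal_pdf.
- by move=> x _; rewrite lee_fin normal_pdf_ge0.
Qed.

End normal_density_integral.

(** * Taylor bounds for trigonometric and hyperbolic functions *)

Section elementary_bounds.
Context {R : realType}.
Implicit Types x y : R.

(** This climbs a ladder of Taylor bounds: starting from [cos x <= 1], each inequality says that the
    derivative of the next one is non-negative. *)
Lemma ge0_of_derive (f df : R -> R) :
  (forall x, is_derive x 1 f (df x)) -> f 0 = 0 ->
  (forall x, 0 <= x -> 0 <= df x) -> forall x, 0 <= x -> 0 <= f x.
Proof.
move=> fdf f0 df0 x x0; rewrite -f0.
apply: (@ger0_derive1_le_cc R f 0 x) => //.
- move=> y; rewrite in_itv /= => /andP[/ltW y0 _].
  by rewrite derive1E (@derive_val _ _ _ _ _ _ _ (fdf y)); exact: df0.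
- apply: derivable_within_continuous => y _.
  exact: (@ex_derive _ _ _ _ _ _ _ (fdf y)).
- by rewrite in_itv /= lexx.
- by rewrite in_itv /= lexx andbT.
Qed.

Lemma sin_le_id x : 0 <= x -> sin x <= x.
Proof.
move=> x0; rewrite -subr_ge0; move: x x0.
apply: (@ge0_of_derive (fun x => x - sin x) (fun x => 1 - cos x)) => //.
- by rewrite sin0 subr0.
Qed.

Lemma cos_ge_taylor2 x : 0 <= x -> 1 - x ^+ 2 / 2 <= cos x.
Proof.
move=> x0; rewrite -subr_ge0; move: x x0.
apply: (@ge0_of_derive (fun x => cos x - (1 - x ^+ 2 / 2)) (fun x => x - sin x)).
- by move=> x; apply: is_derive_eq; rewrite /GRing.scale /=; field.
- by rewrite cos0; field.
- by move=> x x0; rewrite subr_ge0 sin_le_id.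
Qed.

Lemma sin_ge_taylor3 x : 0 <= x -> x - x ^+ 3 / 6 <= sin x.
Proof.
move=> x0; rewrite -subr_ge0; move: x x0.
apply: (@ge0_of_derive (fun x => sin x - (x - x ^+ 3 / 6))
  (fun x => cos x - (1 - x ^+ 2 / 2))).
- by move=> x; apply: is_derive_eq; rewrite /GRing.scale /=; field.
- by rewrite sin0; field.
- by move=> x x0; rewrite subr_ge0 cos_ge_taylor2.
Qed.

Lemma cos_le_taylor4 x : 0 <= x -> cos x <= 1 - x ^+ 2 / 2 + x ^+ 4 / 24.
Proof.
move=> x0; rewrite -subr_ge0; move: x x0.
apply: (@ge0_of_derive (fun x => (1 - x ^+ 2 / 2 + x ^+ 4 / 24) - cos x)
  (fun x => sin x - (x - x ^+ 3 / 6))).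
- by move=> x; apply: is_derive_eq; rewrite /GRing.scale /=; field.
- by rewrite cos0; field.
- by move=> x x0; rewrite subr_ge0 sin_ge_taylor3.
Qed.

Lemma cos_taylor x : `|cos x - (1 - x ^+ 2 / 2)| <= x ^+ 4.
Proof.
wlog x0 : x / 0 <= x.
  move=> h; have [|/ltW x0] := leP 0 x; first exact: h.
  have := h (- x); rewrite oppr_ge0 => /(_ x0).
  by rewrite cosN sqrrN (_ : (- x) ^+ 4 = x ^+ 4)//; ring.
rewrite ger0_norm ?subr_ge0 ?cos_ge_taylor2//.
have := cos_le_taylor4 x0; have : 0 <= x ^+ 4 by rewrite exprn_ge0.
lra.
Qed.

Lemma sin_taylor x : `|sin x - x| <= `|x| ^+ 3.
Proof.
wlog x0 : x / 0 <= x.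
  move=> h; have [|/ltW x0] := leP 0 x; first exact: h.
  have := h (- x); rewrite oppr_ge0 => /(_ x0).
  by rewrite sinN normrN -opprD normrN.
rewrite ler0_norm ?subr_le0 ?sin_le_id// ger0_norm//.
have := sin_ge_taylor3 x0; have : 0 <= x ^+ 3 by rewrite exprn_ge0.
lra.
Qed.

(** Twice the hyperbolic cosine. It dominates every power of |x| up to a constant, and its expansion
    of order two extracts a variance from a moment generating function. *)
Definition cosh2 x := expR x + expR (- x).

Lemma cosh2_ge2 x : 2 <= cosh2 x.
Proof.
rewrite /cosh2 expRN; have := expR_gt0 x; set e := expR x => e0.
rewrite -subr_ge0 (_ : _ - _ = (e - 1) ^+ 2 / e); last by field; rewrite gt_eqF.
by rewrite divr_ge0 ?sqr_ge0// ltW.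
Qed.

Let dcosh2 x : is_derive x 1 cosh2 (expR x - expR (- x)).
Proof. by rewrite /cosh2; apply: is_derive_eq; rewrite /GRing.scale /=; ring. Qed.

Let dsinh2 x : is_derive x 1 (fun x => expR x - expR (- x)) (cosh2 x).
Proof. by rewrite /cosh2; apply: is_derive_eq; rewrite /GRing.scale /=; ring. Qed.

Lemma cosh2_ge_taylor x : 2 + x ^+ 2 <= cosh2 x.
Proof.
have s x0 : 0 <= x0 -> 0 <= (expR x0 - expR (- x0)) - 2 * x0.
  move: x0; apply: (@ge0_of_derive (fun x => (expR x - expR (- x)) - 2 * x)
    (fun x => cosh2 x - 2)).
  - by move=> y; rewrite /cosh2; apply: is_derive_eq; rewrite /GRing.scale /=; ring.
  - by rewrite oppr0 subrr mulr0 subrr.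
  - by move=> y _; rewrite subr_ge0 cosh2_ge2.
wlog x0 : x / 0 <= x.
  move=> h; have [|/ltW x0] := leP 0 x; first exact: h.
  by have := h (- x); rewrite oppr_ge0 => /(_ x0); rewrite sqrrN /cosh2 opprK addrC [X in _ <= X]addrC [X in X <= _]addrC.
rewrite -subr_ge0; move: x x0.
apply: (@ge0_of_derive (fun x => cosh2 x - (2 + x ^+ 2))
  (fun x => (expR x - expR (- x)) - 2 * x)) => //.
- by move=> y; rewrite /cosh2; apply: is_derive_eq; rewrite /GRing.scale /=; ring.
- by rewrite /cosh2 oppr0 expR0; ring.
Qed.

Let expR_sub1_le x : expR x - 1 <= x * expR x.
Proof.
have := expR_ge1Dx (- x); rewrite expRN => h; have e0 := expR_gt0 x.
have : (1 + - x) * expR x <= 1 by rewrite -ler_pdivlMr// div1r.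
lra.
Qed.

(** The bound [c2], obtained by squaring [expR y - 1 <= y * expR y], is integrated twice from 0. The
    quartic remainder keeps the factor [cosh2 x] because the bound is global in [x]. *)
Lemma cosh2_le_taylor x : cosh2 x <= 2 + x ^+ 2 + x ^+ 4 * cosh2 x.
Proof.
have c2 y : 0 <= y -> cosh2 y - 2 <= y ^+ 2 * expR y.
  move=> y0; have h := expR_sub1_le y; have e0 := expR_gt0 y.
  have h1 : 0 <= expR y - 1 by rewrite subr_ge0 -(expR0 R) ler_expR.
  rewrite /cosh2 expRN (_ : _ - 2 = (expR y - 1) ^+ 2 / expR y); last by field; rewrite gt_eqF.
  rewrite ler_pdivrMr// -mulrA -expr2 -exprMn ler_sqr ?nnegrE//.
  by rewrite mulr_ge0// ltW.
have s2 y : 0 <= y -> 0 <= y ^+ 3 * expR y - ((expR y - expR (- y)) - 2 * y).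
  move: y; apply: (@ge0_of_derive _ (fun y => 3 * y ^+ 2 * expR y + y ^+ 3 * expR y - (cosh2 y - 2))).
  - by move=> y; rewrite /cosh2; apply: is_derive_eq; rewrite /GRing.scale /=; ring.
  - by rewrite oppr0 subrr mulr0 subrr expr0n mul0r subrr.
  - move=> y y0; have := c2 _ y0.
    have : 0 <= y ^+ 3 * expR y by rewrite mulr_ge0 ?exprn_ge0// expR_ge0.
    have : 0 <= y ^+ 2 * expR y by rewrite mulr_ge0 ?exprn_ge0// expR_ge0.
    lra.
have c4 y : 0 <= y -> 0 <= y ^+ 4 * expR y - (cosh2 y - (2 + y ^+ 2)).
  move: y; apply: (@ge0_of_derive _ (fun y => 4 * y ^+ 3 * expR y + y ^+ 4 * expR y - ((expR y - expR (- y)) - 2 * y))).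
  - by move=> y; rewrite /cosh2; apply: is_derive_eq; rewrite /GRing.scale /=; ring.
  - by rewrite /cosh2 oppr0 expR0; ring.
  - move=> y y0; have := s2 _ y0.
    have : 0 <= y ^+ 3 * expR y by rewrite mulr_ge0 ?exprn_ge0// expR_ge0.
    have : 0 <= y ^+ 4 * expR y by rewrite mulr_ge0 ?exprn_ge0// expR_ge0.
    lra.
wlog x0 : x / 0 <= x.
  move=> h; have [|/ltW x0] := leP 0 x; first exact: h.
  have := h (- x); rewrite oppr_ge0 => /(_ x0).
  by rewrite /cosh2 opprK [X in X <= _]addrC (addrC (expR (- x))) sqrrN (_ : (- x) ^+ 4 = x ^+ 4)//; ring.
have := c4 _ x0; rewrite {3}/cosh2.
have : 0 <= x ^+ 4 * expR (- x) by rewrite mulr_ge0 ?exprn_ge0// expR_ge0.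
lra.
Qed.

Lemma le_cosh2 x y : `|x| <= `|y| -> cosh2 x <= cosh2 y.
Proof.
have cabs z : cosh2 `|z| = cosh2 z.
  have [z0|z0] := leP 0 z; first by rewrite ger0_norm.
  by rewrite ltr0_norm// /cosh2 opprK addrC.
rewrite -[cosh2 x]cabs -[cosh2 y]cabs; move: `|x| (normr_ge0 x) `|y| => {}x x0 {}y xy.
rewrite /cosh2 !expRN.
have ex : 1 <= expR x by rewrite -(expR0 R) ler_expR.
have exy : expR x <= expR y by rewrite ler_expR.
rewrite -subr_ge0 (_ : _ - _ = (expR y - expR x) * (1 - (expR x * expR y)^-1)); last first.
  by field; rewrite !gt_eqF ?expR_gt0.
rewrite mulr_ge0 ?subr_ge0// invf_le1 ?mulr_gt0 ?expR_gt0//.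
by rewrite -[leLHS]mulr1 ler_pM// (le_trans ex).
Qed.

Lemma sqr_cosh2_le x : cosh2 x ^+ 2 <= 2 * (expR (2 * x) + expR (- 2 * x)).
Proof.
rewrite (_ : 2 * x = x + x); last by ring.
rewrite (_ : -2 * x = - x + - x); last by ring.
rewrite /cosh2 !expRD; set a := expR x; set b := expR (- x).
rewrite -subr_ge0 (_ : _ - _ = (a - b) ^+ 2) ?sqr_ge0//; ring.
Qed.

(** For [x >= 0] and [k > 0], raise [x / k <= expR (x / k)] to the power [k]. *)
Lemma norm_pow_le_cosh2 (k : nat) x : `|x| ^+ k <= k%:R ^+ k * cosh2 x.
Proof.
wlog x0 : x / 0 <= x.
  move=> h; have [|/ltW x0] := leP 0 x; first exact: h.
  have := h (- x); rewrite oppr_ge0 => /(_ x0).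
  by rewrite normrN /cosh2 opprK addrC.
rewrite ger0_norm//; have e1 := expR_ge0 (- x).
case: k => [|k]; first by rewrite !expr0 mul1r (le_trans _ (cosh2_ge2 x))// ler1n.
rewrite (@le_trans _ _ (k.+1%:R ^+ k.+1 * expR x))//; last first.
  by rewrite ler_wpM2l ?exprn_ge0// /cosh2 lerDl.
rewrite {1}(_ : x = k.+1%:R * (x / k.+1%:R)); last by rewrite mulrC divfK// pnatr_eq0.
rewrite exprMn ler_wpM2l ?exprn_ge0//.
rewrite (_ : expR x = expR (x / k.+1%:R) ^+ k.+1); last first.
  by rewrite -expRM_natl mulrC divfK// pnatr_eq0.
rewrite ler_pXn2r ?nnegrE ?expR_ge0 ?divr_ge0//.
by rewrite (le_trans _ (expR_ge1Dx _))// lerDr.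
Qed.

End elementary_bounds.

(** * Random variables with moments of all orders *)

Section moments.
Context dsp (Omega : measurableType dsp) (R : realType) (P : probability Omega R).
Implicit Types Y Z : Omega -> R.

Lemma measurable_leset Y Z : measurable_fun setT Y -> measurable_fun setT Z ->
  measurable [set w | Y w <= Z w].
Proof.
move=> mY mZ; rewrite (_ : [set _ | _] = (Z \- Y) @^-1` `[0, +oo[); last first.
  by apply/seteqP; split => w /=; rewrite in_itv /= andbT subr_ge0.
by rewrite -[X in measurable X]setTI; exact: measurable_funB.
Qed.

Lemma measurable_ltset Y Z : measurable_fun setT Y -> measurable_fun setT Z ->
  measurable [set w | Y w < Z w].
Proof.
move=> mY mZ; rewrite (_ : [set _ | _] = (Z \- Y) @^-1` `]0, +oo[); last first.
  by apply/seteqP; split => w /=; rewrite in_itv /= andbT subr_gt0.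
by rewrite -[X in measurable X]setTI; exact: measurable_funB.
Qed.

(** These variables form an algebra, so every polynomial in Gaussian coordinates is integrable
    without a separate estimate. *)
Definition allmom Y : Prop :=
  measurable_fun setT Y /\
  forall k, P.-integrable setT (EFin \o (fun w => Y w ^+ k)).

Lemma integrable_dom Y Z : measurable_fun setT Y ->
  P.-integrable setT (EFin \o Z) -> (forall w, `|Y w| <= Z w) ->
  P.-integrable setT (EFin \o Y).
Proof.
move=> mY iZ YZ; apply: (le_integrable measurableT _ _ iZ).
  exact/measurable_EFinP.
by move=> w _ /=; rewrite lee_fin (le_trans (YZ w))// ler_norm.
Qed.

Lemma integrableDr Y Z : P.-integrable setT (EFin \o Y) ->
  P.-integrable setT (EFin \o Z) -> P.-integrable setT (EFin \o (fun w => Y w + Z w)).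
Proof. by move=> iY iZ; apply: eq_integrable (integrableD measurableT iY iZ). Qed.

Lemma integrableZr' (c : R) Y : P.-integrable setT (EFin \o Y) ->
  P.-integrable setT (EFin \o (fun w => c * Y w)).
Proof. by move=> iY; apply: eq_integrable (integrableZl measurableT c iY). Qed.

Lemma integrable_cstr (c : R) : P.-integrable setT (EFin \o (fun=> c)).
Proof. exact: finite_measure_integrable_cst. Qed.

Lemma integrable_bounded Y (M : R) : measurable_fun setT Y ->
  (forall w, `|Y w| <= M) -> P.-integrable setT (EFin \o Y).
Proof. by move=> mY YM; exact: (integrable_dom mY (integrable_cstr M)). Qed.

Lemma allmom_measurable Y : allmom Y -> measurable_fun setT Y.
Proof. by case. Qed.

Lemma allmom_integrable Y : allmom Y -> P.-integrable setT (EFin \o Y).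
Proof.
by move=> [_ /(_ 1%N)]; under eq_fun do rewrite expr1.
Qed.

Lemma allmom_integrableM Y Z : allmom Y -> allmom Z ->
  P.-integrable setT (EFin \o (fun w => Y w * Z w)).
Proof.
move=> [mY iY] [mZ iZ].
apply: (integrable_dom (Z := fun w => Y w ^+ 2 + Z w ^+ 2)).
- exact: measurable_funM.
- exact: integrableDr.
move=> w; rewrite ler_norml; apply/andP; split.
  have := sqr_ge0 (Y w + Z w); have := sqr_ge0 (Y w); have := sqr_ge0 (Z w); nra.
have := sqr_ge0 (Y w - Z w); have := sqr_ge0 (Y w); have := sqr_ge0 (Z w); nra.
Qed.

Lemma allmomX Y k : allmom Y -> allmom (fun w => Y w ^+ k).
Proof.
move=> [mY iY]; split; first exact: measurable_funX.
by move=> j; under eq_fun do rewrite -exprM; exact: iY.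
Qed.

Lemma allmomM Y Z : allmom Y -> allmom Z -> allmom (fun w => Y w * Z w).
Proof.
move=> hY hZ; split; first by apply: measurable_funM; exact: allmom_measurable.
move=> k; under eq_fun do rewrite exprMn.
by apply: allmom_integrableM; exact: allmomX.
Qed.

Lemma allmom_cst (c : R) : allmom (fun=> c).
Proof. by split => // k; exact: integrable_cstr. Qed.

Lemma allmomZ (c : R) Y : allmom Y -> allmom (fun w => c * Y w).
Proof. by move=> hY; apply: allmomM => //; exact: allmom_cst. Qed.

Lemma allmomD Y Z : allmom Y -> allmom Z -> allmom (fun w => Y w + Z w).
Proof.
move=> hY hZ; split; first by apply: measurable_funD; exact: allmom_measurable.
move=> k; under eq_fun do rewrite exprDn.
have : P.-integrable setT (fun w => \sum_(i < k.+1)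
   ((Y w ^+ (k - i) * Z w ^+ i) *+ 'C(k, i))%:E)%E.
  apply: integrable_sum => // i _ /=.
  under eq_fun do rewrite -mulr_natl.
  by apply: integrableZr'; apply: allmom_integrableM; exact: allmomX.
by apply: eq_integrable => // w _ /=; rewrite sumEFin.
Qed.

Lemma allmomN Y : allmom Y -> allmom (fun w => - Y w).
Proof. by move=> /(allmomZ (-1)); under eq_fun do rewrite mulN1r. Qed.

Lemma allmomB Y Z : allmom Y -> allmom Z -> allmom (fun w => Y w - Z w).
Proof. by move=> hY hZ; apply: allmomD => //; exact: allmomN. Qed.

Lemma allmom_sum (I : Type) (s : seq I) (p : pred I) (Y : I -> Omega -> R) :
  (forall i, p i -> allmom (Y i)) -> allmom (fun w => \sum_(i <- s | p i) Y i w).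
Proof.
move=> hY; elim: s => [|i s ih].
  by under eq_fun do rewrite big_nil; exact: allmom_cst.
under eq_fun do rewrite big_cons.
by case pi : (p i) => //; apply: allmomD => //; exact: hY.
Qed.

Local Notation E := (Rintegral P setT).

Lemma ExpD Y Z : P.-integrable setT (EFin \o Y) -> P.-integrable setT (EFin \o Z) ->
  E (fun w => Y w + Z w) = E Y + E Z.
Proof. by move=> iY iZ; rewrite RintegralD. Qed.

Lemma ExpB Y Z : P.-integrable setT (EFin \o Y) -> P.-integrable setT (EFin \o Z) ->
  E (fun w => Y w - Z w) = E Y - E Z.
Proof. by move=> iY iZ; rewrite RintegralB. Qed.

Lemma ExpZ c Y : P.-integrable setT (EFin \o Y) -> E (fun w => c * Y w) = c * E Y.
Proof. by move=> iY; rewrite RintegralZl. Qed.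

Lemma Exp_cst c : E (fun=> c) = c.
Proof.
rewrite Rintegral_cst//; have -> : fine (P setT) = 1 by rewrite probability_setT.
by rewrite mulr1.
Qed.

Lemma Exp_sum (I : Type) (s : seq I) (p : pred I) (Y : I -> Omega -> R) :
  (forall i, p i -> allmom (Y i)) ->
  E (fun w => \sum_(i <- s | p i) Y i w) = \sum_(i <- s | p i) E (Y i).
Proof.
move=> hY; elim: s => [|i s ih].
  by under eq_Rintegral do rewrite big_nil; rewrite Exp_cst big_nil.
under eq_Rintegral do rewrite big_cons.
rewrite big_cons; case pi : (p i) => //; rewrite ExpD ?ih//.
  by apply: allmom_integrable; exact: hY.
by apply: allmom_integrable; exact: allmom_sum.
Qed.

Lemma Exp_le Y Z : P.-integrable setT (EFin \o Y) -> P.-integrable setT (EFin \o Z) ->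
  (forall w, Y w <= Z w) -> E Y <= E Z.
Proof. by move=> iY iZ YZ; apply: le_Rintegral. Qed.

Lemma Exp_norm Y : P.-integrable setT (EFin \o Y) -> `|E Y| <= E (fun w => `|Y w|).
Proof. by move=> iY; apply: le_normr_Rintegral. Qed.

Lemma markov_pow Y k (a : R) : allmom Y -> 0 < a ->
  (P [set w | (a <= `|Y w|)%R] <= ((a ^+ k.*2)^-1 * E (fun w => Y w ^+ k.*2))%:E)%E.
Proof.
move=> hY a0; have [mY iY] := hY.
have ak : 0 < a ^+ k.*2 by rewrite exprn_gt0.
have mA : measurable [set w | a <= `|Y w|].
  by apply: measurable_leset => //; exact: measurableT_comp.
have fP : P [set w | a <= `|Y w|] \is a fin_num by rewrite fin_num_measure.
rewrite -(fineK fP) lee_fin mulrC ler_pdivlMr//.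
rewrite (_ : fine _ * _ = E (fun w => a ^+ k.*2 * \1_[set w | a <= `|Y w|] w)); last first.
  rewrite ExpZ; last exact: integrable_indic.
  by rewrite /Rintegral integral_indic// setIT mulrC.
apply: Exp_le => //.
  by apply: integrableZr'; exact: integrable_indic.
move=> w; rewrite indicE; case: (boolP (w \in _)) => [|_]; last first.
  by rewrite mulr0 -mul2n exprM exprn_ge0// sqr_ge0.
rewrite inE /= mulr1 => aY; rewrite -[Y w ^+ _]ger0_norm; last first.
  by rewrite -mul2n exprM exprn_ge0// sqr_ge0.
by rewrite normrX lerXn2r ?nnegrE ?normr_ge0 ?(ltW a0).
Qed.

End moments.

Section law_moments.
Context d1 d2 (O1 : measurableType d1) (O2 : measurableType d2) (R : realType).
Variables (P1 : probability O1 R) (P2 : probability O2 R).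

Lemma same_law_Exp (U : O1 -> R) (Y : O2 -> R) (f : R -> R) :
  measurable_fun setT U -> measurable_fun setT Y -> same_law P1 P2 U Y ->
  measurable_fun setT f ->
  \int[P1]_w f (U w) = \int[P2]_w f (Y w).
Proof.
move=> mU mY UY mf; rewrite /Rintegral; congr fine.
by apply: (same_law_integral (f := EFin \o f)) => //; exact/measurable_EFinP.
Qed.

Lemma same_law_integrable (U : O1 -> R) (Y : O2 -> R) (f : R -> R) :
  measurable_fun setT U -> measurable_fun setT Y -> same_law P1 P2 U Y ->
  measurable_fun setT f ->
  P1.-integrable setT (EFin \o (f \o U)) -> P2.-integrable setT (EFin \o (f \o Y)).
Proof.
move=> mU mY UY mf /integrableP[_ fin]; apply/integrableP; split.
  by apply/measurable_EFinP; exact: measurableT_comp.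
move: fin; rewrite (same_law_integral (Y := Y) (P2 := P2) (f := fun x => `|(f x)%:E|%E))//.
by apply: measurableT_comp => //; exact/measurable_EFinP.
Qed.

Lemma same_law_allmom (U : O1 -> R) (Y : O2 -> R) :
  measurable_fun setT Y -> same_law P1 P2 U Y ->
  allmom P1 U -> allmom P2 Y.
Proof.
move=> mY UY [mU iU]; split => // k.
apply: (same_law_integrable mU mY UY (f := fun x => x ^+ k)) => //; exact: iU.
Qed.

End law_moments.

(** * Moments of Gaussian variables *)

Section gaussian_moments.
Context dsp (Omega : measurableType dsp) (R : realType) (P : probability Omega R).
Variables (F : R -> set (set Omega)) (B : R -> Omega -> R).
Hypothesis filtF : is_filtration F.
Hypothesis brB : brownian P F B.
Local Notation E := (Rintegral P setT).

Let N w := B 1 w - B 0 w.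

Let incr c s t v : 0 <= s -> s <= t -> c ^+ 2 * (t - s) = v ->
  gaussian P (fun w => c * (B t w - B s w)) v.
Proof. by move=> s0 st <-; exact: (brownian_gaussian brB). Qed.

Let Ngauss c : gaussian P (fun w => c * N w) (c ^+ 2).
Proof. by apply: incr => //; rewrite subr0 mulr1. Qed.

Let mN : measurable_fun setT N.
Proof. by have [] := Ngauss 1; under eq_fun do rewrite mul1r. Qed.

Let Nlaw A : measurable A -> P (N @^-1` A) = normal_prob 0 1 A.
Proof.
move=> mA; have [_ /(_ _ mA)] := Ngauss 1; under eq_fun do rewrite mul1r.
by move=> ->; rewrite /normal1 expr1n oner_eq0 sqrtr1.
Qed.

Let mgf (t : R) : (\int[P]_w (expR (t * N w))%:E)%E = (expR (t ^+ 2 / 2))%:E.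
Proof.
pose Q : probability (measurableTypeR R) R := normal_prob 0 1.
have m1 : measurable_fun setT (fun x : R => t * x) by apply: measurable_funM.
rewrite -normal_mgf.
apply: (@same_law_integral _ _ _ _ _ P Q _ _ N idfun (fun x => (expR (t * x))%:E)) => //.
  exact: (@measurable_id _ (measurableTypeR R) setT).
apply/measurable_EFinP.
by apply: (@measurableT_comp _ _ _ _ _ _ (@expR R)) => //; exact: measurable_expR.
Qed.

Let mexp t : measurable_fun setT (fun w => expR (t * N w)).
Proof.
have m1 : measurable_fun setT (fun w => t * N w) by apply: measurable_funM.
by apply: (@measurableT_comp _ _ _ _ _ _ (@expR R)) => //; exact: measurable_expR.
Qed.

Let iexp t : P.-integrable setT (EFin \o (fun w => expR (t * N w))).
Proof.
apply/integrableP; split; first exact/measurable_EFinP.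
under eq_integral do rewrite /= ger0_norm ?expR_ge0//.
by rewrite mgf ltry.
Qed.

Let Eexp t : E (fun w => expR (t * N w)) = expR (t ^+ 2 / 2).
Proof. by rewrite /Rintegral mgf. Qed.

Let icosh : P.-integrable setT (EFin \o (fun w => cosh2 (N w))).
Proof.
have := integrableDr (iexp 1) (iexp (-1)).
by under eq_fun do rewrite mulN1r mul1r.
Qed.

Let Nallmom : allmom P N.
Proof.
split => // k; apply: (integrable_dom (Z := fun w => k%:R ^+ k * cosh2 (N w))).
- exact: measurable_funX.
- exact: integrableZr'.
- by move=> w; rewrite normrX; exact: norm_pow_le_cosh2.
Qed.

(** [N] and [- N] have the same law, so an odd moment equals its opposite. *)
Let Nodd k : odd k -> E (fun w => N w ^+ k) = 0.
Proof.
move=> ok; have [mNN _] := Ngauss (-1); have [mN1 _] := Ngauss 1.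
have : E (fun w => (1 * N w) ^+ k) = E (fun w => (-1 * N w) ^+ k).
  apply: (same_law_Exp (f := fun x => x ^+ k)) => //.
  by apply: (gaussian_same_law (Ngauss 1) (Ngauss (-1))); rewrite sqrrN.
under eq_Rintegral do rewrite mul1r.
under [in RHS]eq_Rintegral do rewrite exprMn -signr_odd ok expr1.
by rewrite ExpZ; [lra|have [_] := Nallmom; exact].
Qed.

(** The second moment m is read off the moment generating function near 0: the expectation 2 e^(t^2
    / 2) of [cosh2 (t * N)] lies between 2 + t^2 m and 2 + t^2 m + t^4 C, which forces |m - 1| <= (C
    + 1) t for every small t. *)
Let N2 : E (fun w => N w ^+ 2) = 1.
Proof.
have [_ iN] := Nallmom.
have iNc : P.-integrable setT (EFin \o (fun w => N w ^+ 4 * cosh2 (N w))).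
  apply: (integrable_dom (Z := fun w => 4 ^+ 4 * 2 * (expR (2 * N w) + expR (- 2 * N w)))).
  - apply: measurable_funM; first exact: measurable_funX.
    by have /integrableP[/measurable_EFinP] := icosh.
  - by apply: integrableZr'; exact: integrableDr.
  move=> w; have c2 := cosh2_ge2 (N w).
  rewrite normrM normrX [X in _ * X]ger0_norm; last by rewrite (le_trans _ c2).
  apply: (@le_trans _ _ ((4 ^+ 4 * cosh2 (N w)) * cosh2 (N w))).
    by apply: ler_wpM2r (norm_pow_le_cosh2 4 _); rewrite (le_trans _ c2).
  rewrite -[leLHS]mulrA -[leRHS]mulrA ler_wpM2l ?exprn_ge0//.
  exact: (sqr_cosh2_le (N w)).
pose C := E (fun w => N w ^+ 4 * cosh2 (N w)).
have C0 : 0 <= C.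
  apply: Rintegral_ge0 => w _; rewrite mulr_ge0// ?(le_trans _ (cosh2_ge2 _))//.
  by rewrite (exprM _ 2 2) sqr_ge0.
set m := E (fun w => N w ^+ 2).
have key t : 0 < t -> t <= 1 -> `|m - 1| <= (C + 1) * t.
  move=> t0 t1.
  have icc : P.-integrable setT (EFin \o (fun w => cosh2 (t * N w))).
    have := integrableDr (iexp t) (iexp (- t)).
    by under eq_fun do rewrite mulNr.
  have Ecc : E (fun w => cosh2 (t * N w)) = 2 * expR (t ^+ 2 / 2).
    have := ExpD (iexp t) (iexp (- t)); rewrite !Eexp sqrrN.
    under eq_Rintegral do rewrite mulNr.
    by rewrite /cosh2 => ->; ring.
  have lo : 2 + t ^+ 2 * m <= 2 * expR (t ^+ 2 / 2).
    rewrite -Ecc /m -ExpZ//.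
    rewrite -[X in X + _](Exp_cst P 2) -ExpD//; [|exact: integrable_cstr|exact: integrableZr'].
    apply: Exp_le => //.
      by apply: integrableDr; [exact: integrable_cstr|exact: integrableZr'].
    by move=> w; rewrite -exprMn; exact: cosh2_ge_taylor.
  have hi : 2 * expR (t ^+ 2 / 2) <= 2 + t ^+ 2 * m + t ^+ 4 * C.
    rewrite -Ecc /m /C -!ExpZ//.
    rewrite -[X in X + _ + _](Exp_cst P 2) -!ExpD//; last first.
    - exact: integrableZr'.
    - exact: integrable_cstr.
    - exact: integrableZr'.
    - by apply: integrableDr; [exact: integrable_cstr|exact: integrableZr'].
    apply: Exp_le => //.
      apply: integrableDr; last exact: integrableZr'.
      by apply: integrableDr; [exact: integrable_cstr|exact: integrableZr'].
    move=> w; rewrite -exprMn; apply: (le_trans (cosh2_le_taylor _)).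
    rewrite lerD2l mulrA -exprMn ler_wpM2l//; first by rewrite (exprM _ 2 2) sqr_ge0.
    have h : 0 <= (t * N w) ^+ 2 <= N w ^+ 2.
      by rewrite sqr_ge0 /= exprMn ler_piMl ?sqr_ge0// expr_le1// ltW.
    apply: le_cosh2.
    by rewrite -ler_sqr ?nnegrE// -!normrX !ger0_norm ?sqr_ge0//; case/andP: h.
  have u0 : 0 < t ^+ 2 by rewrite exprn_gt0.
  have e1 : 1 + t ^+ 2 / 2 <= expR (t ^+ 2 / 2) by exact: expR_ge1Dx.
  have e2 : 2 * expR (t ^+ 2 / 2) <= 2 + t ^+ 2 + t ^+ 4.
    have := expR_ge1Dx (- (t ^+ 2 / 2)); rewrite expRN => h.
    have ug : 0 < 1 - t ^+ 2 / 2.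
      have : t ^+ 2 <= 1 by rewrite expr_le1// ltW.
      lra.
    have h' : expR (t ^+ 2 / 2) <= (1 - t ^+ 2 / 2)^-1.
      by rewrite -[leLHS]invrK lef_pV2 ?posrE ?invr_gt0 ?expR_gt0.
    rewrite (le_trans (_ : _ <= 2 * (1 - t ^+ 2 / 2)^-1))// ?ler_pM2l//.
    rewrite ler_pdivrMr// (_ : t ^+ 4 = t ^+ 2 * t ^+ 2); last by ring.
    have u1 : t ^+ 2 <= 1 by rewrite expr_le1// ltW.
    set u := t ^+ 2 in u0 u1 *; nra.
  have tt : t ^+ 2 <= t by rewrite expr2 ler_piMl// ltW.
  have t4 : t ^+ 4 = t ^+ 2 * t ^+ 2 by ring.
  have Ct : 0 <= C * t ^+ 2 by rewrite mulr_ge0 ?(ltW u0).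
  have a1 : m - 1 <= t ^+ 2.
    by rewrite -(ler_pM2l u0); move: lo e2; rewrite t4; set u := t ^+ 2; lra.
  have a2 : - (C * t ^+ 2) <= m - 1.
    rewrite -(ler_pM2l u0); move: hi e1; rewrite t4; set u := t ^+ 2; lra.
  have Ctt : C * t ^+ 2 <= C * t by rewrite ler_wpM2l.
  rewrite ler_norml; apply/andP; split; lra.
have m1 : `|m - 1| = 0.
  apply/eqP; rewrite eq_le normr_ge0 andbT leNgt; apply/negP => a0.
  (* At this [t] the bound [key] is at most half of |m - 1|, a contradiction. *)
  pose t := Num.min 1 (`|m - 1| / (2 * (C + 1))).
  have c2 : 0 < 2 * (C + 1) by rewrite mulr_gt0// ltr_wpDl.
  have t0 : 0 < t by rewrite lt_min ltr01 divr_gt0.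
  have t1 : t <= 1 by rewrite ge_min lexx.
  have := key _ t0 t1.
  have : t <= `|m - 1| / (2 * (C + 1)) by rewrite ge_min lexx orbT.
  rewrite ler_pdivlMr// => h1 h2.
  have : t * (2 * (C + 1)) = 2 * ((C + 1) * t) by ring.
  lra.
by apply/eqP; rewrite -subr_eq0 -normr_eq0 m1.
Qed.

(** Stability determines the fourth moment m: for an independent copy [M], the sum [N + M] has the
    law of sqrt 2 N, and expanding its fourth power gives 4 m = 2 m + 6. *)
Let N4 : E (fun w => N w ^+ 4) = 3.
Proof.
pose M w := B 2 w - B 1 w.
have gM : gaussian P M 1.
  have := @incr 1 1 2 1; under eq_fun do rewrite mul1r; apply => //.
    by rewrite ler1n.
  by ring.
have [mM lM] := gM.
have sNM : same_law P P N M.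
  by move=> A mA; rewrite lM// Nlaw// /normal1 oner_eq0 sqrtr1.
have aM : allmom P M by exact: same_law_allmom sNM Nallmom.
have EM k : E (fun w => M w ^+ k) = E (fun w => N w ^+ k).
  by apply/esym; apply: (same_law_Exp (f := fun x => x ^+ k)).
have ind : indep_rv P N M.
  move=> A1 A2 mA1 mA2; apply: (brownian_indep brB) => //; first by rewrite ler1n.
  have [sF _] := filtF.1 1 ler01.
  pose T' := g_sigma_algebraType (F 1).
  have FE : @measurable _ T' = F 1 by exact: (sigma_algebra_id sF).
  have m1 : measurable_fun [set: T'] (B 1 : T' -> R).
    by move=> _ D mD; rewrite setTI FE; exact: (brownian_adapted brB).
  have m0 : measurable_fun [set: T'] (B 0 : T' -> R).
    move=> _ D mD; rewrite setTI FE; apply: (filtF.2 _ _ (lexx 0) ler01).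
    exact: (brownian_adapted brB).
  by have /(_ measurableT _ mA1) := measurable_funB m1 m0; rewrite setTI FE.
have Eprod j k : E (fun w => N w ^+ j * M w ^+ k) = E (fun w => N w ^+ j) * E (fun w => N w ^+ k).
  rewrite -(EM k).
  have mX i : measurable_fun setT (fun x : R => x ^+ i) by exact: measurable_funX.
  have indX : indep_rv P (fun w => N w ^+ j) (fun w => M w ^+ k).
    move=> A1 A2 mA1 mA2.
    have mi i A : measurable A -> measurable ((fun x : R => x ^+ i) @^-1` A).
      by move=> mA; rewrite -[X in measurable X]setTI; exact: mX.
    exact: (ind _ _ (mi j _ mA1) (mi k _ mA2)).
  by apply: (integral_indepM indX _ _).2; [have [_] := Nallmom|have [_] := aM]; exact.
have gs : gaussian P (fun w => N w + M w) 2.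
  have := @incr 1 0 2 2; under eq_fun do rewrite mul1r.
  have -> : (fun w => B 2 w - B 0 w) = (fun w => N w + M w).
    by apply/funext => w; rewrite /N /M; ring.
  by apply => //; ring.
have e1 : E (fun w => (N w + M w) ^+ 4) = 4 * E (fun w => N w ^+ 4).
  transitivity (E (fun w => (Num.sqrt 2 * N w) ^+ 4)).
    have [ms _] := gs; have [mr _] := Ngauss (Num.sqrt 2).
    apply: (same_law_Exp (f := fun x => x ^+ 4)) => //.
    by apply: (gaussian_same_law gs (Ngauss _)); rewrite sqr_sqrtr.
  have s4 : Num.sqrt (2 : R) ^+ 4 = 4.
    by rewrite (exprM _ 2 2) sqr_sqrtr//; ring.
  under eq_Rintegral do rewrite exprMn s4.
  by rewrite ExpZ//; have [_] := Nallmom; exact.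
have e2 : E (fun w => (N w + M w) ^+ 4) =
    E (fun w => N w ^+ 4) + 6 + E (fun w => N w ^+ 4).
  have ex w : (N w + M w) ^+ 4 = \sum_(i < 5) 'C(4, i)%:R * (N w ^+ (4 - i) * M w ^+ i).
    by rewrite exprDn; apply: eq_bigr => i _; rewrite mulr_natl.
  under eq_Rintegral do rewrite ex.
  rewrite Exp_sum => [|i _]; last by apply: allmomZ; apply: allmomM; exact: allmomX.
  under eq_bigr => i _.
    rewrite ExpZ; last by apply: allmom_integrable; apply: allmomM; exact: allmomX.
    rewrite Eprod; over.
  rewrite !big_ord_recr big_ord0 /= add0r !bin0 !binn.
  rewrite (Nodd (isT : odd 3)) (Nodd (isT : odd 1)) N2.
  have -> : E (fun w => N w ^+ 0) = 1.
    by under eq_Rintegral do rewrite expr0; rewrite Exp_cst.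
  rewrite (_ : 'C(4, 2) = 6)//; ring.
lra.
Qed.

Lemma gaussian_allmom d2 (O2 : measurableType d2) (P2 : probability O2 R) (Y : O2 -> R) v :
  0 <= v -> gaussian P2 Y v -> allmom P2 Y.
Proof.
move=> v0 gY.
have s : same_law P P2 (fun w => Num.sqrt v * N w) Y.
  by apply: (gaussian_same_law (Ngauss _) gY); rewrite sqr_sqrtr.
exact: (same_law_allmom gY.1 s (allmomZ _ Nallmom)).
Qed.

Lemma gaussian_moment d2 (O2 : measurableType d2) (P2 : probability O2 R) (Y : O2 -> R) v k :
  0 <= v -> gaussian P2 Y v ->
  \int[P2]_w Y w ^+ k = Num.sqrt v ^+ k * E (fun w => N w ^+ k).
Proof.
move=> v0 gY; have [mr _] := Ngauss (Num.sqrt v); have [mY _] := gY.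
rewrite -ExpZ; last by have [_] := Nallmom; exact.
under [in RHS]eq_Rintegral do rewrite -exprMn.
apply: (same_law_Exp (f := fun x => x ^+ k)) => //.
by apply: (gaussian_same_law gY (Ngauss _)); rewrite sqr_sqrtr.
Qed.

Lemma gaussian_moment2 d2 (O2 : measurableType d2) (P2 : probability O2 R) (Y : O2 -> R) v :
  0 <= v -> gaussian P2 Y v -> \int[P2]_w Y w ^+ 2 = v.
Proof. by move=> v0 gY; rewrite (gaussian_moment _ v0 gY) N2 mulr1 sqr_sqrtr. Qed.

Lemma gaussian_moment4 d2 (O2 : measurableType d2) (P2 : probability O2 R) (Y : O2 -> R) v :
  0 <= v -> gaussian P2 Y v -> \int[P2]_w Y w ^+ 4 = 3 * v ^+ 2.
Proof.
by move=> v0 gY; rewrite (gaussian_moment _ v0 gY) N4 (exprM _ 2 2) sqr_sqrtr// mulrC.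
Qed.

Lemma gaussian_mean d2 (O2 : measurableType d2) (P2 : probability O2 R) (Y : O2 -> R) v :
  0 <= v -> gaussian P2 Y v -> \int[P2]_w Y w = 0.
Proof.
move=> v0 gY; have := gaussian_moment 1 v0 gY; rewrite Nodd// mulr0.
by under eq_Rintegral do rewrite expr1.
Qed.

End gaussian_moments.

(** * Isserlis' formula and centred quadratic forms *)

Section gaussian_vector.
Context dsp (Omega : measurableType dsp) (R : realType) (P : probability Omega R).
Variables (F : R -> set (set Omega)) (B : R -> Omega -> R).
Hypothesis filtF : is_filtration F.
Hypothesis brB : brownian P F B.
Variables (p : nat) (Z : Omega -> 'cV[R]_p) (S : 'M[R]_p).
Hypothesis gZ : forall u : 'cV[R]_p,
  gaussian P (fun w => (u^T *m Z w) 0 0) ((u^T *m S *m u) 0 0).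
Hypothesis symS : S^T = S.
Hypothesis psdS : forall u : 'cV[R]_p, 0 <= (u^T *m S *m u) 0 0.
Local Notation E := (Rintegral P setT).

Let f (u : 'cV[R]_p) (w : Omega) : R := (u^T *m Z w) 0 0.
Let b (u v : 'cV[R]_p) : R := (u^T *m S *m v) 0 0.

Let fD u v w : f (u + v) w = f u w + f v w.
Proof. by rewrite /f linearD /= mulmxDl mxE. Qed.

Let fB u v w : f (u - v) w = f u w - f v w.
Proof. by rewrite /f linearB /= mulmxBl !mxE. Qed.

Let bDl u v t : b (u + v) t = b u t + b v t.
Proof. by rewrite /b linearD /= !mulmxDl mxE. Qed.

Let bBl u v t : b (u - v) t = b u t - b v t.
Proof. by rewrite /b linearB /= !mulmxBl !mxE. Qed.

Let bC u v : b u v = b v u.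
Proof.
rewrite /b; transitivity ((u^T *m S *m v)^T 0 0); first by rewrite [RHS]mxE.
by rewrite !trmx_mul trmxK symS mulmxA.
Qed.

Let bDr u v t : b t (u + v) = b t u + b t v.
Proof. by rewrite bC bDl !(bC _ t). Qed.

Let bBr u v t : b t (u - v) = b t u - b t v.
Proof. by rewrite bC bBl !(bC _ t). Qed.

Let af u : allmom P (f u).
Proof. exact: (gaussian_allmom brB (psdS u) (gZ u)). Qed.

Let af2 u v : allmom P (fun w => f u w * f v w).
Proof. exact: allmomM. Qed.

Let E2 u : E (fun w => f u w ^+ 2) = b u u.
Proof. exact: (gaussian_moment2 brB (psdS u) (gZ u)). Qed.

Let E4 u : E (fun w => f u w ^+ 4) = 3 * b u u ^+ 2.
Proof. exact: (gaussian_moment4 filtF brB (psdS u) (gZ u)). Qed.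

Let iX u k : P.-integrable setT (EFin \o (fun w => f u w ^+ k)).
Proof. by apply: allmom_integrable; exact: allmomX. Qed.

(** Only the laws of single linear forms are given, so mixed moments are reached by polarisation. *)
Let Ef2 u v : E (fun w => f u w * f v w) = b u v.
Proof.
have e w : f u w * f v w = 4^-1 * (f (u + v) w ^+ 2 - f (u - v) w ^+ 2).
  by rewrite fD fB; field.
under eq_Rintegral do rewrite e.
rewrite ExpZ ?ExpB ?E2//; last by apply: allmom_integrable; apply: allmomB; exact: allmomX.
by rewrite !bBl !bBr !bDl !bDr (bC v u); field.
Qed.

Let Ef22 u v : E (fun w => f u w ^+ 2 * f v w ^+ 2) = b u u * b v v + 2 * b u v ^+ 2.
Proof.
have e w : f u w ^+ 2 * f v w ^+ 2 = 12^-1 *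
   ((f (u + v) w ^+ 4 + f (u - v) w ^+ 4) - 2 * (f u w ^+ 4 + f v w ^+ 4)).
  by rewrite fD fB; field.
under eq_Rintegral do rewrite e.
have a4 t : allmom P (fun w => f t w ^+ 4) by exact: allmomX.
have aD s t : allmom P (fun w => f s w ^+ 4 + f t w ^+ 4) by exact: allmomD.
have iD s t := allmom_integrable (aD s t).
have iZ s t := allmom_integrable (allmomZ 2 (aD s t)).
have iB := allmom_integrable (allmomB (aD (u + v) (u - v)) (allmomZ 2 (aD u v))).
rewrite ExpZ ?ExpB ?ExpZ ?ExpD ?E4//.
by rewrite !bBl !bBr !bDl !bDr (bC v u); field.
Qed.

(** Isserlis' formula, by polarising [Ef22] in each of its two arguments. *)
Let Ef4 u v s t : E (fun w => f u w * f v w * (f s w * f t w)) =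
  b u v * b s t + b u s * b v t + b u t * b v s.
Proof.
have e w : f u w * f v w * (f s w * f t w) = 16^-1 *
  ((f (u + v) w ^+ 2 * f (s + t) w ^+ 2 - f (u + v) w ^+ 2 * f (s - t) w ^+ 2) -
   (f (u - v) w ^+ 2 * f (s + t) w ^+ 2 - f (u - v) w ^+ 2 * f (s - t) w ^+ 2)).
  by rewrite !fB !fD; field.
under eq_Rintegral do rewrite e.
have a x y : allmom P (fun w => f x w ^+ 2 * f y w ^+ 2).
  by apply: allmomM; exact: allmomX.
have i x y : P.-integrable setT (EFin \o (fun w => f x w ^+ 2 * f y w ^+ 2)).
  exact: allmom_integrable.
have aB x y x' y' : allmom P (fun w => f x w ^+ 2 * f y w ^+ 2 - f x' w ^+ 2 * f y' w ^+ 2).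
  exact: allmomB.
have iB x y x' y' : P.-integrable setT (EFin \o
    (fun w => f x w ^+ 2 * f y w ^+ 2 - f x' w ^+ 2 * f y' w ^+ 2)).
  exact: allmom_integrable.
rewrite ExpZ; last by apply/allmom_integrable/allmomB.
rewrite ExpB// ExpB// ExpB// !Ef22.
rewrite !bBl !bBr !bDl !bDr !(bC v u) !(bC t s).
by field.
Qed.

Let fe (i : 'I_p) w : f (delta_mx i 0) w = Z w i 0.
Proof. by rewrite /f trmx_delta -rowE mxE. Qed.

Let be (i j : 'I_p) : b (delta_mx i 0) (delta_mx j 0) = S i j.
Proof. by rewrite /b trmx_delta -rowE -colE !mxE. Qed.

Lemma gaussian_coord_allmom i : allmom P (fun w => Z w i 0).
Proof. by under eq_fun do rewrite -fe; exact: af. Qed.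

Lemma gaussian_coord_cov i j : E (fun w => Z w i 0 * Z w j 0) = S i j.
Proof. by under eq_Rintegral do rewrite -!fe; rewrite Ef2 be. Qed.

Variable Q : 'M[R]_p.

(** These are the summands of the central limit theorem: taken at the normalised increments, they
    add up to the error of the realised covariance tested against [Q]. *)
Definition centred_quad (z : 'cV[R]_p) : R :=
  \sum_i \sum_j Q i j * (z i 0 * z j 0 - S i j).

Let aterm i j : allmom P (fun w => Q i j * (Z w i 0 * Z w j 0 - S i j)).
Proof.
apply: allmomZ; apply: allmomB; last exact: allmom_cst.
by apply: allmomM; exact: gaussian_coord_allmom.
Qed.

Lemma centred_quad_allmom : allmom P (fun w => centred_quad (Z w)).
Proof. by apply: allmom_sum => i _; apply: allmom_sum => j _; exact: aterm. Qed.

Lemma centred_quad_mean : E (fun w => centred_quad (Z w)) = 0.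
Proof.
rewrite Exp_sum => [|i _]; last by apply: allmom_sum => j _; exact: aterm.
rewrite big1// => i _; rewrite Exp_sum => [|j _]; last exact: aterm.
rewrite big1// => j _.
have a : allmom P (fun w => Z w i 0 * Z w j 0) by apply: allmomM; exact: gaussian_coord_allmom.
rewrite ExpZ; last by apply: allmom_integrable; apply: allmomB => //; exact: allmom_cst.
rewrite ExpB; [|exact: allmom_integrable|exact: integrable_cstr].
by rewrite gaussian_coord_cov Exp_cst subrr mulr0.
Qed.

(** Of the three pairings in Isserlis' formula, centring removes the one that matches i with j and k
    with l. *)
Lemma centred_quad_var : E (fun w => centred_quad (Z w) ^+ 2) =
  \sum_i \sum_j \sum_k \sum_l Q i j * Q k l * (S i k * S j l + S i l * S j k).
Proof.
have e w : centred_quad (Z w) ^+ 2 = \sum_i \sum_j \sum_k \sum_l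
    (Q i j * (Z w i 0 * Z w j 0 - S i j)) * (Q k l * (Z w k 0 * Z w l 0 - S k l)).
  rewrite expr2 {1}/centred_quad mulr_suml; apply: eq_bigr => i _.
  rewrite mulr_suml; apply: eq_bigr => j _.
  rewrite mulr_sumr; apply: eq_bigr => k _.
  by rewrite mulr_sumr.
under eq_Rintegral do rewrite e.
have a4 i j k l : allmom P (fun w => (Q i j * (Z w i 0 * Z w j 0 - S i j)) * (Q k l * (Z w k 0 * Z w l 0 - S k l))).
  by apply: allmomM; exact: aterm.
rewrite Exp_sum => [|i _]; last by do 3! (apply: allmom_sum => ? _); exact: a4.
apply: eq_bigr => i _.
rewrite Exp_sum => [|j _]; last by do 2! (apply: allmom_sum => ? _); exact: a4.
apply: eq_bigr => j _.
rewrite Exp_sum => [|k _]; last by apply: allmom_sum => ? _; exact: a4.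
apply: eq_bigr => k _.
rewrite Exp_sum => [|l _]; last exact: a4.
apply: eq_bigr => l _.
have e4 w : (Q i j * (Z w i 0 * Z w j 0 - S i j)) * (Q k l * (Z w k 0 * Z w l 0 - S k l)) =
  Q i j * Q k l * ((f (delta_mx i 0) w * f (delta_mx j 0) w * (f (delta_mx k 0) w * f (delta_mx l 0) w)
   - S k l * (f (delta_mx i 0) w * f (delta_mx j 0) w))
   - (S i j * (f (delta_mx k 0) w * f (delta_mx l 0) w) - S i j * S k l)).
  by rewrite !fe; ring.
under eq_Rintegral do rewrite e4.
have aM4 : allmom P (fun w => f (delta_mx i 0) w * f (delta_mx j 0) w * (f (delta_mx k 0) w * f (delta_mx l 0) w)).
  exact: allmomM.
have aZ c m n : allmom P (fun w => c * (f (delta_mx m 0) w * f (delta_mx n 0) w)) by exact: allmomZ.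
have aB1 : allmom P (fun w => f (delta_mx i 0) w * f (delta_mx j 0) w * (f (delta_mx k 0) w * f (delta_mx l 0) w)
   - S k l * (f (delta_mx i 0) w * f (delta_mx j 0) w)) by exact: allmomB.
have aB2 : allmom P (fun w => S i j * (f (delta_mx k 0) w * f (delta_mx l 0) w) - S i j * S k l).
  by apply: allmomB => //; exact: allmom_cst.
rewrite ExpZ; last by apply: allmom_integrable; exact: allmomB.
rewrite ExpB; [|exact: allmom_integrable..].
rewrite ExpB; [|exact: allmom_integrable..].
rewrite ExpB; [|exact: allmom_integrable|exact: integrable_cstr].
rewrite Exp_cst !ExpZ; [|exact/allmom_integrable/af2..].
rewrite Ef4 !Ef2 !be; ring.
Qed.

End gaussian_vector.

(** * A central limit theorem for cosines *)

Lemma indep_rv_comp d (Omega : measurableType d) (R : realType) (P : probability Omega R)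
    (U Y : Omega -> R) (f g : R -> R) :
  measurable_fun setT f -> measurable_fun setT g ->
  indep_rv P U Y -> indep_rv P (f \o U) (g \o Y).
Proof.
move=> mf mg UY A C mA mC.
have mi (h : R -> R) (D : set R) : measurable_fun setT h -> measurable D -> measurable (h @^-1` D).
  by move=> mh mD; rewrite -[X in measurable X]setTI; exact: mh.
exact: (UY _ _ (mi f _ mf mA) (mi g _ mg mC)).
Qed.

Section characteristic_function.
Context dsp (Omega : measurableType dsp) (R : realType) (P : probability Omega R).
Local Notation E := (Rintegral P setT).

Lemma measurable_cosD (Y : Omega -> R) (t c : R) : measurable_fun setT Y ->
  measurable_fun setT (fun w => cos (t + c * Y w)).
Proof.
move=> mY; apply: (@measurableT_comp _ _ _ _ _ _ (@cos R)).
  exact: continuous_measurable_fun (@continuous_cos R).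
by apply: measurable_funD => //; apply: measurable_funM.
Qed.

Lemma measurable_sinD (Y : Omega -> R) (t c : R) : measurable_fun setT Y ->
  measurable_fun setT (fun w => sin (t + c * Y w)).
Proof.
move=> mY; apply: (@measurableT_comp _ _ _ _ _ _ (@sin R)).
  exact: continuous_measurable_fun (@continuous_sin R).
by apply: measurable_funD => //; apply: measurable_funM.
Qed.

Lemma integrable_cosD (Y : Omega -> R) (t c : R) : measurable_fun setT Y ->
  P.-integrable setT (EFin \o (fun w => cos (t + c * Y w))).
Proof.
move=> mY; apply: (@integrable_bounded _ _ _ P _ 1); first exact: measurable_cosD.
by move=> w; rewrite ler_norml cos_geN1 cos_le1.
Qed.

Lemma integrable_sinD (Y : Omega -> R) (t c : R) : measurable_fun setT Y ->
  P.-integrable setT (EFin \o (fun w => sin (t + c * Y w))).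
Proof.
move=> mY; apply: (@integrable_bounded _ _ _ P _ 1); first exact: measurable_sinD.
by move=> w; rewrite ler_norml sin_geN1 sin_le1.
Qed.

Lemma Exp_norm_le1 (Y : Omega -> R) : measurable_fun setT Y ->
  (forall w, `|Y w| <= 1) -> `|E Y| <= 1.
Proof.
move=> mY Y1; have iY := integrable_bounded P mY Y1.
rewrite (le_trans (Exp_norm iY))// -[leRHS](Exp_cst P 1).
by apply: Exp_le => //; [exact: integrable_norm|exact: integrable_cstr].
Qed.

Lemma expR_neg_taylor (x : R) : 0 <= x -> `|expR (- x) - (1 - x)| <= x ^+ 2.
Proof.
move=> x0; have := expR_ge1Dx (- x) => lo; rewrite ger0_norm ?subr_ge0//.
have x1 : 0 < 1 + x by rewrite ltr_pwDl.
have : expR (- x) <= (1 + x)^-1.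
  by rewrite expRN lef_pV2 ?posrE ?expR_gt0// expR_ge1Dx.
have : (1 + x)^-1 <= 1 - x + x ^+ 2.
  rewrite -div1r ler_pdivrMr//.
  have : 0 <= x ^+ 3 by rewrite exprn_ge0.
  rewrite (_ : (1 - x + x ^+ 2) * (1 + x) = 1 + x ^+ 3); last by ring.
  lra.
lra.
Qed.

Variables (n : nat) (v : nat -> Omega -> R) (s2 m4 : R).
Hypothesis n_gt0 : (0 < n)%N.
Hypothesis v_allmom : forall k, (k < n)%N -> allmom P (v k).
Hypothesis v_mean : forall k, (k < n)%N -> E (v k) = 0.
Hypothesis v_var : forall k, (k < n)%N -> E (fun w => v k w ^+ 2) = s2.
Hypothesis v_m4 : forall k, (k < n)%N -> E (fun w => v k w ^+ 4) <= m4.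
Hypothesis v_indep : forall k, (k < n)%N ->
  indep_rv P (fun w => \sum_(i < k) v i w) (v k).

Let c := (Num.sqrt n%:R)^-1 : R.
Let c0 : 0 < c. Proof. by rewrite invr_gt0 sqrtr_gt0 ltr0n. Qed.
Let c1 : c <= 1.
Proof. by rewrite invf_le1 ?sqrtr_gt0 ?ltr0n// -[leLHS]sqrtr1 ler_wsqrtr// ler1n. Qed.
Let c2 : c ^+ 2 * n%:R = 1.
Proof. by rewrite exprVn sqr_sqrtr// mulVf// pnatr_eq0 -lt0n. Qed.

Let S k w := \sum_(i < k) v i w.
Let mv k : (k < n)%N -> measurable_fun setT (v k).
Proof. by move=> kn; have [] := v_allmom kn. Qed.
Let mS k : (k <= n)%N -> measurable_fun setT (S k).
Proof.
move=> kn; apply: measurable_sum => i.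
by apply: mv; rewrite (leq_trans _ kn).
Qed.

Let cos_v k : (k < n)%N ->
  `|E (fun w => cos (0 + c * v k w)) - (1 - s2 / 2 * c ^+ 2)| <= m4 * c ^+ 4.
Proof.
move=> kn; have a := v_allmom kn; have [_ iv] := a.
have e : E (fun w => 1 - c ^+ 2 / 2 * v k w ^+ 2) = 1 - s2 / 2 * c ^+ 2.
  rewrite ExpB; [|exact: integrable_cstr|exact: integrableZr'].
  by rewrite Exp_cst ExpZ// v_var//; ring.
have ip : P.-integrable setT (EFin \o (fun w => 1 - c ^+ 2 / 2 * v k w ^+ 2)).
  by apply: allmom_integrable; apply: allmomB; [exact: allmom_cst|apply/allmomZ/allmomX].
have ic := integrable_cosD 0 c (mv kn).
rewrite -e -ExpB//; apply: (le_trans (Exp_norm _)).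
  have := integrableDr ic (integrableZr' (-1) ip).
  by apply: eq_integrable => // w _ /=; rewrite mulN1r.
apply: (@le_trans _ _ (E (fun w => c ^+ 4 * v k w ^+ 4))); last first.
  by rewrite ExpZ// mulrC ler_wpM2r ?exprn_ge0 ?(ltW c0)// v_m4.
apply: Exp_le.
- apply: (integrable_norm (f := fun w => cos (0 + c * v k w) - (1 - c ^+ 2 / 2 * v k w ^+ 2))).
  have := integrableDr ic (integrableZr' (-1) ip).
  by apply: eq_integrable => // w _ /=; rewrite mulN1r.
- exact: integrableZr'.
move=> w; rewrite add0r -exprMn.
have -> : 1 - c ^+ 2 / 2 * v k w ^+ 2 = 1 - (c * v k w) ^+ 2 / 2 by ring.
exact: cos_taylor.
Qed.

(** The linear term has mean 0, so the expectation is of order c^3. The cubic remainder is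
    controlled by the fourth moment through x^3 <= 1 + x^4. *)
Let sin_v k : (k < n)%N ->
  `|E (fun w => sin (0 + c * v k w))| <= (1 + m4) * c ^+ 3.
Proof.
move=> kn; have a := v_allmom kn; have [_ iv] := a.
have i1 : P.-integrable setT (EFin \o (fun w => c * v k w)).
  by apply: allmom_integrable; exact: allmomZ.
have e : E (fun w => c * v k w) = 0.
  by rewrite ExpZ ?v_mean ?mulr0//; exact: allmom_integrable.
have is_ := integrable_sinD 0 c (mv kn).
have id_ : P.-integrable setT (EFin \o (fun w => sin (0 + c * v k w) - c * v k w)).
  have := integrableDr is_ (integrableZr' (-1) i1).
  by apply: eq_integrable => // w _ /=; rewrite mulN1r.
have -> : E (fun w => sin (0 + c * v k w)) = E (fun w => sin (0 + c * v k w) - c * v k w).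
  by rewrite ExpB// e subr0.
apply: (le_trans (Exp_norm id_)).
have i4 : P.-integrable setT (EFin \o (fun w => 1 + v k w ^+ 4)).
  by apply: integrableDr => //; exact: integrable_cstr.
apply: (@le_trans _ _ (E (fun w => c ^+ 3 * (1 + v k w ^+ 4)))); last first.
  rewrite ExpZ// ExpD//; last exact: integrable_cstr.
  by rewrite Exp_cst mulrC ler_wpM2r ?exprn_ge0 ?(ltW c0)// lerD2l v_m4.
apply: Exp_le; [exact: integrable_norm id_|exact: integrableZr'|].
move=> w; rewrite add0r (le_trans (sin_taylor _))// normrM exprMn gtr0_norm//.
rewrite ler_wpM2l ?exprn_ge0 ?(ltW c0)//.
have -> : v k w ^+ 4 = `|v k w| ^+ 4 by rewrite -normrX ger0_norm// (exprM _ 2 2) sqr_ge0.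
set x := `|_|; have x0 : 0 <= x by exact: normr_ge0.
have [x1|x1] := leP x 1.
  have : x ^+ 3 <= 1 by rewrite exprn_ile1.
  have : 0 <= x ^+ 4 by rewrite exprn_ge0.
  lra.
have : x ^+ 3 <= x ^+ 4 by rewrite ler_weXn2l// ltW.
lra.
Qed.

(** One more summand multiplies the expected cosine by nearly [rho], and since c^2 n = 1, [rho ^+ n]
    is exactly the factor e^(- s2 / 2) of the normal law. *)
Let rho := expR (- (s2 / 2 * c ^+ 2)).

Let s20 : 0 <= s2.
Proof.
rewrite -(v_var n_gt0); apply: Rintegral_ge0 => w _; exact: sqr_ge0.
Qed.

Let delta := (1 + m4) * c ^+ 3 + (m4 * c ^+ 4 + (s2 / 2 * c ^+ 2) ^+ 2).

(** Addition formula and independence. As the expected sine of c v is of order c^3, the sine term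
    counts as an error and the recursion closes on cosines; replacing the expected cosine of c v by
    [rho] costs order c^4. Hence [delta] is of order c^3, and the n = c^(-2) steps together cost
    order c. *)
Let step k t : (k < n)%N ->
  `|E (fun w => cos (t + c * S k.+1 w)) - rho * E (fun w => cos (t + c * S k w))| <= delta.
Proof.
move=> kn; have kn' := ltnW kn.
set x := E (fun w => cos (t + c * S k w)); set y := E (fun w => sin (t + c * S k w)).
set C := E (fun w => cos (0 + c * v k w)); set D := E (fun w => sin (0 + c * v k w)).
have mcos (a : R) : measurable_fun setT (fun z : R => cos (a + c * z)).
  apply: (@measurableT_comp _ _ _ _ _ _ (@cos R)); first exact: continuous_measurable_fun (@continuous_cos R).
  by apply: measurable_funD => //; apply: measurable_funM.
have msin (a : R) : measurable_fun setT (fun z : R => sin (a + c * z)).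
  apply: (@measurableT_comp _ _ _ _ _ _ (@sin R)); first exact: continuous_measurable_fun (@continuous_sin R).
  by apply: measurable_funD => //; apply: measurable_funM.
have i1 := indep_rv_comp (mcos t) (mcos 0) (v_indep kn).
have i2 := indep_rv_comp (msin t) (msin 0) (v_indep kn).
have [ic ec] := integral_indepM i1 (integrable_cosD t c (mS kn')) (integrable_cosD 0 c (mv kn)).
have [is_ es] := integral_indepM i2 (integrable_sinD t c (mS kn')) (integrable_sinD 0 c (mv kn)).
have -> : E (fun w => cos (t + c * S k.+1 w)) = x * C - y * D.
  rewrite /x /y /C /D -ec -es -ExpB//.
  apply: eq_Rintegral => w _ /=; rewrite -cosD /S big_ord_recr /=.
  by congr cos; ring.
have x1 : `|x| <= 1.
  apply: Exp_norm_le1; first exact/measurable_cosD/mS.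
  by move=> w; rewrite ler_norml cos_geN1 cos_le1.
have y1 : `|y| <= 1.
  apply: Exp_norm_le1; first exact/measurable_sinD/mS.
  by move=> w; rewrite ler_norml sin_geN1 sin_le1.
have -> : x * C - y * D - rho * x = x * (C - (1 - s2 / 2 * c ^+ 2)) - y * D
   - x * (rho - (1 - s2 / 2 * c ^+ 2)) by ring.
have hC := cos_v kn; have hD := sin_v kn.
have hr : `|rho - (1 - s2 / 2 * c ^+ 2)| <= (s2 / 2 * c ^+ 2) ^+ 2.
  by apply: expR_neg_taylor; rewrite mulr_ge0 ?sqr_ge0// divr_ge0.
have b (a z e : R) : `|a| <= 1 -> `|z| <= e -> `|a * z| <= e.
  by move=> a1 ze; rewrite normrM (le_trans _ ze)// ler_piMl.
rewrite (le_trans (ler_normB _ _))// (le_trans (lerD (ler_normB _ _) (lexx _)))//.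
by rewrite /delta; have := b _ _ _ x1 hC; have := b _ _ _ y1 hD; have := b _ _ _ x1 hr; lra.
Qed.

Lemma cos_clt_bound t :
  `|E (fun w => cos (t + c * S n w)) - cos t * expR (- (s2 / 2))|
    <= (1 + 2 * m4 + s2 ^+ 2) * c.
Proof.
have m40 : 0 <= m4.
  apply: le_trans (v_m4 n_gt0); apply: Rintegral_ge0 => w _.
  by rewrite (exprM _ 2 2) sqr_ge0.
have r01 : 0 <= rho <= 1.
  by rewrite expR_ge0 -(expR0 R) ler_expR oppr_le0 mulr_ge0 ?sqr_ge0// divr_ge0.
(* Errors add up without being amplified because [0 <= rho <= 1]. *)
have ind k : (k <= n)%N ->
    `|E (fun w => cos (t + c * S k w)) - rho ^+ k * cos t| <= k%:R * delta.
  elim: k => [_|k ih kn].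
    rewrite expr0 mul1r mul0r.
    rewrite (_ : E _ = cos t) ?subrr ?normr0//.
    rewrite -[RHS](Exp_cst P); apply: eq_Rintegral => w _.
    by rewrite /S big_ord0 mulr0 addr0.
  have {}ih := ih (ltnW kn); have st := step t kn.
  have -> : forall a, a - rho ^+ k.+1 * cos t =
     (a - rho * E (fun w => cos (t + c * S k w))) +
     rho * (E (fun w => cos (t + c * S k w)) - rho ^+ k * cos t).
    by move=> a; rewrite exprS; ring.
  rewrite (le_trans (ler_normD _ _))// -natr1 mulrDl mul1r addrC lerD//.
  rewrite normrM (le_trans _ ih)// ler_piMl// ger0_norm//; by case/andP: r01.
have := ind n (leqnn n).
have -> : rho ^+ n = expR (- (s2 / 2)).
  by rewrite /rho -expRM_natl mulrN mulrCA [n%:R * _]mulrC c2 mulr1.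
rewrite mulrC => /le_trans; apply.
rewrite /delta.
have nc k : n%:R * c ^+ k.+2 = c ^+ k by rewrite (exprD _ 2 k) mulrA [n%:R * _]mulrC c2 mul1r.
rewrite !mulrDr.
rewrite (_ : n%:R * ((1 + m4) * c ^+ 3) = (1 + m4) * c); last first.
  by rewrite mulrCA nc expr1.
rewrite (_ : n%:R * (m4 * c ^+ 4) = m4 * c ^+ 2); last by rewrite mulrCA nc.
rewrite (_ : n%:R * _ = (s2 / 2) ^+ 2 * c ^+ 2); last first.
  by rewrite exprMn -exprM mulrCA nc.
have cc : c ^+ 2 <= c by rewrite expr2 ler_piMl// ltW.
have h1 : m4 * c ^+ 2 <= m4 * c by rewrite ler_wpM2l.
have h2 : (s2 / 2) ^+ 2 * c ^+ 2 <= s2 ^+ 2 * c.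
  rewrite ler_pM ?sqr_ge0// exprMn ler_piMr ?sqr_ge0// exprVn invf_le1//; lra.
lra.
Qed.

End characteristic_function.

(** * Approximation by trigonometric polynomials *)

Section trig_polynomials.
Context {R : realType} {q : nat}.
Implicit Types (g h : 'cV[R]_q -> R).

(** A term consists of coefficient, frequency vector and phase. Thanks to the phase, sines belong to
    the family and product-to-sum formulas keep products in it, while its terms are just the test
    functions handled by the central limit theorem. *)
Definition trig_poly g := exists s : seq (R * 'cV[R]_q * R),
  forall x, g x = \sum_(t <- s) t.1.1 * cos (t.2 + (t.1.2^T *m x) 0 0).

Lemma trig_poly_ext g h : (forall x, g x = h x) -> trig_poly g -> trig_poly h.
Proof. by move=> gh [s gs]; exists s => x; rewrite -gh gs. Qed.

Lemma trig_poly_cst (c : R) : trig_poly (fun=> c).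
Proof.
by exists [:: (c, 0, 0)] => x; rewrite big_seq1 /= trmx0 mul0mx mxE addr0 cos0 mulr1.
Qed.

Lemma trig_polyD g h : trig_poly g -> trig_poly h -> trig_poly (fun x => g x + h x).
Proof. by move=> [s gs] [t ht]; exists (s ++ t) => x; rewrite big_cat /= gs ht. Qed.

Lemma trig_polyM g h : trig_poly g -> trig_poly h -> trig_poly (fun x => g x * h x).
Proof.
move=> [s gs] [t ht].
have key (a : R * 'cV[R]_q * R) : trig_poly (fun x =>
    a.1.1 * cos (a.2 + (a.1.2^T *m x) 0 0) * h x).
  exists ([seq (a.1.1 * b.1.1 / 2, a.1.2 + b.1.2, a.2 + b.2) | b <- t] ++
          [seq (a.1.1 * b.1.1 / 2, a.1.2 - b.1.2, a.2 - b.2) | b <- t]) => x.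
  rewrite ht big_cat /= !big_map -big_split /= mulr_sumr; apply: eq_bigr => b _.
  rewrite linearD linearB /= mulmxDl mulmxBl !mxE.
  set A := \sum_j (a.1.2)^T 0 j * _; set C := \sum_j (b.1.2)^T 0 j * _.
  rewrite (_ : a.2 + b.2 + (A + C) = (a.2 + A) + (b.2 + C)); last by ring.
  rewrite (_ : a.2 - b.2 + (A - C) = (a.2 + A) - (b.2 + C)); last by ring.
  by move: (a.2 + A) (b.2 + C) => y z; rewrite cosD cosB; field.
apply: (trig_poly_ext (g := fun x => \sum_(a <- s) (a.1.1 * cos (a.2 + (a.1.2^T *m x) 0 0) * h x))).
  by move=> x; rewrite gs mulr_suml.
elim: s {gs} => [|a s ih].
  by apply: trig_poly_ext (trig_poly_cst 0) => x; rewrite big_nil.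
by apply: trig_poly_ext (trig_polyD (key a) ih) => x; rewrite big_cons.
Qed.

Lemma trig_poly_sum (I : Type) (s : seq I) (g : I -> 'cV[R]_q -> R) :
  (forall i, trig_poly (g i)) -> trig_poly (fun x => \sum_(i <- s) g i x).
Proof.
move=> gi; elim: s => [|i s ih].
  by apply: trig_poly_ext (trig_poly_cst 0) => x; rewrite big_nil.
by apply: trig_poly_ext (trig_polyD (gi i) ih) => x; rewrite big_cons.
Qed.

Lemma trig_poly_prod (I : Type) (s : seq I) (g : I -> 'cV[R]_q -> R) :
  (forall i, trig_poly (g i)) -> trig_poly (fun x => \prod_(i <- s) g i x).
Proof.
move=> gi; elim: s => [|i s ih].
  by apply: trig_poly_ext (trig_poly_cst 1) => x; rewrite big_nil.
by apply: trig_poly_ext (trig_polyM (gi i) ih) => x; rewrite big_cons.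
Qed.

Lemma trig_poly_sin (c : R) (j : 'I_q) : trig_poly (fun x => sin (c * x j 0)).
Proof.
exists [:: (1, c *: delta_mx j 0, - (pi / 2))] => x.
rewrite big_seq1 /= mul1r.
have -> : (c *: delta_mx j 0 : 'cV[R]_q)^T = c *: delta_mx 0 j.
  by apply/rowP => i; rewrite !mxE andbC.
rewrite -scalemxAl mxE -rowE mxE.
by rewrite cosD cosN sinN cos_pihalf sin_pihalf; ring.
Qed.

End trig_polynomials.

(** * Bernstein polynomials in one and several variables *)

Section bernstein.
Context {R : realType}.

(* [bern N i p] is the probability that a binomial variable with parameters
   [N] and [p] equals [i]. *)
Fixpoint bern (N i : nat) (p : R) : R :=
  if N is N'.+1 then
    (if i is i'.+1 then p * bern N' i' p else 0) + (1 - p) * bern N' i p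
  else (i == 0%N)%:R.

Lemma bern_big N i p : (N < i)%N -> bern N i p = 0.
Proof.
elim: N i => [|N ih] [|i]//= Ni; first by rewrite !ih ?mulr0 ?addr0// ltnW.
Qed.

Lemma bern_ge0 N i p : 0 <= p <= 1 -> 0 <= bern N i p.
Proof.
move=> /andP[p0 p1]; elim: N i => [|N ih] i /=; first exact: ler0n.
rewrite addr_ge0// ?mulr_ge0 ?subr_ge0//; case: i => // i.
by rewrite mulr_ge0.
Qed.

(** Conditioning on one trial reduces an expectation over [N.+1] trials to two expectations over
    [N]; the first two moments follow by induction. *)
Lemma bern_sumS N p (phi : nat -> R) :
  \sum_(i < N.+2) bern N.+1 i p * phi i =
  p * (\sum_(i < N.+1) bern N i p * phi i.+1) +
  (1 - p) * \sum_(i < N.+1) bern N i p * phi i.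
Proof.
rewrite /=; under eq_bigr do rewrite mulrDl.
rewrite big_split /=; congr (_ + _).
  by rewrite big_ord_recl /= mul0r add0r mulr_sumr; apply: eq_bigr => i _; rewrite mulrA.
rewrite big_ord_recr /= bern_big// mulr0 mul0r addr0 mulr_sumr.
by apply: eq_bigr => i _; rewrite mulrA.
Qed.

Lemma bern_sum N p : \sum_(i < N.+1) bern N i p = 1.
Proof.
have -> : \sum_(i < N.+1) bern N i p = \sum_(i < N.+1) bern N i p * 1.
  by apply: eq_bigr => i _; rewrite mulr1.
elim: N => [|N ih]; first by rewrite big_ord_recl big_ord0 /=; ring.
by rewrite (bern_sumS N p (fun=> 1)) ih; ring.
Qed.

Lemma bern_mean N p : \sum_(i < N.+1) bern N i p * i%:R = N%:R * p.
Proof.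
elim: N => [|N ih]; first by rewrite big_ord_recl big_ord0 /=; ring.
rewrite (bern_sumS N p (fun i => i%:R)) ih.
under eq_bigr do rewrite -natr1 mulrDr mulr1.
by rewrite big_split /= ih bern_sum -natr1; ring.
Qed.

Lemma bern_sqr N p : \sum_(i < N.+1) bern N i p * i%:R ^+ 2 =
  N%:R ^+ 2 * p ^+ 2 + N%:R * (p * (1 - p)).
Proof.
elim: N => [|N ih]; first by rewrite big_ord_recl big_ord0 /=; ring.
rewrite (bern_sumS N p (fun i => i%:R ^+ 2)) ih.
have -> : \sum_(i < N.+1) bern N i p * i.+1%:R ^+ 2 =
    \sum_(i < N.+1) bern N i p * i%:R ^+ 2 +
    (2 * \sum_(i < N.+1) bern N i p * i%:R + \sum_(i < N.+1) bern N i p).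
  rewrite mulr_sumr -!big_split /=; apply: eq_bigr => i _.
  by rewrite -natr1; ring.
by rewrite ih bern_mean bern_sum -natr1; ring.
Qed.

Lemma bern_var N p : (0 < N)%N -> 0 <= p <= 1 ->
  \sum_(i < N.+1) bern N i p * (i%:R / N%:R - p) ^+ 2 <= N%:R^-1.
Proof.
move=> N0 /andP[p0 p1]; have n0 : N%:R != 0 :> R by rewrite pnatr_eq0 -lt0n.
have -> : \sum_(i < N.+1) bern N i p * (i%:R / N%:R - p) ^+ 2 =
    N%:R ^- 2 * (\sum_(i < N.+1) bern N i p * i%:R ^+ 2) +
    ((- (2 * p / N%:R)) * (\sum_(i < N.+1) bern N i p * i%:R) +
     p ^+ 2 * \sum_(i < N.+1) bern N i p).
  rewrite !mulr_sumr -!big_split /=; apply: eq_bigr => i _.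
  by field.
rewrite bern_sqr bern_mean bern_sum.
have -> : N%:R ^- 2 * (N%:R ^+ 2 * p ^+ 2 + N%:R * (p * (1 - p))) +
    (- (2 * p / N%:R) * (N%:R * p) + p ^+ 2 * 1) = N%:R^-1 * (p * (1 - p)) by field.
rewrite ler_piMr ?invr_ge0//; nra.
Qed.

Lemma bern_trig q N i (g : 'cV[R]_q -> R) : trig_poly g ->
  trig_poly (fun x => bern N i (g x)).
Proof.
move=> tg; elim: N i => [|N ih] i /=; first exact: trig_poly_cst.
apply: trig_polyD; first by case: i => [|i]; [exact: trig_poly_cst|exact: trig_polyM].
apply: trig_polyM => //; apply: trig_polyD; first exact: trig_poly_cst.
by apply: trig_poly_ext (trig_polyM (trig_poly_cst (-1)) tg) => x; rewrite mulN1r.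
Qed.

End bernstein.

Section multivariate_bernstein.
Context {R : realType} {q N : nat}.
Variable p : 'I_q -> R.
Hypothesis p01 : forall j, 0 <= p j <= 1.

(** The joint law of independent binomial variables, one for each coordinate. *)
Definition mbern (k : {ffun 'I_q -> 'I_N.+1}) : R := \prod_j bern N (k j) (p j).

Lemma mbern_ge0 k : 0 <= mbern k.
Proof. by apply: prodr_ge0 => j _; exact: bern_ge0. Qed.

Lemma mbern_sum : \sum_k mbern k = 1.
Proof.
rewrite -(bigA_distr_bigA (fun j (i : 'I_N.+1) => bern N i (p j))) /=.
by rewrite big1// => j _; exact: bern_sum.
Qed.

Lemma mbern_var j : (0 < N)%N ->
  \sum_k mbern k * ((k j)%:R / N%:R - p j) ^+ 2 <= N%:R^-1.
Proof.
move=> N0.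
(* The squared deviation is placed into the factor of coordinate [j], so that the sum over all [k]
   factorises over the coordinates. *)
pose F j' (i : 'I_N.+1) := bern N i (p j') *
   (if j' == j then (i%:R / N%:R - p j) ^+ 2 else 1).
have -> : \sum_k mbern k * ((k j)%:R / N%:R - p j) ^+ 2 =
    \sum_(k : {ffun 'I_q -> 'I_N.+1}) \prod_j' F j' (k j').
  apply: eq_bigr => k _; rewrite /F big_split /=; congr (_ * _).
  by rewrite -big_mkcond /= big_pred1_eq.
rewrite -(bigA_distr_bigA F) (bigD1 j)//=.
have -> : \prod_(l | l != j) \sum_(i < N.+1) F l i = 1.
  apply: big1 => l lj; rewrite /F; under eq_bigr do rewrite (negbTE lj) mulr1.
  exact: bern_sum.
rewrite mulr1 /F; under eq_bigr do rewrite eqxx.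
exact: bern_var.
Qed.

End multivariate_bernstein.

Section trig_approximation.
Context {R : realType}.

(** A quantitative inverse of the sine; the square is due to its derivative vanishing at the end
    points. With half sum u and half difference t, the difference of the sines is 2 cos u sin t.
    Here sin t >= t / 3 because t <= 2, and cos u >= sin t because |u| <= pi/2 - t. *)
Lemma sin_sub_ge (a b : R) : - (pi / 2) <= a <= pi / 2 -> - (pi / 2) <= b <= pi / 2 ->
  (a - b) ^+ 2 <= 18 * `|sin a - sin b|.
Proof.
wlog ba : a b / b <= a.
  move=> h ha hb; have [ba|/ltW ab] := leP b a; first exact: h.
  by rewrite -sqrrN opprB distrC; exact: h.
move=> /andP[a1 a2] /andP[b1 b2].
set t := (a - b) / 2; set u := (a + b) / 2.
have pi4 : pi / 2 <= 2 :> R by case/andP: (pihalf_02 R) => _ /ltW.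
have t0 : 0 <= t by rewrite divr_ge0// subr_ge0.
have -> : a = u + t by rewrite /u /t; field.
have -> : b = u - t by rewrite /u /t; field.
have -> : sin (u + t) - sin (u - t) = 2 * (cos u * sin t).
  by rewrite sinD sinB; ring.
have st : t / 3 <= sin t.
  apply: le_trans (sin_ge_taylor3 t0).
  have t2 : t <= 2 by rewrite /t; lra.
  have : t ^+ 3 <= 4 * t.
    by rewrite (_ : t ^+ 3 = t ^+ 2 * t) ?ler_wpM2r// ?exprSr//; nra.
  lra.
have cu : sin t <= cos u.
  have -> : sin t = cos (pi / 2 - t) by rewrite cosB cos_pihalf sin_pihalf; ring.
  have -> : cos u = cos `|u|.
    by have [u0|u0] := leP 0 u; rewrite ?(ger0_norm u0) ?(ltr0_norm u0) ?cosN.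
  have u1 : `|u| <= pi / 2 - t by rewrite ler_norml /u /t; apply/andP; split; lra.
  rewrite leNgt; apply/negP; rewrite ltr_cos; first by rewrite ltNge u1.
    by rewrite in_itv /= (le_trans (normr_ge0 _) u1)/=; have := pi_ge0 R; lra.
  by rewrite in_itv /= normr_ge0 (le_trans u1)//; have := pi_ge0 R; lra.
have s0 : 0 <= sin t by rewrite (le_trans _ st)// divr_ge0.
have c0 := le_trans s0 cu.
rewrite ger0_norm; last by rewrite !mulr_ge0.
have t3 : 0 <= t / 3 by rewrite divr_ge0.
have : t / 3 * (t / 3) <= cos u * sin t by apply: ler_pM => //; exact: le_trans st cu.
rewrite (_ : u + t - (u - t) = 2 * t); last by ring.
rewrite exprMn expr2; lra.
Qed.

Lemma continuous_trmx_rV q : continuous (fun v : 'rV[R]_q => v^T).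
Proof.
move=> v A /nbhs_ballP[e /= e0 eA]; apply/nbhs_ballP; exists e => //= w [_ vw].
by apply: eA; split => // i j; rewrite !mxE; exact: vw.
Qed.

(** Only [x] is confined to the box. The point [y] may leave it, as do some of the interpolation
    nodes K asin(s) to which this is applied. *)
Lemma uniformly_continuous_box q (f : 'cV[R]_q -> R) (K e : R) :
  continuous f -> 0 < e ->
  exists2 d : R, 0 < d & forall x y : 'cV[R]_q, (forall j, `|x j 0| <= K) ->
    (forall j, `|y j 0 - x j 0| < d) -> `|f y - f x| < e.
Proof.
move=> cf e0; pose g (v : 'rV[R]_q) := f v^T.
have cg : continuous g.
  by move=> v; apply: continuous_comp; [exact: continuous_trmx_rV|exact: cf].
have cK : compact [set v : 'rV[R]_q | forall i, `[- K, K]%classic (v ord0 i)].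
  by apply: (@rV_compact _ _ (fun=> `[- K, K]%classic)) => i; exact: segment_compact.
have /compact_near_coveringP := cK.
move=> /(_ R (0^'+) (fun (d : R) (v : 'rV[R]_q) => forall w : 'rV[R]_q, (forall j, `|w 0 j - v 0 j| < d) -> `|g w - g v| < e)).
have near1 : forall v : 'rV[R]_q, (forall i, `[- K, K]%classic (v ord0 i)) ->
    \forall v' \near v & d \near (0 : R)^'+,
    (fun (d : R) (v : 'rV[R]_q) => forall w : 'rV[R]_q, (forall j, `|w 0 j - v 0 j| < d) -> `|g w - g v| < e) d v'.
  move=> v _; have /cvg_ballP/(_ (e / 2)) := cg v.
  rewrite divr_gt0// => /(_ isT)/nbhs_ballP[r /= r0 hr].
  have hr' (w : 'rV[R]_q) : (forall j, `|w 0 j - v 0 j| < r) -> `|g w - g v| < e / 2.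
    move=> h; rewrite distrC; apply: hr; split => // i j.
    by rewrite ord1 /ball /= distrC; exact: h.
  exists (ball v (r / 2), `]0, (r / 2)[%classic).
    split => /=; first by apply: nbhsx_ballx; rewrite divr_gt0.
    exists (r / 2) => /=; first by rewrite divr_gt0.
    move=> x; rewrite /= sub0r normrN => xr x0.
    by rewrite in_itv /= x0 (le_lt_trans (ler_norm _) xr).
  move=> [v' d] /= [[_ bv'] d0] w hw.
  have vv' j : `|v' 0 j - v 0 j| < r / 2 by rewrite distrC; exact: bv'.
  move: d0; rewrite in_itv /= => /andP[d0 dr].
  have h1 : `|g w - g v| < e / 2.
    apply: hr' => j; rewrite (splitr r) (le_lt_trans (ler_distD (v' 0 j) _ _))// ltrD//.
    exact: lt_trans (hw j) dr.
  have h2 : `|g v' - g v| < e / 2.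
    apply: hr' => j; rewrite (lt_trans (vv' j))//; lra.
  rewrite (splitr e) (le_lt_trans (ler_distD (g v) _ _))// ltrD//.
  by rewrite distrC.
move=> cover; have [d /= d0 hd] := cover _ near1.
exists (d / 2); first by rewrite divr_gt0.
move=> x y xK xy.
have := hd (d / 2); rewrite /ball /= sub0r normrN gtr0_norm ?divr_gt0//.
rewrite ltr_pdivrMr// mulr_natr mulr2n ltrDl d0 => /(_ isT).
move=> /(_ isT x^T).
have xT : forall i, `[- K, K]%classic (x^T ord0 i).
  by move=> i /=; rewrite in_itv /= mxE -ler_norml.
move=> /(_ xT y^T); rewrite /g !trmxK; apply.
by move=> j; rewrite !mxE.
Qed.

(** Bernstein's operator in the variables (1 + sin (x_j / K)) / 2, which range over [0, 1]; on the
    box, x_j / K stays where the sine is injective. As [g] is a convex combination of values of [f],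
    it keeps the bound [M] on the whole space, which later controls the mass outside the box. *)
Lemma trig_approx q (f : 'cV[R]_q -> R) (M K e : R) :
  continuous f -> (forall x, `|f x| <= M) -> 0 < K -> 0 < e ->
  exists g : 'cV[R]_q -> R, [/\ trig_poly g, (forall x, `|g x| <= M) &
    forall x : 'cV[R]_q, (forall j, `|x j 0| <= K) -> `|g x - f x| <= e].
Proof.
move=> cf fM K0 e0.
have M0 : 0 <= M by rewrite (le_trans _ (fM 0)).
have [d d0 hd] := uniformly_continuous_box K cf (divr_gt0 e0 (ltr0Sn R 1)).
(* If k_j / n is within [eta] of p_j, the sines differ by less than 2 eta, so by [sin_sub_ge] the
   node is within the root of 36 K^2 eta, which is [d]. *)
pose eta := d ^+ 2 / (36 * K ^+ 2).
have eta0 : 0 < eta by rewrite divr_gt0 ?exprn_gt0// mulr_gt0// exprn_gt0.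
(* Chebyshev's inequality, summed over the [q] coordinates, bounds the contribution of far nodes by
   C / n. *)
pose C := 2 * M * q%:R / eta ^+ 2.
have C0 : 0 <= C by rewrite !mulr_ge0// invr_ge0 exprn_ge0// ltW.
have [N CN] : exists N : nat, C / (e / 2) < N.+1%:R.
  by exists (Num.truncn (C / (e / 2))); exact: truncnS_gt.
pose n := N.+1.
pose p (x : 'cV[R]_q) j := (1 + sin (K^-1 * x j 0)) / 2.
have p01 x j : 0 <= p x j <= 1.
  rewrite /p; have := sin_geN1 (K^-1 * x j 0); have := sin_le1 (K^-1 * x j 0).
  by move=> h1 h2; apply/andP; split; lra.
pose y (k : {ffun 'I_q -> 'I_n.+1}) : 'cV[R]_q :=
  \col_j (K * asin (2 * ((k j)%:R / n%:R) - 1)).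
pose g (x : 'cV[R]_q) := \sum_(k : {ffun 'I_q -> 'I_n.+1}) f (y k) * mbern (p x) k.
have tp j : trig_poly (fun x => p x j).
  apply: (trig_poly_ext (g := fun x => 2^-1 * (1 + sin (K^-1 * x j 0)))).
    by move=> x; rewrite /p mulrC.
  apply: trig_polyM (trig_poly_cst _) _.
  by apply: trig_polyD (trig_poly_cst _) _; exact: trig_poly_sin.
exists g; split.
- apply: trig_poly_sum => k; apply: trig_polyM (trig_poly_cst _) _.
  by apply: trig_poly_prod => j; exact: bern_trig.
- move=> x; rewrite (le_trans (ler_norm_sum _ _ _))//.
  rewrite -[leRHS]mulr1 -(@mbern_sum R q n (p x)) mulr_sumr; apply: ler_sum => k _.
  by rewrite normrM [X in _ * X]ger0_norm ?mbern_ge0// ler_wpM2r ?mbern_ge0.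
move=> x xK.
have -> : g x - f x = \sum_(k : {ffun 'I_q -> 'I_n.+1}) (f (y k) - f x) * mbern (p x) k.
  under [RHS]eq_bigr do rewrite mulrBl.
  by rewrite sumrB -mulr_sumr mbern_sum mulr1.
(* Near nodes are handled by uniform continuity. At a far node some squared deviation exceeds eta^2,
   so its term alone dominates 2 M. *)
have key (k : {ffun 'I_q -> 'I_n.+1}) : `|f (y k) - f x| <=
    e / 2 + \sum_j (2 * M / eta ^+ 2) * ((k j)%:R / n%:R - p x j) ^+ 2.
  have c0 : 0 <= 2 * M / eta ^+ 2 by rewrite !mulr_ge0// invr_ge0 exprn_ge0// ltW.
  have [/forallP far|] := boolP [forall j, `|(k j)%:R / n%:R - p x j| < eta].
    have : `|f (y k) - f x| < e / 2.
      apply: hd => // j; rewrite /y mxE.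
      have kn : 0 <= ((k j)%:R / n%:R : R) <= 1.
        by rewrite divr_ge0//= ler_pdivrMr// mul1r ler_nat -ltnS.
      set s := 2 * _ - 1.
      have s1 : -1 <= s <= 1 by move: kn => /andP[? ?]; apply/andP; split; rewrite /s; lra.
      have [as1 as2] := asin_def s1.
      pose b := K^-1 * x j 0.
      have b1 : - (pi / 2) <= b <= pi / 2.
        have := pihalf_ge1 R; have : `|b| <= 1.
          by rewrite /b normrM gtr0_norm ?invr_gt0// mulrC ler_pdivrMr// mul1r.
        by rewrite ler_norml => /andP[? ?] ?; apply/andP; split; lra.
      have := sin_sub_ge as1 b1; rewrite as2.
      have -> : s - sin b = 2 * ((k j)%:R / n%:R - p x j) by rewrite /s /p /b; field; rewrite pnatr_eq0.
      rewrite normrM gtr0_norm// => h.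
      have -> : x j 0 = K * b by rewrite /b mulrA divff ?mul1r// gt_eqF.
      rewrite -mulrBr -ltr_sqr ?nnegrE ?(ltW d0)// -normrX exprMn ger0_norm; last first.
        by rewrite mulr_ge0// ?sqr_ge0// exprn_ge0// ltW.
      have K2 : 0 < K ^+ 2 by rewrite exprn_gt0.
      have hf := far j; rewrite /eta ltr_pdivlMr ?mulr_gt0// in hf.
      apply: le_lt_trans hf.
      have := ler_wpM2l (ltW K2) h; lra.
    move=> /ltW h; rewrite (le_trans h)// lerDl; apply: sumr_ge0 => j _.
    by rewrite mulr_ge0// sqr_ge0.
  rewrite negb_forall => /existsP[j]; rewrite -leNgt => near_.
  apply: (@le_trans _ _ (2 * M)).
    by rewrite (le_trans (ler_normB _ _))// mulr_natl mulr2n lerD.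
  rewrite (bigD1 j)//= addrA.
  have h1 : 2 * M <= 2 * M / eta ^+ 2 * ((k j)%:R / n%:R - p x j) ^+ 2.
    rewrite -mulrA ler_peMr ?mulr_ge0// mulrC ler_pdivlMr ?exprn_gt0// mul1r.
    by rewrite -[leRHS]ger0_norm ?sqr_ge0// normrX lerXn2r ?nnegrE// ltW.
  rewrite (le_trans h1)// addrAC lerDr addr_ge0 ?divr_ge0 ?(ltW e0)//.
  by apply: sumr_ge0 => l _; rewrite mulr_ge0// sqr_ge0.
rewrite (le_trans (ler_norm_sum _ _ _))//.
apply: (@le_trans _ _ (\sum_(k : {ffun 'I_q -> 'I_n.+1}) (e / 2 +
     \sum_j (2 * M / eta ^+ 2) * ((k j)%:R / n%:R - p x j) ^+ 2) * mbern (p x) k)).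
  apply: ler_sum => k _; rewrite normrM [X in _ * X]ger0_norm ?mbern_ge0//.
  by rewrite ler_wpM2r ?mbern_ge0.
under eq_bigr do rewrite mulrDl.
rewrite big_split /= -mulr_sumr mbern_sum mulr1.
rewrite [leRHS](splitr e) lerD2l.
under eq_bigr do rewrite mulr_suml.
rewrite exchange_big /=.
apply: (@le_trans _ _ (\sum_(j < q) (2 * M / eta ^+ 2) * n%:R^-1)).
  apply: ler_sum => j _.
  under eq_bigr do rewrite -mulrA [_ ^+ 2 * _]mulrC.
  rewrite -mulr_sumr ler_wpM2l ?mbern_var//.
  by rewrite !mulr_ge0// invr_ge0 exprn_ge0// ltW.
rewrite sumr_const card_ord -[_ *+ q]mulr_natr.
have -> : 2 * M / eta ^+ 2 / n%:R * q%:R = C / n%:R.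
  by rewrite /C mulrAC; congr (_ / _); rewrite mulrAC.
rewrite ler_pdivrMr// mulrC -ler_pdivrMr ?divr_gt0//; exact: ltW.
Qed.

End trig_approximation.

Section measurability_of_matrices.
Context {R : realType}.

Lemma continuous_measurable_mx m n (f : 'M[R]_(m, n) -> R) : continuous f ->
  measurable_fun setT f.
Proof.
move=> cf; apply: (measurability (@RGenOpens.G R)); first exact: RGenOpens.measurableE.
move=> _ [_ [x [y ->]] <-]; rewrite setTI measurable_mxE; apply: sub_sigma_algebra => /=.
by apply: open_comp; [move=> M _; exact: cf|exact: interval_open].
Qed.

Lemma measurable_entryT d (T : measurableType d) m n (f : T -> 'M[R]_(m, n)) i j :
  measurable_fun setT f -> measurable_fun setT (fun w => f w i j).
Proof. by move=> mf; exact: (measurableT_comp (measurable_entry i j) mf). Qed.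

Lemma measurable_linear_form d (T : measurableType d) q (u : 'cV[R]_q) (f : T -> 'cV[R]_q) :
  measurable_fun setT f -> measurable_fun setT (fun w => (u^T *m f w) 0 0).
Proof.
move=> mf; under eq_fun do rewrite mxE.
apply: measurable_sum => j; apply: measurable_funM => //.
exact: measurable_entryT.
Qed.

Lemma measurable_mulmx d (T : measurableType d) m n k (A : 'M[R]_(m, n)) (f : T -> 'M[R]_(n, k)) :
  measurable_fun setT f -> measurable_fun setT (fun w => A *m f w).
Proof.
move=> mf; apply: measurable_fun_mx => i j; under eq_fun do rewrite mxE.
apply: measurable_sum => l; apply: measurable_funM => //.
exact: measurable_entryT.
Qed.

Lemma measurable_forall_ord d (T : measurableType d) q (A : 'I_q -> set T) :
  (forall j, measurable (A j)) -> measurable [set w | forall j, A j w].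
Proof.
move=> mA; rewrite (_ : [set _ | _] = \bigcap_(j in [set: 'I_q]) A j).
  by apply: fin_bigcap_measurable.
by apply/seteqP; split => w /= h j; [move=> _; exact: h|exact: h].
Qed.

Lemma measurable_box d (T : measurableType d) q (f : T -> 'cV[R]_q) (K : R) :
  measurable_fun setT f -> measurable [set w | forall j, `|f w j 0| <= K].
Proof.
move=> mf; apply: measurable_forall_ord => j.
apply: (@measurable_leset _ T R (fun w => `|f w j 0|) (fun=> K)) => //.
by apply: measurableT_comp => //; exact: measurable_entryT.
Qed.

Lemma measurable_trig_poly q (g : 'cV[R]_q -> R) : trig_poly g -> measurable_fun setT g.
Proof.
move=> [s gs]; rewrite (_ : g = fun x => \sum_(t <- s) t.1.1 * cos (t.2 + (t.1.2^T *m x) 0 0)); last exact/funext.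
apply: measurable_sum => t; apply: measurable_funM => //.
apply: (@measurableT_comp _ _ _ _ _ _ (@cos R)).
  exact: continuous_measurable_fun (@continuous_cos R).
by apply: measurable_funD => //; exact: measurable_linear_form.
Qed.

End measurability_of_matrices.

Section law_approximation.
Context dsp (Omega : measurableType dsp) (R : realType) (P : probability Omega R).
Local Notation E := (Rintegral P setT).

Lemma Exp_diff_le (f g : Omega -> R) (A : set Omega) (M e e' : R) :
  measurable_fun setT f -> measurable_fun setT g -> measurable A ->
  (forall w, `|f w| <= M) -> (forall w, `|g w| <= M) -> 0 <= e ->
  (forall w, ~ A w -> `|g w - f w| <= e) -> (P A <= e'%:E)%E ->
  `|E f - E g| <= e + 2 * M * e'.
Proof.
move=> mf mg mA fM gM e0 fg Pe.
have M0 : 0 <= M by rewrite (le_trans _ (fM point)).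
have iF := integrable_bounded P mf fM; have iG := integrable_bounded P mg gM.
have idiff : P.-integrable setT (EFin \o (fun w => f w - g w)).
  have := integrableDr iF (integrableZr' (-1) iG).
  by apply: eq_integrable => // w _ /=; rewrite mulN1r.
have iA : P.-integrable setT (EFin \o (fun w => 2 * M * \1_A w)).
  by apply: integrableZr'; exact: integrable_indic.
rewrite -ExpB//; apply: (le_trans (Exp_norm idiff)).
apply: (@le_trans _ _ (E (fun w => e + 2 * M * \1_A w))).
  apply: Exp_le; first exact: integrable_norm idiff.
    by apply: integrableDr => //; exact: integrable_cstr.
  move=> w; rewrite indicE; have [Aw|nAw] := pselect (A w); last first.
    by rewrite memNset// mulr0 addr0 distrC fg.
  rewrite mem_set// mulr1 (le_trans (ler_normB _ _))//.
  by have := fM w; have := gM w; lra.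
rewrite ExpD//; last exact: integrable_cstr.
rewrite Exp_cst lerD2l ExpZ; last exact: integrable_indic.
rewrite ler_wpM2l ?mulr_ge0//.
have fA : P A \is a fin_num by rewrite fin_num_measure.
by rewrite /Rintegral integral_indic// setIT -lee_fin fineK.
Qed.

Lemma law_approx q (Y : Omega -> 'cV[R]_q) (f g : 'cV[R]_q -> R) (M K e e' : R) :
  measurable_fun setT Y -> measurable_fun setT f -> measurable_fun setT g ->
  (forall x, `|f x| <= M) -> (forall x, `|g x| <= M) -> 0 <= e ->
  (forall x : 'cV[R]_q, (forall j, `|x j 0| <= K) -> `|g x - f x| <= e) ->
  (P (~` [set w | forall j, (`|Y w j 0| <= K)%R]) <= e'%:E)%E ->
  `|E (fun w => f (Y w)) - E (fun w => g (Y w))| <= e + 2 * M * e'.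
Proof.
move=> mY mf mg fM gM e0 fg; apply: Exp_diff_le => //.
- exact: measurableT_comp.
- exact: measurableT_comp.
- by apply/measurableC/measurable_box.
by move=> w /contrapT; exact: fg.
Qed.

End law_approximation.

(** * Convergence in law from shifted cosines and tightness *)

Section convergence_in_law.
Context dsp (Omega : measurableType dsp) (R : realType) (P : probability Omega R).
Variables (q : nat) (Z : nat -> Omega -> 'cV[R]_q) (nu : probability 'cV[R]_q R).
Hypothesis mZ : forall n, measurable_fun setT (Z n).

(** Tightness confines all laws to one box up to small mass. There [f] is close to a trigonometric
    polynomial with the same global bound, and for trigonometric polynomials convergence is the
    first hypothesis, by linearity. *)
Lemma cvg_in_law_trig :
  (forall (t : R) (u : 'cV[R]_q),
    \int[P]_w cos (t + (u^T *m Z n w) 0 0) @[n --> \oo] -->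
    \int[nu]_x cos (t + (u^T *m x) 0 0)) ->
  (forall e : R, 0 < e -> exists K : R, [/\ 0 < K,
     \forall n \near \oo, (P (~` [set w | forall j, (`|Z n w j 0| <= K)%R]) <= e%:E)%E &
     (nu (~` [set x : 'cV[R]_q | forall j, (`|x j 0| <= K)%R]) <= e%:E)%E]) ->
  cvg_in_law P Z nu.
Proof.
move=> cosZ tight f cf [M fM].
have mid : measurable_fun setT (@id 'cV[R]_q) by exact: measurable_id.
have mf := continuous_measurable_mx cf.
have M0 : 0 <= M by rewrite (le_trans _ (fM 0)).
have trigZ g : trig_poly g ->
    \int[P]_w g (Z n w) @[n --> \oo] --> \int[nu]_x g x.
  move=> [s gs].
  have mc d (T : measurableType d) (Y : T -> 'cV[R]_q) (t : R) (u : 'cV[R]_q) : measurable_fun setT Y ->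
      measurable_fun setT (fun w => cos (t + (u^T *m Y w) 0 0)).
    move=> mY; apply: (@measurableT_comp _ _ _ _ _ _ (@cos R)).
      exact: continuous_measurable_fun (@continuous_cos R).
    by apply: measurable_funD => //; exact: measurable_linear_form.
  have ic d (T : measurableType d) (Q : probability T R) (Y : T -> 'cV[R]_q) (t : R) (u : 'cV[R]_q) :
      measurable_fun setT Y ->
      Q.-integrable setT (EFin \o (fun w => cos (t + (u^T *m Y w) 0 0))).
    move=> mY; apply: (@integrable_bounded _ _ _ Q _ 1); first exact: mc.
    by move=> w; rewrite ler_norml cos_geN1 cos_le1.
  have Es d (T : measurableType d) (Q : probability T R) (Y : T -> 'cV[R]_q) :
      measurable_fun setT Y -> \int[Q]_w g (Y w) =
      \sum_(t <- s) t.1.1 * \int[Q]_w cos (t.2 + (t.1.2^T *m Y w) 0 0).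
    move=> mY; under eq_Rintegral do rewrite gs.
    elim: s {gs} => [|t s ih].
      by under eq_Rintegral do rewrite big_nil; rewrite Exp_cst big_nil.
    under eq_Rintegral do rewrite big_cons.
    rewrite big_cons -ih -ExpZ; last exact: ic.
    rewrite ExpD//; first by apply: integrableZr'; exact: ic.
    have := @integrable_sum _ T R Q setT measurableT _ s xpredT
      (fun t w => (t.1.1 * cos (t.2 + (t.1.2^T *m Y w) 0 0))%:E).
    move=> h; have {}h := h (fun t _ => integrableZr' t.1.1 (ic _ _ Q _ t.2 t.1.2 mY)).
    by apply: eq_integrable h => // w _ /=; rewrite sumEFin.
  rewrite (Es _ _ nu id mid).
  have -> : (fun n => \int[P]_w g (Z n w)) = (fun n =>
      \sum_(t <- s) t.1.1 * \int[P]_w cos (t.2 + (t.1.2^T *m Z n w) 0 0)).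
    by apply/funext => n; exact: (Es _ _ P _ (mZ n)).
  elim: s {gs Es} => [|t s ih].
    rewrite big_nil; have -> : (fun n => \sum_(t <- ([::] : seq (R * 'cV[R]_q * R))) t.1.1 *
        \int[P]_w cos (t.2 + (t.1.2^T *m Z n w) 0 0)) = (fun=> 0 : R).
      by apply/funext => n; rewrite big_nil.
    exact: cvg_cst.
  rewrite big_cons; have -> : (fun n => \sum_(t <- t :: s) t.1.1 *
      \int[P]_w cos (t.2 + (t.1.2^T *m Z n w) 0 0)) = fun n =>
      t.1.1 * \int[P]_w cos (t.2 + (t.1.2^T *m Z n w) 0 0) +
      \sum_(t <- s) t.1.1 * \int[P]_w cos (t.2 + (t.1.2^T *m Z n w) 0 0).
    by apply/funext => n; rewrite big_cons.
  by apply: cvgD => //; apply: cvgMr; exact: cosZ.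
have rE d (T : measurableType d) (Q : probability T R) (Y : T -> 'cV[R]_q) :
    measurable_fun setT Y -> (\int[Q]_w (f (Y w))%:E)%E = (\int[Q]_w f (Y w))%:E.
  move=> mY; rewrite /Rintegral fineK//; apply: integrable_fin_num => //.
  by apply: (integrable_bounded Q _ (fun w => fM (Y w))); exact: measurableT_comp.
rewrite (rE _ _ nu id mid).
have -> : (fun k => (\int[P]_w (f (Z k w))%:E)%E) = EFin \o (fun k => \int[P]_w f (Z k w)).
  by apply/funext => n; exact: (rE _ _ P _ (mZ n)).
apply: cvg_EFin; first by near=> n.
apply/cvgrPdist_le => e e0.
have e4 : 0 < e / 4 by rewrite divr_gt0.
(* The mass outside the box then costs at most e / 8 under either law; [M + 1] covers [M = 0]. *)
pose e' := e / (16 * (M + 1)).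
have e'0 : 0 < e' by rewrite divr_gt0// mulr_gt0// ltr_wpDl.
have e'M : 2 * M * e' <= e / 8.
  rewrite /e' mulrA ler_pdivrMr; last by rewrite mulr_gt0// ltr_wpDl.
  have : 0 <= M * e by rewrite mulr_ge0// ltW.
  lra.
have [K [K0 ZK nuK]] := tight _ e'0.
have e8 : 0 < e / 8 by rewrite divr_gt0.
have [g [tg gM gf]] := trig_approx cf fM K0 e8.
have mg := measurable_trig_poly tg.
have /cvgrPdist_le/(_ _ e4) gZ := trigZ _ tg.
near=> n.
have h1 : `|\int[P]_w f (Z n w) - \int[P]_w g (Z n w)| <= e / 8 + 2 * M * e'.
  by apply: (law_approx (mZ n) mf mg fM gM (ltW e8) gf); near: n.
have h2 := law_approx mid mf mg fM gM (ltW e8) gf nuK.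
have h3 : `|\int[nu]_x g x - \int[P]_w g (Z n w)| <= e / 4 by near: n.
have -> : \int[nu]_x f x - \int[P]_w f (Z n w) =
  (\int[nu]_x f x - \int[nu]_x g x) + (\int[nu]_x g x - \int[P]_w g (Z n w)) -
  (\int[P]_w f (Z n w) - \int[P]_w g (Z n w)) by ring.
rewrite (le_trans (ler_normB _ _))// (le_trans (lerD (ler_normD _ _) (lexx _)))//.
by move: h2; rewrite /=; lra.
Unshelve. all: by end_near. Qed.

End convergence_in_law.

(** * The duplication matrix and linear forms of vech *)

Section vech_algebra.
Context {R : realType} {p : nat}.
Local Notation pbar := (p * p.+1)./2.
Local Notation D := (@duplication R p).

Lemma quad_form_gram m n (A : 'M[R]_(m, n)) : A *m A^T = 0 -> A = 0.
Proof.
move=> A0; apply/matrixP => i j; rewrite mxE.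
have := congr1 (fun M : 'M[R]_m => M i i) A0; rewrite !mxE.
under eq_bigr do rewrite mxE -expr2.
move=> /eqP; rewrite psumr_eq0 => [/allP/(_ j)|k _]; last exact: sqr_ge0.
by rewrite mem_index_enum sqrf_eq0 => /(_ isT)/eqP.
Qed.

Let vi_inj (k l : 'I_pbar) : vech_index k = vech_index l -> k = l.
Proof. by move=> /enum_val_inj /cast_ord_inj. Qed.

Let vi_le (k : 'I_pbar) : ((vech_index k).1 <= (vech_index k).2)%N.
Proof. by have := enum_valP (cast_ord (esym (card_lower_triangle p)) k). Qed.

Lemma duplication_linv : exists L : 'M[R]_(pbar, p * p), L *m D = 1%:M.
Proof.
exists (\matrix_(k, r) (mxtens_unindex r == vech_index k)%:R).
apply/matrixP => k l; rewrite !mxE.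
rewrite (bigD1 (mxtens_index (vech_index k))) //= !mxE mxtens_indexK eqxx mul1r.
rewrite big1 ?addr0 => [|r rk]; last first.
  rewrite !mxE; case: eqP => [e|_]; last by rewrite mul0r.
  by move: rk; rewrite -e mxtens_unindexK eqxx.
have [->|kl] := eqVneq k l; first by rewrite eqxx.
case: eqP => [/vi_inj/eqP|_] /=; first by rewrite (negPf kl).
(* The transposed pair lies in the lower triangle as well only if it is diagonal. *)
case: eqP => [e|//]; exfalso; move/eqP: kl; apply; apply: vi_inj.
have := vi_le k; rewrite e /= => le1; have le2 := vi_le l.
have e12 : (vech_index l).1 = (vech_index l).2.
  by apply/val_inj/eqP; rewrite eqn_leq le1 le2.
by rewrite e12; case: (vech_index l) e12 => ? ? /= ->.
Qed.

(** [D] has a left inverse, so a row vector killed by the Gram matrix is killed by [D^T] already,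
    hence 0. Invertibility makes [duplication_pinv], which is built from [invmx], a genuine left
    inverse of [D]. *)
Lemma duplication_gram_unit : D^T *m D \in unitmx.
Proof.
rewrite -row_free_unit -kermx_eq0; apply/eqP.
have [L LD] := duplication_linv.
set K := kermx _; have KD : K *m D^T = 0.
  apply: quad_form_gram; rewrite trmx_mul trmxK mulmxA -(mulmxA K).
  by rewrite mulmx_ker mul0mx.
have := congr1 (mulmx^~ L^T) KD; rewrite mul0mx -mulmxA -trmx_mul LD trmx1 mulmx1.
exact.
Qed.

Lemma duplication_pinv_vec (A : 'M[R]_p) : A^T = A ->
  duplication_pinv p *m vec A = vech A.
Proof.
move=> sA; rewrite (vec_duplication sA) /duplication_pinv -!mulmxA [_ *m (D *m vech A)]mulmxA mulKmx//.
exact: duplication_gram_unit.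
Qed.

(* The matrix of the functional [A |-> u^T vech A] on symmetric matrices. *)
Definition unvech_form (u : 'cV[R]_pbar) : 'M[R]_p :=
  \matrix_(i, j) ((duplication_pinv p)^T *m u) (mxtens_index (j, i)) 0.

(** The rows of the duplication matrix at (i, j) and (j, i) coincide. *)
Lemma unvech_form_sym u i j : unvech_form u i j = unvech_form u j i.
Proof.
rewrite [LHS]mxE [RHS]mxE /duplication_pinv trmx_mul trmxK -mulmxA [LHS]mxE [RHS]mxE.
apply: eq_bigr => k _; congr (_ * _); rewrite !mxE !mxtens_indexK /= orbC.
by congr (_ || _)%:R; case: (vech_index k) => a b /=; rewrite !xpair_eqE andbC.
Qed.

Lemma sum_mxtens (f : 'I_(p * p) -> R) :
  \sum_r f r = \sum_i \sum_j f (mxtens_index (j, i)).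
Proof.
rewrite pair_bigA (reindex (fun ij : 'I_p * 'I_p => mxtens_index (ij.2, ij.1))) //.
exists (fun r => ((mxtens_unindex r).2, (mxtens_unindex r).1)) => [[i j]|r] _.
  by rewrite mxtens_indexK.
by rewrite -[RHS]mxtens_unindexK; case: (mxtens_unindex r).
Qed.

Lemma unvech_formE u (A : 'M[R]_p) : A^T = A ->
  (u^T *m vech A) 0 0 = \sum_i \sum_j unvech_form u i j * A i j.
Proof.
move=> sA; rewrite -(duplication_pinv_vec sA) mulmxA mxE.
rewrite sum_mxtens; apply: eq_bigr => i _; apply: eq_bigr => j _.
rewrite [vec _ _ _]mxE mxtens_indexK [unvech_form _ _ _]mxE; congr (_ * _).
by rewrite -[in RHS](trmxK u) -trmx_mul [RHS]mxE.
Qed.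

(** This matches the covariance of the theorem with [centred_quad_var] at [Q = unvech_form u]: by
    symmetry of [Q] the two remaining pairings have the same sum, whence the factor 2. *)
Lemma unvech_form_var u (S : 'M[R]_p) :
  (u^T *m (2 *: (duplication_pinv p *m tensmx S S *m (duplication_pinv p)^T)) *m u) 0 0 =
  \sum_i \sum_j \sum_k \sum_l unvech_form u i j * unvech_form u k l *
    (S i k * S j l + S i l * S j k).
Proof.
have [L LE] : exists L, L = @duplication_pinv R p by exists (duplication_pinv p).
rewrite -LE -scalemxAr -scalemxAl mxE -!mulmxA (mulmxA u^T L).
set v := L^T *m u.
have -> : u^T *m L = v^T by rewrite /v trmx_mul trmxK.
have e1 : (v^T *m (tensmx S S *m v)) 0 0 = \sum_i \sum_j \sum_k \sum_l
   unvech_form u i j * unvech_form u k l * (S i k * S j l).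
  rewrite mxE sum_mxtens; apply: eq_bigr => i _; apply: eq_bigr => j _.
  rewrite [(tensmx S S *m v) _ _]mxE mulr_sumr sum_mxtens; apply: eq_bigr => k _; apply: eq_bigr => l _.
  rewrite tensmxE [v^T _ _]mxE [unvech_form u i j]mxE [unvech_form u k l]mxE -LE -/v; ring.
have e2 : \sum_i \sum_j \sum_k \sum_l
   unvech_form u i j * unvech_form u k l * (S i l * S j k) =
   \sum_i \sum_j \sum_k \sum_l unvech_form u i j * unvech_form u k l * (S i k * S j l).
  apply: eq_bigr => i _; apply: eq_bigr => j _; rewrite exchange_big /=.
  by apply: eq_bigr => k _; apply: eq_bigr => l _; rewrite [unvech_form u l k]unvech_form_sym.
have -> : \sum_i \sum_j \sum_k \sum_l unvech_form u i j * unvech_form u k l *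
    (S i k * S j l + S i l * S j k) = \sum_i \sum_j \sum_k \sum_l
   unvech_form u i j * unvech_form u k l * (S i k * S j l) +
   \sum_i \sum_j \sum_k \sum_l unvech_form u i j * unvech_form u k l * (S i l * S j k).
  rewrite -big_split; apply: eq_bigr => i _; rewrite -big_split; apply: eq_bigr => j _.
  rewrite -big_split; apply: eq_bigr => k _; rewrite -big_split; apply: eq_bigr => l _ /=.
  by rewrite mulrDr.
by rewrite e2 -e1; ring.
Qed.

End vech_algebra.

(** * Cosine transform and existence of Gaussian laws *)

Section gaussian_existence.
Context dsp (Omega : measurableType dsp) (R : realType) (P : probability Omega R).
Variables (F : R -> set (set Omega)) (B : R -> Omega -> R).
Hypothesis filtF : is_filtration F.
Hypothesis brB : brownian P F B.

Let FE t : 0 <= t -> @measurable _ (g_sigma_algebraType (F t)) = F t.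
Proof. by move=> t0; have [sF _] := filtF.1 t t0; exact: (sigma_algebra_id sF). Qed.

Lemma adapted_funP t (Y : Omega -> R) : 0 <= t ->
  (forall A, measurable A -> F t (Y @^-1` A)) <->
  measurable_fun [set: g_sigma_algebraType (F t)] (Y : g_sigma_algebraType (F t) -> R).
Proof.
move=> t0; split => [aY _ A mA|mY A mA].
  by rewrite setTI (FE t0); exact: aY.
by have := mY measurableT _ mA; rewrite setTI (FE t0).
Qed.

Lemma brownian_incr_adapted s t t' c : 0 <= s -> s <= t' -> 0 <= t -> t <= t' ->
  measurable_fun [set: g_sigma_algebraType (F t')]
    (fun w : g_sigma_algebraType (F t') => c * (B t w - B s w)).
Proof.
move=> s0 st' t0 tt'; have t'0 := le_trans s0 st'.
have m x : 0 <= x -> x <= t' -> measurable_fun [set: g_sigma_algebraType (F t')]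
    (B x : g_sigma_algebraType (F t') -> R).
  move=> x0 xt'; apply/adapted_funP => // A mA.
  by apply: (filtF.2 _ _ x0 xt'); exact: (brownian_adapted brB).
by apply: measurable_funM => //; apply: measurable_funB; exact: m.
Qed.

(** Increments are added one at a time: the sum of the first k is measurable for the filtration at
    [t k], hence independent of the next increment. *)
Lemma gaussian_incr_sum (t c : nat -> R) (n : nat) : 0 <= t 0%N ->
  (forall k, t k <= t k.+1) ->
  gaussian P (fun w => \sum_(k < n) c k * (B (t k.+1) w - B (t k) w))
    (\sum_(k < n) c k ^+ 2 * (t k.+1 - t k)) /\
  forall k, indep_rv P (fun w => \sum_(i < k) c i * (B (t i.+1) w - B (t i) w))
     (fun w => c k * (B (t k.+1) w - B (t k) w)).
Proof.
move=> t00 tS.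
have tmono i j : (i <= j)%N -> t i <= t j.
  by move=> /(homo_leq (@lexx _ _) (fun y x z => @le_trans _ _ y x z) tS).
have t_ge0 i : 0 <= t i by rewrite (le_trans t00)// tmono.
have ind k : indep_rv P (fun w => \sum_(i < k) c i * (B (t i.+1) w - B (t i) w))
     (fun w => c k * (B (t k.+1) w - B (t k) w)).
  move=> A C mA mC.
  have mc : measurable_fun setT (fun x : R => c k * x) by apply: measurable_funM.
  have mC' : measurable ((fun x : R => c k * x) @^-1` C).
    by rewrite -[X in measurable X]setTI; exact: mc.
  apply: (brownian_indep brB _ _ _ mC') => //.
  move: A mA; apply/adapted_funP => //.
  apply: measurable_sum => i.
  by apply: brownian_incr_adapted => //; apply: tmono => //; exact: ltnW.
split; last exact: ind.
elim: n => [|n ih].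
  have := brownian_gaussian brB 0 (lexx 0) (lexx (0 : R)).
  rewrite expr0n mul0r big_ord0.
  by under eq_fun do rewrite mul0r; under [X in _ -> gaussian _ X _]eq_fun do rewrite big_ord0.
rewrite big_ord_recr /=; under eq_fun do rewrite big_ord_recr /=.
have h1 : 0 <= \sum_(i < n) c i ^+ 2 * (t i.+1 - t i).
  by apply: sumr_ge0 => i _; rewrite mulr_ge0 ?sqr_ge0// subr_ge0.
have h2 : 0 <= c n ^+ 2 * (t n.+1 - t n) by rewrite mulr_ge0 ?sqr_ge0// subr_ge0.
have h3 := brownian_gaussian brB (c n) (t_ge0 n) (tS n).
exact: (gaussianD filtF brB h1 h2 ih h3 (ind n)).
Qed.

(** The central limit bound is applied to the normal law itself. For every n, it is the law of
    n^(-1/2) times a sum of n independent variables of the same law, so the difference of the two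
    sides is at most a constant over sqrt n, hence 0. *)
Lemma gaussian_cos d2 (O2 : measurableType d2) (P2 : probability O2 R) (Y : O2 -> R) v (t : R) :
  0 <= v -> gaussian P2 Y v ->
  \int[P2]_w cos (t + Y w) = cos t * expR (- (v / 2)).
Proof.
move=> v0 gY.
pose s := Num.sqrt v.
have gN : gaussian P (fun w => s * (B 1 w - B 0 w)) v.
  have e : s ^+ 2 * (1 - 0) = v by rewrite subr0 mulr1 sqr_sqrtr.
  by have := brownian_gaussian brB s (lexx 0) ler01; rewrite e.
have -> : \int[P2]_w cos (t + Y w) = \int[P]_w cos (t + s * (B 1 w - B 0 w)).
  apply: (same_law_Exp (f := fun x => cos (t + x))) => //; [exact: gY.1|exact: gN.1|exact: gaussian_same_law gY gN _|].
  apply: (@measurableT_comp _ _ _ _ _ _ (@cos R)).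
    exact: continuous_measurable_fun (@continuous_cos R).
  exact: measurable_funD.
set x := \int[P]_w _; set y := cos t * _.
have key n : (0 < n)%N -> `|x - y| <= (1 + 2 * (3 * v ^+ 2) + v ^+ 2) * (Num.sqrt n%:R)^-1.
  move=> n0; have n1 : n%:R != 0 :> R by rewrite pnatr_eq0 -lt0n.
  have sn : Num.sqrt n%:R != 0 :> R by rewrite sqrtr_eq0 -ltNge ltr0n.
  (* Increments over cells of length 1 / n, scaled by sqrt n s, have variance [v]; divided by sqrt
     n, their sum telescopes to s (B 1 - B 0). *)
  pose T k := k%:R / n%:R : R; pose c (k : nat) : R := Num.sqrt n%:R * s.
  have T0 : 0 <= T 0%N by rewrite /T mul0r.
  have TS k : T k <= T k.+1 by rewrite /T ler_wpM2r ?invr_ge0// ler_nat.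
  have Tk k : 0 <= T k by rewrite divr_ge0.
  have [_ ind] := gaussian_incr_sum c n T0 TS.
  have g k : gaussian P (fun w => c k * (B (T k.+1) w - B (T k) w)) v.
    have := brownian_gaussian brB (c k) (Tk k) (TS k).
    have -> : c k ^+ 2 * (T k.+1 - T k) = v; last by [].
    rewrite /c exprMn !sqr_sqrtr// /T -mulrBl -natr1 [_ + 1 - _]addrAC subrr add0r mul1r.
    by rewrite mulrAC divff ?mul1r.
  have := @cos_clt_bound _ _ _ P n (fun k w => c k * (B (T k.+1) w - B (T k) w)) v (3 * v ^+ 2) n0.
  move=> /(_ _ _ _ _ _ t) h; rewrite /x /y.
  have -> : \int[P]_w cos (t + s * (B 1 w - B 0 w)) = \int[P]_w
     cos (t + (Num.sqrt n%:R)^-1 * \sum_(k < n) c k * (B (T k.+1) w - B (T k) w)).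
    apply: eq_Rintegral => w _; congr (cos (t + _)).
    rewrite -mulr_sumr -(big_mkord xpredT (fun k => B (T k.+1) w - B (T k) w)).
    rewrite telescope_sumr// /T divff// mul0r.
    by rewrite /c -mulrA mulKf.
  apply: h => k _.
  - exact: (gaussian_allmom brB v0 (g k)).
  - exact: (gaussian_mean brB v0 (g k)).
  - exact: (gaussian_moment2 brB v0 (g k)).
  - by rewrite (gaussian_moment4 filtF brB v0 (g k)).
  - exact: ind.
apply/eqP; rewrite -subr_eq0 -normr_eq0 eq_le normr_ge0 andbT leNgt; apply/negP => xy0.
pose C := 1 + 2 * (3 * v ^+ 2) + v ^+ 2.
have C0 : 0 < C by rewrite /C; have := sqr_ge0 v; lra.
pose n := (Num.truncn ((C / `|x - y|) ^+ 2)).+1.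
have nC : (C / `|x - y|) ^+ 2 < n%:R by exact: truncnS_gt.
have := key n isT; rewrite -/C leNgt => /negP; apply.
rewrite ltr_pdivrMr ?sqrtr_gt0// mulrC -ltr_pdivrMr//.
rewrite -ltr_sqr ?nnegrE ?sqrtr_ge0 ?divr_ge0 ?ltW// sqr_sqrtr//.
Qed.

(** Successive unit increments of [B] form a standard Gaussian vector, which [A] maps to covariance
    A A^T. This provides the limit law, whose existence is part of convergence to a normal law. *)
Lemma gaussian_vector_exists m q (A : 'M[R]_(q, m)) :
  exists nu : probability 'cV[R]_q R, is_normal_law nu 0 (A *m A^T).
Proof.
pose t (k : nat) : R := k%:R.
have t0 : 0 <= t 0%N by [].
have tS k : t k <= t k.+1 by rewrite /t ler_nat.
pose Y w : 'cV[R]_q := A *m \col_(k < m) (B (t k.+1) w - B (t k) w).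
have mY : measurable_fun setT Y.
  apply: measurable_mulmx; apply: measurable_fun_mx => i j.
  under eq_fun do rewrite mxE.
  by apply: measurable_funB; apply: (brownian_measurable brB); rewrite /t.
pose Y' : {mfun Omega >-> 'cV[R]_q} := HB.pack Y (isMeasurableFun.Build _ _ _ _ Y mY).
exists (distribution P Y') => u C mC.
pose c (k : nat) : R := if insub k is Some i then (u^T *m A) 0 i else 0.
have [[_ g] _] := gaussian_incr_sum c m t0 tS.
rewrite mulmx0 mxE /distribution /pushforward /=.
have cE (k : 'I_m) : c k = (u^T *m A) 0 k.
  by rewrite /c insubT //= => kk; congr (_ 0 _); exact/val_inj.
have -> : (u^T *m (A *m A^T) *m u) 0 0 = \sum_(k < m) c k ^+ 2 * (t k.+1 - t k).
  rewrite mulmxA -mulmxA -{2}[u]trmxK -trmx_mul mxE; apply: eq_bigr => k _.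
  by rewrite cE /t -natr1 [_ + 1 - _]addrAC subrr add0r mulr1 expr2 [(_^T) _ _]mxE.
rewrite -g//; congr (P _).
have e w : (u^T *m Y w) 0 0 = \sum_(k < m) c k * (B (t k.+1) w - B (t k) w).
  rewrite /Y mulmxA mxE; apply: eq_bigr => k _.
  by rewrite cE [(\col_k _) _ _]mxE.
by apply/seteqP; split => w /=; rewrite e.
Qed.

End gaussian_existence.

(** * Negligibility of the drift *)

(** Summation by parts: [g] enters only through its partial sums. *)
Lemma abel_bound (R : realType) (n : nat) (gam g : nat -> R) (B C L : R) :
  0 <= B -> 0 <= C -> 0 <= L ->
  (forall i, (i < n)%N -> `|gam i| <= C) ->
  (forall i, (i.+1 < n)%N -> `|gam i.+1 - gam i| <= L) ->
  (forall k, (k <= n)%N -> `|\sum_(i < k) g i| <= B) ->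
  `|\sum_(i < n) gam i * g i| <= B * (C + n%:R * L).
Proof.
move=> B0 C0 L0 gC gL gB.
case: n => [|n] in gC gL gB *.
  by rewrite big_ord0 normr0 mulr_ge0// addr_ge0// mulr_ge0.
pose S k := \sum_(i < k) g i.
have abel m : \sum_(i < m.+1) gam i * g i =
    gam m * S m.+1 - \sum_(i < m) (gam i.+1 - gam i) * S i.+1.
  elim: m => [|m ih]; first by rewrite /S !big_ord_recl !big_ord0; ring.
  rewrite big_ord_recr ih /= [in RHS]big_ord_recr /= /S [in RHS]big_ord_recr /=; ring.
rewrite abel (le_trans (ler_normB _ _))// mulrDr lerD//.
  by rewrite normrM mulrC ler_pM// ?gB// gC.
rewrite (le_trans (ler_norm_sum _ _ _))//.
apply: (@le_trans _ _ (\sum_(i < n) B * L)).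
  apply: ler_sum => i _; rewrite normrM mulrC.
  have Si : `|S i.+1| <= B by apply: gB; rewrite ltnW// ltnS.
  have gi : `|gam i.+1 - gam i| <= L by apply: gL; rewrite ltnS.
  by rewrite ler_pM.
have -> : \sum_(i < n) B * L = B * (n%:R * L).
  by rewrite sumr_const card_ord -[LHS]mulr_natl mulrCA.
by rewrite ler_wpM2l// ler_wpM2r// ler_nat.
Qed.

Section drift.
Context (R : realType).
Variables (al : R -> R) (C : R).
Hypothesis mal : measurable_fun setT al.
Hypothesis alC : forall t, `|al t| <= C.
Local Notation mu := (@lebesgue_measure R).

Definition itv_int (f : R -> R) (s t : R) := \int[mu]_(u in `]s, t]) f u.
Local Notation J := (itv_int al).

Lemma C_ge0 : 0 <= C. Proof. by rewrite (le_trans _ (alC 0)). Qed.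

Lemma itv_integrable (f : R -> R) (M : R) (s t : R) : measurable_fun setT f ->
  (forall u, `|f u| <= M) -> mu.-integrable `]s, t] (EFin \o f).
Proof.
move=> mf fM; apply: measurable_bounded_integrable => //.
- by rewrite /= lebesgue_measure_itv; case: ifPn => // _; rewrite -EFinD ltry.
- exact: measurable_funTS.
- exists M; split; first exact: num_real.
  by move=> x Mx y _; rewrite /= (le_trans (fM _))// ltW.
Qed.

Lemma itv_int_add (f : R -> R) (M r s t : R) : measurable_fun setT f ->
  (forall u, `|f u| <= M) -> r <= s -> s <= t ->
  itv_int f r t = itv_int f r s + itv_int f s t.
Proof.
move=> mf fM rs st.
have := @Rintegral_itvB R f (BRight r) (BRight t) s (itv_integrable r t mf fM).
rewrite !bnd_simp => /(_ rs st) h.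
by rewrite /itv_int -h addrC subrK.
Qed.

Lemma itv_int_le (f g : R -> R) (M M' s t : R) :
  measurable_fun setT f -> measurable_fun setT g ->
  (forall u, `|f u| <= M) -> (forall u, `|g u| <= M') ->
  (forall u, s < u -> u <= t -> f u <= g u) -> itv_int f s t <= itv_int g s t.
Proof.
move=> mf mg fM gM fg.
have i1 := itv_integrable s t mf fM; have i2 := itv_integrable s t mg gM.
apply: le_Rintegral => //.
by move=> u /=; rewrite in_itv /= => /andP[]; exact: fg.
Qed.

Lemma itv_int_cst (c s t : R) : s <= t -> itv_int (fun=> c) s t = c * (t - s).
Proof.
move=> st; rewrite /itv_int Rintegral_cst//; congr (_ * _).
rewrite /= lebesgue_measure_itv /= lte_fin.
case: ifPn => [_|]; first by [].
by rewrite -leNgt => ts; apply/esym/eqP; rewrite subr_eq0 eq_le ts st.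
Qed.

Lemma itv_int_bound (f : R -> R) (M s t : R) : measurable_fun setT f ->
  (forall u, `|f u| <= M) -> s <= t -> `|itv_int f s t| <= M * (t - s).
Proof.
move=> mf fM st; have i := itv_integrable s t mf fM.
rewrite (le_trans (le_normr_Rintegral _ i))// -(itv_int_cst _ st).
have mn : measurable_fun setT (fun u => `|f u|) by exact: measurableT_comp.
apply: (itv_int_le (M := M) (M' := `|M|) mn) => //.
by move=> u; rewrite normr_id.
Qed.

Lemma itv_intB (f g : R -> R) (M M' s t : R) :
  measurable_fun setT f -> measurable_fun setT g ->
  (forall u, `|f u| <= M) -> (forall u, `|g u| <= M') ->
  itv_int f s t - itv_int g s t = itv_int (fun u => f u - g u) s t.
Proof.
move=> mf mg fM gM; rewrite /itv_int RintegralB//.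
  exact: (itv_integrable _ _ mf fM).
exact: (itv_integrable _ _ mg gM).
Qed.

(* Lipschitz regularisation of [al], to which summation by parts applies. *)
Definition left_avg (m : nat) (t : R) := m.+1%:R * J (t - m.+1%:R^-1) t.

Lemma left_avg_bound m t : `|left_avg m t| <= C.
Proof.
rewrite /left_avg normrM gtr0_norm// mulrC -ler_pdivlMr//.
have h : t - m.+1%:R^-1 <= t by rewrite lerBlDr lerDl.
by rewrite (le_trans (itv_int_bound mal alC h))// opprB addrCA subrr addr0.
Qed.

(** The difference of the integrals over two windows of equal length is a difference of integrals
    over two intervals of length [t - s]. *)
Lemma left_avg_lip m s t : s <= t ->
  `|left_avg m t - left_avg m s| <= 2 * m.+1%:R * C * (t - s).
Proof.
move=> st; set d := m.+1%:R^-1 : R.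
have d0 : 0 <= d by rewrite /d.
have e : J (t - d) t - J (s - d) s = J s t - J (s - d) (t - d).
  have a1 : J (s - d) t = J (s - d) s + J s t.
    by apply: (itv_int_add mal alC) => //; rewrite lerBlDr lerDl.
  have a2 : J (s - d) t = J (s - d) (t - d) + J (t - d) t.
    by apply: (itv_int_add mal alC) => //; [rewrite lerD2r|rewrite lerBlDr lerDl].
  by move: a1; rewrite a2 => h; lra.
rewrite /left_avg -mulrBr -/d e normrM gtr0_norm// -!mulrA mulrCA ler_wpM2l//.
rewrite mulr_natl mulr2n (le_trans (ler_normB _ _))// lerD// ?itv_int_bound//.
have := itv_int_bound mal alC (_ : s - d <= t - d).
by rewrite lerD2r => /(_ st); rewrite opprB addrA subrK.
Qed.

Lemma left_avg_measurable m : measurable_fun setT (left_avg m).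
Proof.
apply: continuous_measurable_fun => t; apply/cvgrPdist_lt => e e0.
pose L := 2 * m.+1%:R * C + 1.
have L0 : 0 < L by rewrite ltr_wpDl// !mulr_ge0// C_ge0.
have lip s u : `|left_avg m s - left_avg m u| <= L * `|s - u|.
  have h x y : x <= y -> `|left_avg m y - left_avg m x| <= L * `|y - x|.
    move=> xy; rewrite (le_trans (left_avg_lip m xy))// ger0_norm ?subr_ge0//.
    by rewrite ler_wpM2r ?subr_ge0// /L lerDl.
  have [us|/ltW su] := leP u s; first exact: h.
  by rewrite distrC (distrC s); exact: h.
near=> s; rewrite (le_lt_trans (lip _ _))// mulrC -ltr_pdivlMr//.
near: s; apply: cvgr_dist_lt; last by rewrite divr_gt0.
exact: cvg_id.
Unshelve. all: by end_near. Qed.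

Lemma left_avg_cvg t : (al s @[s --> t^'-] --> al t) ->
  left_avg m t @[m --> \oo] --> al t.
Proof.
move=> /cvgrPdist_le lc; apply/cvgrPdist_le => e e0.
have [r /= r0 hr] := lc e e0.
near=> m.
have : m.+1%:R^-1 < r by near: m; exact: near_infty_natSinv_lt (PosNum r0).
set d := m.+1%:R^-1 : R => dr.
have d0 : 0 < d by rewrite /d.
have md : m.+1%:R * d = 1 by rewrite /d divff// pnatr_eq0.
have td : t - d <= t by rewrite lerBlDr lerDl ltW.
have mc : measurable_fun setT (fun _ : R => al t) by [].
have ac : forall u : R, `|al t| <= C by move=> _; exact: alC.
have -> : al t = m.+1%:R * itv_int (fun=> al t) (t - d) t.
  by rewrite itv_int_cst// opprB addrCA subrr addr0 mulrCA md mulr1.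
rewrite /left_avg -mulrBr -/d (itv_intB _ _ mc mal ac alC) normrM gtr0_norm//.
rewrite mulrC -ler_pdivlMr// -/d.
(* [f] agrees with the integrand on the window, also at its right end, where both vanish, and is
   bounded by [e] on the whole line, as [itv_int_bound] requires. *)
pose f (u : R) := if (t - d < u) && (u < t) then al t - al u else 0.
have -> : itv_int (fun u => al t - al u) (t - d) t = itv_int f (t - d) t.
  apply: eq_Rintegral => u; rewrite inE /= in_itv /= /f => /andP[-> /=].
  by rewrite le_eqVlt => /predU1P[->|->//]; rewrite ltxx subrr.
have mf : measurable_fun setT f.
  apply: measurable_fun_ifT => //; last exact: measurable_funB.
  by apply: measurable_and; apply: measurable_fun_ltr.
have fe u : `|f u| <= e.
  rewrite /f; case: ifPn => [/andP[u1 u2]|_]; last by rewrite normr0 ltW.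
  apply: hr => //=; rewrite gtr0_norm ?subr_gt0//.
  by apply: lt_trans dr; rewrite ltrBlDr addrC -ltrBlDr.
by rewrite (le_trans (itv_int_bound mf fe td))// opprB addrCA subrr addr0.
Unshelve. all: by end_near. Qed.

Variable T : R.
Hypothesis T_gt0 : 0 < T.
Hypothesis al_left : forall t, 0 < t -> t <= T -> al s @[s --> t^'-] --> al t.

Let mdiff m : measurable_fun setT (fun t => `|al t - left_avg m t|).
Proof.
apply: measurableT_comp => //; apply: measurable_funB => //.
exact: left_avg_measurable.
Qed.

Let bdiff m t : `| `|al t - left_avg m t| | <= 2 * C.
Proof.
rewrite normr_id (le_trans (ler_normB _ _))// mulr_natl mulr2n lerD//.
exact: left_avg_bound.
Qed.

Lemma left_avg_L1 :
  itv_int (fun t => `|al t - left_avg m t|) 0 T @[m --> \oo] --> (0 : R).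
Proof.
have mE m : measurable_fun setT (fun t : R => (`|al t - left_avg m t|)%:E).
  by apply: measurableT_comp; [exact: EFin_measurable|exact: mdiff].
have := @dominated_cvg _ _ R mu `]0, T]%classic _
   (fun m t => (`|al t - left_avg m t|)%:E) (fun=> 0%:E) (fun=> (2 * C)%:E).
rewrite /itv_int /Rintegral => h.
have {}h : (\int[mu]_(x in `]0%R, T]) (`|al x - left_avg m x|)%:E)%E @[m --> \oo] --> 0%E.
  rewrite -(integral0 mu `]0%R, T]%classic); apply: h => //.
  - by move=> m; exact: measurable_funTS (mE m).
  - move=> t /=; rewrite in_itv /= => /andP[t0 tT].
    apply: cvg_EFin; first by near=> m.
    have := left_avg_cvg (al_left t0 tT).
    move=> /cvgrPdist_le h; apply/cvgrPdist_le => e /h.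
    by apply: filterS => m; rewrite sub0r normrN normr_id.
  - apply/integrableP; split => //; rewrite integral_cst//= lebesgue_measure_itv /=.
    by case: ifPn => _; rewrite ?mule0 ?ltry// -EFinD -EFinM ltry.
  - by move=> m t _; rewrite /= lee_fin.
exact: (fine_cvg h).
Unshelve. all: by end_near. Qed.

(** Cauchy-Schwarz gives such a bound without the small factor [e]. To gain it, the cell averages of
    [al] are split into samples of the Lipschitz function [left_avg m], to which summation by parts
    applies, and a remainder. The remainder is small in L^1 and bounded, hence small in L^2, and
    Young's inequality applies to it. The index [m] is fixed before [n] because the Lipschitz
    constant grows with [m]. *)
Lemma drift_negligible (B e : R) : 0 <= B -> 0 < e ->
  \forall n \near \oo, forall g : nat -> R,
    (forall k, (k <= n)%N -> `|\sum_(i < k) g i| <= B) ->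
    `|\sum_(i < n) J (i%:R * (T / n%:R)) (i.+1%:R * (T / n%:R)) * g i| <=
      T / n%:R * Num.sqrt n%:R * e * (1 + \sum_(i < n) g i ^+ 2).
Proof.
move=> B0 e0; have C0 := C_ge0.
(* With this value, 2 C times 2 e1 is at most T e^2 / 2, as the term [small2] demands. *)
pose e1 := T * e ^+ 2 / (8 * (C + 1)).
have C1 : 0 < 8 * (C + 1) by rewrite mulr_gt0// ltr_wpDl.
have e10 : 0 < e1 by rewrite divr_gt0// mulr_gt0// exprn_gt0.
have /cvgrPdist_le/(_ _ e10) [m _ /(_ m (leqnn m)) hm] := left_avg_L1.
have {hm} : itv_int (fun t => `|al t - left_avg m t|) 0 T <= e1.
  by move: hm; rewrite /= sub0r normrN; apply: le_trans; exact: ler_norm.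
set eta := itv_int _ _ _ => eta_le.
pose L := 2 * m.+1%:R * C.
have L0 : 0 <= L by rewrite !mulr_ge0.
near=> n => g gB.
have n0 : (0 < n)%N by near: n; exact: nbhs_infty_gt.
have nn0 : 0 < n%:R :> R by rewrite ltr0n.
(* [n1] absorbs the constant left by the summation by parts, and [n2] the oscillation of
   [left_avg m] within the cells. *)
have n1 : (B * (C + L * T) * 2 / e) ^+ 2 <= n%:R :> R by near: n; exact: nbhs_infty_ger.
have n2 : L * T * T / e1 <= n%:R :> R by near: n; exact: nbhs_infty_ger.
set h := T / n%:R; have h0 : 0 < h by rewrite divr_gt0.
have nh : n%:R * h = T by rewrite mulrC divfK// gt_eqF.
set sn := Num.sqrt n%:R; have sn0 : 0 < sn by rewrite sqrtr_gt0.
have snn : sn ^+ 2 = n%:R by rewrite sqr_sqrtr// ltW.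
pose t (i : nat) := i%:R * h.
have tS i : t i.+1 - t i = h by rewrite /t -natr1; ring.
have tle i : t i <= t i.+1 by rewrite -subr_ge0 tS ltW.
pose gam i := left_avg m (t i).
pose be i := J (t i) (t i.+1) / h.
have beE i : J (t i) (t i.+1) = h * be i by rewrite mulrC divfK// gt_eqF.
have beC i : `|be i| <= C.
  rewrite normrM normfV (gtr0_norm h0) ler_pdivrMr//.
  by rewrite (le_trans (itv_int_bound mal alC (tle i)))// tS.
have gamC i : `|gam i| <= C by exact: left_avg_bound.
have mla := left_avg_measurable m; have bla := left_avg_bound m.
have diff i : h * `|be i - gam i| <=
    itv_int (fun u => `|al u - left_avg m u|) (t i) (t i.+1) + L * h * h.
  rewrite -[X in X * _](gtr0_norm h0) -normrM mulrBr -beE.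
  have mc : measurable_fun setT (fun _ : R => gam i) by [].
  have -> : h * gam i = itv_int (fun=> gam i) (t i) (t i.+1).
    by rewrite itv_int_cst// tS mulrC.
  have -> : J (t i) (t i.+1) - itv_int (fun=> gam i) (t i) (t i.+1) =
      itv_int (fun u => al u - left_avg m u) (t i) (t i.+1) +
      (itv_int (left_avg m) (t i) (t i.+1) - itv_int (fun=> gam i) (t i) (t i.+1)).
    have := itv_intB (t i) (t i.+1) mal mla alC bla.
    set i1 := itv_int _ _ _; set i2 := itv_int (left_avg m) _ _.
    set i3 := itv_int _ _ _; set i4 := itv_int _ _ _ => <-.
    by rewrite addrA subrK.
  rewrite (le_trans (ler_normD _ _))// lerD//.
    apply: le_normr_Rintegral => //.
    apply: (itv_integrable (M := 2 * C)); first exact: measurable_funB.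
    by move=> u; have := bdiff m u; rewrite normr_id.
  rewrite (itv_intB _ _ mla mc bla (fun=> gamC i)).
  pose f (u : R) := if (t i < u) && (u <= t i.+1) then left_avg m u - gam i else 0.
  have -> : itv_int (fun u => left_avg m u - gam i) (t i) (t i.+1) = itv_int f (t i) (t i.+1).
    by apply: eq_Rintegral => u; rewrite inE /= in_itv /= /f => ->.
  have mf : measurable_fun setT f.
    apply: measurable_fun_ifT => //; last exact: measurable_funB.
    apply: measurable_and; first exact: measurable_fun_ltr.
    exact: measurable_fun_ler.
  have fe u : `|f u| <= L * h.
    rewrite /f; case: ifPn => [/andP[u1 u2]|_]; last by rewrite normr0 mulr_ge0// ltW.
    rewrite (le_trans (left_avg_lip m (ltW u1)))// ler_wpM2l//.
    by rewrite -(tS i) lerD2r.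
  by rewrite (le_trans (itv_int_bound mf fe (tle i)))// tS.
have sumdiff : h * \sum_(i < n) `|be i - gam i| <= eta + L * T * h.
  rewrite mulr_sumr (le_trans (ler_sum _ (fun i _ => diff (nat_of_ord i))))//.
  rewrite big_split /= sumr_const card_ord -mulr_natl.
  have -> : n%:R * (L * h * h) = L * T * h by rewrite -nh; ring.
  rewrite lerD2r.
  have add k : (k <= n)%N -> \sum_(i < k) itv_int (fun u => `|al u - left_avg m u|) (t i) (t i.+1) =
      itv_int (fun u => `|al u - left_avg m u|) 0 (t k).
    elim: k => [_|k ih kn].
      by rewrite big_ord0 /t mul0r /itv_int set_itvoc0 Rintegral_set0.
    rewrite big_ord_recr /= ih 1?ltnW//.
    rewrite -(itv_int_add (mdiff m) (bdiff m))//.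
    by rewrite /t mulr_ge0// ltW.
  by rewrite add// /t nh.
have sumsq : \sum_(i < n) (be i - gam i) ^+ 2 <= 2 * C * (\sum_(i < n) `|be i - gam i|).
  rewrite mulr_sumr; apply: ler_sum => i _.
  rewrite -normr_id -[X in X <= _]ger0_norm ?sqr_ge0// normrX normr_id expr2 ler_wpM2r//.
  by rewrite (le_trans (ler_normB _ _))// mulr_natl mulr2n lerD.
have absum : `|\sum_(i < n) gam i * g i| <= B * (C + n%:R * (L * h)).
  apply: abel_bound => //; first by rewrite mulr_ge0// ltW.
  by move=> i _; rewrite (le_trans (left_avg_lip m (tle i)))// tS.
(* The weight sqrt n e makes both terms of the required order sqrt n e, since the squared remainders
   sum to a small multiple of n. *)
have young : `|\sum_(i < n) (be i - gam i) * g i| <=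
    (\sum_(i < n) (be i - gam i) ^+ 2) / (sn * e) + sn * e / 4 * \sum_(i < n) g i ^+ 2.
  rewrite (le_trans (ler_norm_sum _ _ _))// mulr_suml mulr_sumr -big_split /=.
  apply: ler_sum => i _; rewrite normrM.
  have se : 0 < sn * e by rewrite mulr_gt0.
  rewrite -(ler_pM2r se) mulrDl divfK ?gt_eqF//.
  rewrite -[(be i - gam i) ^+ 2]ger0_norm ?sqr_ge0// -[g i ^+ 2]ger0_norm ?sqr_ge0// !normrX.
  set x := `|be i - gam i|; set y := `|g i|; set z := sn * e.
  have -> : z / 4 * y ^+ 2 * z = (z * y / 2) ^+ 2 by field.
  by have := sqr_ge0 (x - z * y / 2); rewrite -subr_ge0; nra.
have -> : \sum_(i < n) J (i%:R * h) (i.+1%:R * h) * g i =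
   h * (\sum_(i < n) gam i * g i + \sum_(i < n) (be i - gam i) * g i).
  rewrite -big_split mulr_sumr; apply: eq_bigr => i _ /=.
  by rewrite -/(t i) -/(t i.+1) beE; ring.
set G := \sum_(i < n) g i ^+ 2.
have -> : h * sn * e * (1 + G) = h * (sn * e * (1 + G)) by rewrite !mulrA.
rewrite normrM gtr0_norm// ler_wpM2l ?(ltW h0)//.
rewrite (le_trans (ler_normD _ _))//.
apply: (le_trans (lerD absum young)).
have G0 : 0 <= G by apply: sumr_ge0 => i _; exact: sqr_ge0.
have small1 : B * (C + n%:R * (L * h)) <= sn * e / 2.
  have -> : n%:R * (L * h) = L * T by rewrite -nh; ring.
  rewrite ler_pdivlMr// -ler_pdivrMr//.
  rewrite -(ger0_norm (ltW sn0)) (le_trans (ler_norm _))//.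
  by rewrite -ler_sqr ?nnegrE// !real_normK ?num_real// snn.
have small2 : (\sum_(i < n) (be i - gam i) ^+ 2) / (sn * e) <= sn * e / 2.
  rewrite ler_pdivrMr ?mulr_gt0//.
  have -> : sn * e / 2 * (sn * e) = n%:R * (e ^+ 2 / 2) by rewrite -snn; field.
  apply: (le_trans sumsq); rewrite -(ler_pM2l h0).
  have -> : h * (n%:R * (e ^+ 2 / 2)) = T * e ^+ 2 / 2 by rewrite -nh; field.
  rewrite mulrCA.
  apply: (@le_trans _ _ (2 * C * (2 * e1))).
    rewrite ler_wpM2l ?mulr_ge0// (le_trans sumdiff)// mulr_natl mulr2n lerD//.
    by rewrite /h mulrA ler_pdivrMr// [e1 * _]mulrC -ler_pdivrMr.
  have z0 : 0 <= T * e ^+ 2 by rewrite mulr_ge0 ?sqr_ge0// ltW.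
  rewrite /e1 2!mulrA ler_pdivrMr//.
  by move: (T * e ^+ 2) z0 => z z0; lra.
have : sn * e / 4 * G <= sn * e * G.
  rewrite ler_wpM2r// ler_pdivrMr// ler_peMr ?mulr_ge0 ?ltW//; lra.
rewrite -/G [sn * e * (1 + G)]mulrDr mulr1; move: small1 small2.
move: (B * _) (_ / (sn * e)) (sn * e / 4 * G) (sn * e * G) => b1 b2 b3 b4.
by move: (sn * e) => b5 *; lra.
Unshelve. all: by end_near. Qed.

End drift.

(** * The estimator along a fixed path *)

Lemma near_natr_ge (R : realType) (x : R) : \forall n \near \oo, x <= n%:R.
Proof. exact: nbhs_infty_ger. Qed.

(** * Rates in the mesh size *)

Section mesh_rates.
Context (R : realType) (T rho : R).
Hypothesis T_gt0 : 0 < T.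
Hypothesis rho_range : 3^-1 <= rho < 2^-1.

Lemma mesh_gt0 n : (0 < n)%N -> 0 < mesh T n.
Proof. by move=> n0; rewrite divr_gt0// ltr0n. Qed.

Lemma mulr_mesh n : (0 < n)%N -> n%:R * mesh T n = T.
Proof. by move=> n0; rewrite /mesh mulrC divfK// pnatr_eq0 -lt0n. Qed.

Lemma near_mesh_le1 : \forall n \near \oo, mesh T n <= 1.
Proof.
near=> n; have n0 : (0 < n)%N by near: n; exact: nbhs_infty_gt.
rewrite /mesh ler_pdivrMr ?ltr0n// mul1r; near: n; exact: near_natr_ge.
Unshelve. all: by end_near. Qed.

Lemma near_sqrt_ge (x : R) : \forall n \near \oo, x <= Num.sqrt n%:R.
Proof.
near=> n; rewrite (le_trans (ler_norm _))//.
rewrite -[X in _ <= X]ger0_norm ?sqrtr_ge0// -ler_sqr ?nnegrE// !real_normK ?num_real//.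
by rewrite sqr_sqrtr//; near: n; exact: near_natr_ge.
Unshelve. all: by end_near. Qed.

Lemma near_cst_div_sqrt (K e : R) : 0 < e ->
  \forall n \near \oo, Num.sqrt n%:R * (K / n%:R) <= e.
Proof.
move=> e0; near=> n; have n0 : (0 < n)%N by near: n; exact: nbhs_infty_gt.
have s0 : 0 < Num.sqrt n%:R :> R by rewrite sqrtr_gt0 ltr0n.
rewrite -[in X in _ * X](@sqr_sqrtr _ n%:R)// expr2 invfM mulrCA !mulrA.
rewrite mulfK ?gt_eqF// ler_pdivrMr// [e * _]mulrC -ler_pdivrMr//.
by near: n; exact: near_sqrt_ge.
Unshelve. all: by end_near. Qed.

(** For h <= 1 and rho < 1/2, h^rho dominates sqrt h. This puts the drift over one cell below its
    share of the threshold. *)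
Lemma near_mesh_le_powR (C tau : R) : 0 <= C -> 0 < tau ->
  \forall n \near \oo, C * mesh T n <= tau * mesh T n `^ rho.
Proof.
move=> C0 t0; near=> n; have n0 : (0 < n)%N by near: n; exact: nbhs_infty_gt.
have h0 := mesh_gt0 n0; have h1 : mesh T n <= 1 by near: n; exact: near_mesh_le1.
set h := mesh T n in h0 h1 *.
have sh : Num.sqrt h <= h `^ rho.
  rewrite -powR12_sqrt ?(ltW h0)//; apply: ger_powR; first by rewrite h0.
  by case/andP: rho_range => _ /ltW.
apply: le_trans (ler_wpM2l (ltW t0) sh).
rewrite -[in X in X <= _](@sqr_sqrtr _ h) ?(ltW h0)// expr2 mulrA ler_wpM2r ?sqrtr_ge0//.
have s0 := sqrtr_ge0 h.
have x0 : 0 <= C * Num.sqrt h by rewrite mulr_ge0.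
rewrite -ler_sqr ?nnegrE// ?(ltW t0)// exprMn sqr_sqrtr ?(ltW h0)//.
rewrite /h /mesh mulrA ler_pdivrMr ?ltr0n// [X in _ <= X]mulrC -ler_pdivrMr ?exprn_gt0//.
by near: n; exact: near_natr_ge.
Unshelve. all: by end_near. Qed.

(** As rho >= 1/3, the cube of h^rho is at most h. The sixth power of the left-hand side is then at
    most n^3 h^4 = T^4 / n, which involves integer exponents only. *)
Lemma near_sqrt_powR (e : R) : 0 < e ->
  \forall n \near \oo, Num.sqrt n%:R * (mesh T n `^ rho) ^+ 2 <= e.
Proof.
move=> e0; near=> n; have n0 : (0 < n)%N by near: n; exact: nbhs_infty_gt.
have h0 := mesh_gt0 n0; have h1 : mesh T n <= 1 by near: n; exact: near_mesh_le1.
set h := mesh T n in h0 h1 *.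
set s := Num.sqrt n%:R; have s0 : 0 <= s by exact: sqrtr_ge0.
have hp0 : 0 <= h `^ rho by exact: powR_ge0.
have hp3 : (h `^ rho) ^+ 3 <= h.
  rewrite -powR_mulrn// -powRrM.
  rewrite -[X in _ <= X]powRr1 ?(ltW h0)//; apply: ger_powR; first by rewrite h0.
  case/andP: rho_range => + _; rewrite -(ler_pM2r (_ : 0 < 3%:R)) ?ltr0n//.
  by rewrite mulVf ?pnatr_eq0.
have x0 : 0 <= s * (h `^ rho) ^+ 2 by rewrite mulr_ge0// exprn_ge0.
rewrite -(@ler_pXn2r _ 6)// ?nnegrE// ?(ltW e0)//.
have -> : (s * (h `^ rho) ^+ 2) ^+ 6 = (s ^+ 2) ^+ 3 * ((h `^ rho) ^+ 3) ^+ 4.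
  by rewrite exprMn -!exprM.
have -> : s ^+ 2 = n%:R by rewrite /s sqr_sqrtr.
apply: (@le_trans _ _ (n%:R ^+ 3 * h ^+ 4)).
  by rewrite ler_wpM2l ?exprn_ge0// lerXn2r// nnegrE ?exprn_ge0 ?(ltW h0).
have -> : n%:R ^+ 3 * h ^+ 4 = T ^+ 4 / n%:R.
  by rewrite -(mulr_mesh n0) -/h; field; rewrite pnatr_eq0 -lt0n.
rewrite ler_pdivrMr ?ltr0n// mulrC -ler_pdivrMr ?exprn_gt0//.
by near: n; exact: near_natr_ge.
Unshelve. all: by end_near. Qed.

End mesh_rates.

Lemma entry_le_enorm (R : realType) m n (A : 'M[R]_(m, n)) i j : `|A i j| <= enorm A.
Proof.
rewrite -sqrtr_sqr ler_wsqrtr// (bigD1 i)//= (bigD1 j)//= -addrA lerDl addr_ge0//.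
  by apply: sumr_ge0 => *; exact: sqr_ge0.
by apply: sumr_ge0 => *; apply: sumr_ge0 => *; exact: sqr_ge0.
Qed.

(** The divisor [q.+1] is cruder than the root of [q], but it also covers [q = 0]. *)
Lemma enorm_le_cV (R : realType) q (x : 'cV[R]_q) (M : R) : 0 <= M ->
  (forall k, `|x k 0| <= M / q.+1%:R) -> enorm x <= M.
Proof.
move=> M0 xM; rewrite -[leRHS]ger0_norm// -sqrtr_sqr ler_wsqrtr//.
have M1 : 0 <= M / q.+1%:R by rewrite divr_ge0.
apply: (@le_trans _ _ (\sum_(i < q) (M / q.+1%:R) ^+ 2)).
  apply: ler_sum => i _; rewrite big_ord1 -real_normK ?num_real//.
  by rewrite lerXn2r// nnegrE.
rewrite sumr_const card_ord -[_ *+ q]mulr_natl exprMn exprVn mulrCA ler_piMr ?sqr_ge0//.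
rewrite ler_pdivrMr ?exprn_gt0// mul1r -natrX ler_nat.
by rewrite (leq_trans (leqnSn q))// -[X in (X <= _)%N]expn1 leq_pexp2l.
Qed.

Section kept_sums.
Context (R : realType) (q : nat) (Omega : Type) (X : R -> Omega -> 'cV[R]_q).
Variables (T D rho : R) (n : nat) (w : Omega).
Variables (jump : nat -> bool) (K : nat) (y z : nat -> 'cV[R]_q).
Hypothesis D_gt0 : 0 < D.
Hypothesis jumpK : (\sum_(i < n) jump i <= K)%N.
Hypothesis incr : forall i, (i < n)%N -> ~~ jump i ->
  increment X T n w i.+1 = y i + z i.
Local Notation th := (mesh T n `^ rho).
Hypothesis y_le : forall i k, (i < n)%N -> `|y i k 0| <= D / (2 * q.+1%:R) * th.
Hypothesis z_le : forall i k, (i < n)%N -> `|z i k 0| <= D / (2 * q.+1%:R) * th.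
Local Notation b i := (below_threshold X T D rho n w i.+1).
Local Notation dX i := (increment X T n w i.+1).

Let th0 : 0 <= th. Proof. exact: powR_ge0. Qed.
Let Dth0 : 0 <= D * th. Proof. by rewrite mulr_ge0// ltW. Qed.

Let yz_le i k : (i < n)%N -> `|(y i + z i) k 0| <= D * th / q.+1%:R.
Proof.
move=> ni; rewrite mxE (le_trans (ler_normD _ _))//.
rewrite (le_trans (lerD (y_le k ni) (z_le k ni)))//.
have : q.+1%:R != 0 :> R by rewrite pnatr_eq0.
move: q.+1%:R => Q Q0; rewrite le_eqVlt; apply/orP; left; apply/eqP; field.
by rewrite Q0.
Qed.

Let nojump_kept i : (i < n)%N -> ~~ jump i -> b i.
Proof.
move=> ni nj; rewrite /below_threshold incr//.
by apply: enorm_le_cV => // k; exact: yz_le.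
Qed.

Lemma kept_count_ge : (n - K <= kept_count X T D rho n w)%N.
Proof.
rewrite /kept_count big_add1 /= big_mkord leq_subLR (leq_trans _ (leq_add jumpK (leqnn _)))//.
rewrite -big_split /= -{1}(card_ord n) -sum1_card; apply: leq_sum => i _.
have := @nojump_kept i (ltn_ord i).
by case: (jump i) => // /(_ isT) ->.
Qed.

Lemma kept_count_le : (kept_count X T D rho n w <= n)%N.
Proof.
rewrite /kept_count big_add1 /= big_mkord -[leqRHS]card_ord -sum1_card.
by apply: leq_sum => i _; case: (b i).
Qed.

(** Off the jumps the summands agree. At a jump, the left sum has either nothing or an increment
    below the threshold, and the right sum has a product of entries of [y + z], which are also below
    it. Each of the at most [K] jump cells thus costs twice the squared threshold. *)
Lemma kept_sum_bound (k l : 'I_q) :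
  `|(\sum_(1 <= i < n.+1 | below_threshold X T D rho n w i)
       increment X T n w i *m (increment X T n w i)^T) k l
    - \sum_(i < n) (y i + z i) k 0 * (y i + z i) l 0| <= 2 * K%:R * (D * th) ^+ 2.
Proof.
rewrite big_add1 /= big_mkord summxE big_mkcond /= -sumrB.
rewrite (le_trans (ler_norm_sum _ _ _))//.
apply: (@le_trans _ _ (\sum_(i < n) (jump i)%:R * (2 * (D * th) ^+ 2))); last first.
  rewrite -mulr_suml -natr_sum [2 * K%:R]mulrC -mulrA ler_wpM2r// ?ler_nat//.
  by rewrite mulr_ge0// sqr_ge0.
have prod_le (a c : R) : `|a| <= D * th -> `|c| <= D * th -> `|a * c| <= (D * th) ^+ 2.
  by move=> ha hc; rewrite normrM expr2 ler_pM.
have q1 : D * th / q.+1%:R <= D * th by rewrite ler_pdivrMr// ler_peMr// ler1n.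
apply: ler_sum => i _; case: (boolP (jump i)) => ji; last first.
  rewrite (nojump_kept (ltn_ord i) ji) incr// mul0r.
  by rewrite mxE big_ord1 [_^T _ _]mxE subrr normr0.
rewrite mul1r mulr_natl mulr2n (le_trans (ler_normB _ _))// lerD//; last first.
  by apply: prod_le; rewrite (le_trans (yz_le _ _)).
case: ifPn => [bi|_]; last by rewrite normr0 sqr_ge0.
rewrite mxE big_ord1 [_^T _ _]mxE.
by apply: prod_le; rewrite (le_trans (entry_le_enorm _ _ _)).
Qed.

End kept_sums.

Section path_error.
Context (R : realType) (q : nat) (Omega : Type) (X : R -> Omega -> 'cV[R]_q).
Variables (T D rho : R) (w : Omega) (G al : R -> 'cV[R]_q).
Variables (jump : nat -> nat -> bool) (K : nat) (B C : R).
Hypothesis T_gt0 : 0 < T.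
Hypothesis D_gt0 : 0 < D.
Hypothesis rho_range : 3^-1 <= rho < 2^-1.
Hypothesis mal : forall k, measurable_fun setT (fun t => al t k 0).
Hypothesis alC : forall t k, `|al t k 0| <= C.
Hypothesis al_left : forall k t, 0 < t -> t <= T ->
  (fun s => al s k 0) s @[s --> t^'-] --> al t k 0.
Hypothesis GB : forall t k, 0 <= t -> t <= T -> `|G t k 0| <= B.
Hypothesis jumpK : forall n, (\sum_(i < n) jump n i <= K)%N.
Hypothesis incr : forall n i k, (0 < n)%N -> (i < n)%N -> ~~ jump n i ->
  increment X T n w i.+1 k 0 =
  itv_int (fun t => al t k 0) (i%:R * mesh T n) (i.+1%:R * mesh T n) +
  (G (i.+1%:R * mesh T n) - G (i%:R * mesh T n)) k 0.

Definition path_incr n i := G (i.+1%:R * mesh T n) - G (i%:R * mesh T n).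

Definition path_qvar n : 'M[R]_q :=
  T^-1 *: \sum_(i < n) path_incr n i *m (path_incr n i)^T.

Let qvarE n k l : path_qvar n k l =
  T^-1 * \sum_(i < n) path_incr n i k 0 * path_incr n i l 0.
Proof.
rewrite mxE summxE; congr (_ * _); apply: eq_bigr => i _.
by rewrite mxE big_ord1 [_^T _ _]mxE.
Qed.

Lemma path_qvar_diag_ge0 n k : 0 <= path_qvar n k k.
Proof.
rewrite qvarE mulr_ge0 ?invr_ge0 ?(ltW T_gt0)//; apply: sumr_ge0 => i _.
by rewrite -expr2 sqr_ge0.
Qed.

Lemma path_qvar_le_trace n k l : `|path_qvar n k l| <= \tr (path_qvar n).
Proof.
have tr2 i : path_qvar n i i <= \tr (path_qvar n).
  rewrite /mxtrace (bigD1 i)//= lerDl; apply: sumr_ge0 => *.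
  exact: path_qvar_diag_ge0.
apply: (@le_trans _ _ ((path_qvar n k k + path_qvar n l l) / 2)).
  rewrite !qvarE -mulrDr normrM normfV (gtr0_norm T_gt0) -mulrA ler_wpM2l ?invr_ge0 ?(ltW T_gt0)//.
  rewrite (le_trans (ler_norm_sum _ _ _))// -big_split /= mulr_suml ler_sum// => i _.
  rewrite ler_pdivlMr// normrM -!expr2 -[X in _ <= X + _]real_normK ?num_real//.
  rewrite -[X in _ <= _ + X]real_normK ?num_real//.
  by have := sqr_ge0 (`|path_incr n i k 0| - `|path_incr n i l 0|); rewrite sqrrB; lra.
by have := tr2 k; have := tr2 l; lra.
Qed.

(** The error is relative to the trace because a single path gives no bound on its realised
    covariance that is uniform in n. Besides the error in the sum itself, the normalisation by the
    number of kept cells contributes, by a factor of order K / n. *)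
Lemma path_error (e : R) : 0 < e -> \forall n \near \oo,
  (forall i k, (i < n)%N ->
     `|path_incr n i k 0| <= D / (2 * q.+1%:R) * mesh T n `^ rho) ->
  forall k l, `|Num.sqrt n%:R * (Sigma_hat X T D rho n w k l - path_qvar n k l)| <=
    e * (1 + \tr (path_qvar n)).
Proof.
have ar (u v x : R) : 0 <= u -> 0 < v -> x <= v * u -> 1 + x <= (1 + u) * (1 + v).
  by move=> *; lra.
have ar2 (u v x : R) : 0 <= u -> 0 <= x -> u <= 2 * v -> u - v <= x ->
    (u - v) * u <= 2 * x * v by move=> *; nra.
have ar3 (u v : R) : 0 <= u -> 0 <= v -> 2 * v * u <= u / 16 * (32 * (1 + v)).
  by move=> *; lra.
have ar4 (u t d x y : R) : 0 <= u -> 0 <= t -> 0 <= d -> x <= u * t / 16 ->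
    y <= u * t / 16 -> x + t * u / 8 * (1 + d) + y <= t * u / 4 * (1 + d).
  move=> u0 t0 d0 ? ?; have := mulr_ge0 (mulr_ge0 t0 u0) d0.
  by have := mulr_ge0 t0 u0; lra.
have ar5 (u d x y : R) : 0 <= u -> 0 <= d -> x <= u / 2 * (1 + d) ->
    y <= u / 4 * d -> x + y <= u * (1 + d).
  by move=> u0 d0 ? ?; have := mulr_ge0 u0 d0; lra.
move=> e0.
(* In positive dimension, an index is used to extract the signs of [C] and [B] from the bounds. *)
have [q0|qpos] := posnP q.
  by apply: nearW => n _ k; have := ltn_ord k; rewrite [X in (_ < X)%N]q0.
pose k0 := Ordinal qpos.
have C0 : 0 <= C by apply: le_trans (alC 0 k0).
have B0 : 0 <= B by apply: le_trans (GB k0 (lexx 0) (ltW T_gt0)).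
pose tau := D / (2 * q.+1%:R).
have tau0 : 0 < tau by rewrite divr_gt0// mulr_gt0.
have T1 : 0 < 1 + T by rewrite ltr_wpDl.
(* [e1] leaves e / 16 for each cross term after the factor 1 + T tr, and [e2] leaves e T / 16 for
   the jump cells. *)
pose e1 := e / (16 * (1 + T)).
have e10 : 0 < e1 by rewrite divr_gt0// mulr_gt0.
pose e2 := e * T / (32 * (1 + K%:R * D ^+ 2)).
have KD0 : 0 <= K%:R * D ^+ 2 by rewrite mulr_ge0// sqr_ge0.
have KD1 : 0 < 1 + K%:R * D ^+ 2 by rewrite ltr_pwDl.
have e20 : 0 < e2 by rewrite divr_gt0 ?mulr_gt0.
near=> n => small k l.
have n0 : (0 < n)%N by near: n; exact: nbhs_infty_gt.
have nn0 : 0 < n%:R :> R by rewrite ltr0n.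
have h0 := mesh_gt0 T_gt0 n0; have nh := mulr_mesh T n0.
have K2 : (2 * K <= n)%N by near: n; exact: nbhs_infty_ge.
have ch : C * mesh T n <= tau * mesh T n `^ rho by near: n; exact: near_mesh_le_powR.
have r1 : Num.sqrt n%:R * (mesh T n `^ rho) ^+ 2 <= e2 by near: n; exact: near_sqrt_powR.
have r2 : Num.sqrt n%:R * (T ^+ 2 * C ^+ 2 / n%:R) <= e * T / 16.
  by near: n; apply: near_cst_div_sqrt; rewrite divr_gt0// mulr_gt0.
have r3 : Num.sqrt n%:R * (2 * K%:R / n%:R) <= e / 4.
  by near: n; apply: near_cst_div_sqrt; rewrite divr_gt0.
have dr j : forall g : nat -> R,
    (forall k, (k <= n)%N -> `|\sum_(i < k) g i| <= 2 * B) ->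
    `|\sum_(i < n) itv_int (fun t => al t j 0) (i%:R * mesh T n) (i.+1%:R * mesh T n) * g i| <=
      mesh T n * Num.sqrt n%:R * e1 * (1 + \sum_(i < n) g i ^+ 2).
  move: j; near: n; apply: filter_forall => j.
  by apply: drift_negligible => //; [exact: al_left|rewrite mulr_ge0].
set s := Num.sqrt n%:R in r1 r2 r3 dr *; have s0 : 0 < s by rewrite sqrtr_gt0.
have ss : s ^+ 2 = n%:R by rewrite sqr_sqrtr// ltW.
set h := mesh T n in h0 nh ch r1 r2 dr *.
pose y i : 'cV[R]_q := \col_j itv_int (fun t => al t j 0) (i%:R * h) (i.+1%:R * h).
pose z := path_incr n.
have tS i : i.+1%:R * h - i%:R * h = h by rewrite -mulrBl -natr1 addrAC subrr add0r mul1r.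
have y_C i j : `|y i j 0| <= C * h.
  rewrite mxE -[in leRHS](tS i); apply: itv_int_bound => //.
  by rewrite ler_wpM2r ?ler_nat// ltW.
have incr' i : (i < n)%N -> ~~ jump n i -> increment X T n w i.+1 = y i + z i.
  by move=> ni nj; apply/colP => j; rewrite incr// [RHS]mxE [y _ _ _]mxE.
have y_le i j : (i < n)%N -> `|y i j 0| <= D / (2 * q.+1%:R) * mesh T n `^ rho.
  by move=> _; rewrite (le_trans (y_C i j)).
have KS := @kept_sum_bound R q Omega X T D rho n w (jump n) K y z
  D_gt0 (jumpK n) incr' y_le (fun i k => @small i k) k l.
have Nge := @kept_count_ge R q Omega X T D rho n w (jump n) K y z
  D_gt0 (jumpK n) incr' y_le (fun i k => @small i k).
have Nle := @kept_count_le R q Omega X T D rho n w.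
rewrite /Sigma_hat mxE.
move: Nge Nle KS; rewrite /kept_count_or_n.
set N := kept_count _ _ _ _ _ _.
set M := fun_of_matrix (\sum_(1 <= i < n.+1 | _) _) k l.
move=> Nge Nle KS.
(* At most K <= n / 2 cells are discarded, so the default value of [kept_count_or_n] does not
   occur. *)
have N2 : (n <= 2 * N)%N.
  have : (n <= N + K)%N by rewrite addnC -leq_subLR.
  by move=> ?; rewrite -(leq_add2r (2 * K)) (leq_trans (leq_add (leqnn n) K2))// addnn -mul2n -mulnDr leq_mul2l.
have N0 : (0 < N)%N by move: (leq_trans n0 N2); rewrite muln_gt0.
have -> : (N == 0)%N = false by apply/negbTE; rewrite -lt0n.
set tr := \tr _.
have tr0 : 0 <= tr by apply: sumr_ge0 => *; exact: path_qvar_diag_ge0.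
have zz j : \sum_(i < n) z i j 0 ^+ 2 <= T * tr.
  have := le_trans (ler_norm _) (path_qvar_le_trace n j j).
  by rewrite qvarE mulrC ler_pdivrMr// [tr * _]mulrC.
have yz j j' : `|\sum_(i < n) y i j 0 * z i j' 0| <= h * s * (e / 16) * (1 + tr).
  (* The partial sums telescope to G at time m h minus G at time 0. *)
  have hg m : (m <= n)%N -> `|\sum_(i < m) z i j' 0| <= 2 * B.
    move=> mn; have -> : \sum_(i < m) z i j' 0 = G (m%:R * h) j' 0 - G 0 j' 0.
      elim: m {mn} => [|m ih]; first by rewrite big_ord0 mul0r subrr.
      have zE : z m j' 0 = G (m.+1%:R * h) j' 0 - G (m%:R * h) j' 0.
        by rewrite /z /path_incr 2!mxE.
      rewrite big_ord_recr /= ih zE.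
      by rewrite [RHS](_ : _ = G (m%:R * h) j' 0 - G 0 j' 0 + (G (m.+1%:R * h) j' 0 - G (m%:R * h) j' 0)) // [RHS]addrC addrA subrK.
    have mh0 : 0 <= m%:R * h by rewrite mulr_ge0// ltW.
    have mhT : m%:R * h <= T by rewrite -nh ler_wpM2r ?ler_nat// ltW.
    rewrite (le_trans (ler_normB _ _))// [2 * B]mulr_natl mulr2n lerD ?GB//.
    exact: ltW.
  have := dr j (fun i => z i j' 0) hg.
  under eq_bigr do rewrite -/h.
  have -> : \sum_(i < n) itv_int (fun t => al t j 0) (i%:R * h) (i.+1%:R * h) * z i j' 0
     = \sum_(i < n) y i j 0 * z i j' 0 by apply: eq_bigr => i _; rewrite [y _ _ _]mxE.
  move=> /le_trans; apply.
  have hs0 : 0 <= h * s by rewrite mulr_ge0 ?ltW.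
  rewrite -[leLHS]mulrA -[leRHS]mulrA ler_wpM2l//.
  rewrite /e1 -[leLHS]mulrA -[leRHS]mulrA ler_wpM2l ?(ltW e0)//.
  rewrite invfM -[leLHS]mulrA ler_wpM2l// mulrC ler_pdivrMr//.
  exact: ar.
have yy : `|\sum_(i < n) y i k 0 * y i l 0| <= T ^+ 2 * C ^+ 2 / n%:R.
  rewrite (le_trans (ler_norm_sum _ _ _))//.
  apply: (@le_trans _ _ (\sum_(i < n) (C * h) ^+ 2)).
    by apply: ler_sum => i _; rewrite normrM expr2 ler_pM.
  rewrite sumr_const card_ord -[_ *+ n]mulr_natl /h /mesh.
  by rewrite le_eqVlt; apply/orP; left; apply/eqP; field; rewrite pnatr_eq0 -lt0n.
have TQ : \sum_(i < n) z i k 0 * z i l 0 = T * path_qvar n k l.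
  by rewrite qvarE mulrA divff ?gt_eqF// mul1r.
set Q := path_qvar n k l in TQ *.
have Qtr : `|Q| <= tr by exact: path_qvar_le_trace.
have MQ : `|M - T * Q| <= 2 * K%:R * (D * mesh T n `^ rho) ^+ 2 +
    2 * (h * s * (e / 16) * (1 + tr)) + T ^+ 2 * C ^+ 2 / n%:R.
  have -> : M - T * Q = (M - \sum_(i < n) (y i + z i) k 0 * (y i + z i) l 0) +
     (\sum_(i < n) y i k 0 * z i l 0 + \sum_(i < n) y i l 0 * z i k 0 +
      \sum_(i < n) y i k 0 * y i l 0).
    rewrite -TQ -!big_split /= -addrA; congr (_ + _).
    rewrite -sumrN -sumrN -big_split /=; apply: eq_bigr => i _; rewrite !mxE; ring.
  rewrite -[leRHS]addrA (le_trans (ler_normD (M - _) _))// lerD//.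
  rewrite (le_trans (ler_normD _ _))// lerD// [2 * _]mulr_natl mulr2n.
  by rewrite (le_trans (ler_normD _ _))// lerD.
have NN0 : 0 < N%:R :> R by rewrite ltr0n.
have NN2 : n%:R <= 2 * N%:R :> R by rewrite -natrM ler_nat.
have NK : n%:R - N%:R <= K%:R :> R by rewrite lerBlDr addrC -natrD ler_nat addnC -leq_subLR.
have NNn : N%:R <= n%:R :> R by rewrite ler_nat.
(* As n h = T, the error in the sum separates from the error n - N in the normalisation. *)
have -> : (N%:R * h)^-1 * M - Q = (N%:R * h)^-1 * (M - T * Q) + (n%:R - N%:R) / N%:R * Q.
  by rewrite -nh; field; rewrite !gt_eqF.
have Nh : (N%:R * h)^-1 <= 2 / T.
  rewrite -[leRHS]invrK lef_pV2 ?posrE ?mulr_gt0 ?invr_gt0 ?divr_gt0// invfM invrK mulrC.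
  by rewrite -nh ler_pdivrMr// [leRHS]mulrC [leRHS]mulrA ler_wpM2r ?(ltW h0).
have nK : (n%:R - N%:R) / N%:R <= 2 * K%:R / n%:R :> R.
  rewrite ler_pdivrMr// mulrAC ler_pdivlMr//.
  exact: ar2.
rewrite mulrDr (le_trans (ler_normD _ _))//.
have p1 : `|s * ((N%:R * h)^-1 * (M - T * Q))| <= e / 2 * (1 + tr).
  have -> : s * ((N%:R * h)^-1 * (M - T * Q)) = (N%:R * h)^-1 * (s * (M - T * Q)) by rewrite mulrCA.
  rewrite normrM [X in X * _]ger0_norm ?invr_ge0 ?mulr_ge0 ?(ltW h0)//.
  have -> : e / 2 * (1 + tr) = 2 / T * (T * e / 4 * (1 + tr)) by field; rewrite gt_eqF.
  apply: ler_pM => //; first by rewrite invr_ge0 mulr_ge0 ?(ltW h0).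
  rewrite normrM (gtr0_norm s0) (le_trans (ler_wpM2l (ltW s0) MQ))//.
  have b1 : s * (2 * K%:R * (D * mesh T n `^ rho) ^+ 2) <= e * T / 16.
    have -> : s * (2 * K%:R * (D * mesh T n `^ rho) ^+ 2) =
      2 * (K%:R * D ^+ 2) * (s * (mesh T n `^ rho) ^+ 2) by ring.
    apply: le_trans (ler_wpM2l _ r1) _; first by rewrite mulr_ge0.
    rewrite /e2 [leLHS]mulrA ler_pdivrMr ?mulr_gt0//.
    have : 0 <= e * T by rewrite mulr_ge0 ?ltW.
    by move=> ?; exact: ar3.
  have b2 : s * (2 * (h * s * (e / 16) * (1 + tr))) = T * e / 8 * (1 + tr).
    have -> : s * (2 * (h * s * (e / 16) * (1 + tr))) = s ^+ 2 * h * (e / 8 * (1 + tr)) by field.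
    by rewrite ss nh !mulrA.
  rewrite 2![s * _]mulrDr b2; apply: ar4 => //; exact: ltW.
  exact: ltW.
have p2 : `|s * ((n%:R - N%:R) / N%:R * Q)| <= e / 4 * tr.
  rewrite mulrA normrM ler_pM// ger0_norm ?mulr_ge0 ?subr_ge0 ?invr_ge0 ?(ltW s0)//.
  by apply: le_trans r3; rewrite ler_wpM2l ?(ltW s0).
by apply: (ar5 _ _ _ _ (ltW e0)).
Unshelve. all: by end_near. Qed.

End path_error.

(** * Cadlag paths and jumps *)

Section cadlag_functions.
Context (R : realType).
Implicit Types (y l f : R -> R).

(** This supplies the left continuity of the drift that the regularisation relies on, the drift
    being evaluated at left limits of the process. *)
Lemma left_lim_left_continuous y l :
  (forall t, 0 < t -> y s @[s --> t^'-] --> l t) ->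
  forall t, 0 < t -> l s @[s --> t^'-] --> l t.
Proof.
move=> yl t t0; apply/cvgrPdist_le => e e0.
have /cvgrPdist_le/(_ e e0)[r /= r0 hr] := yl t t0.
near=> s.
have st : s < t by near: s; exact: nbhs_left_lt.
have s0 : 0 < s by near: s; exact: nbhs_left_gt.
have rs : t - r < s by near: s; apply: nbhs_left_gt; rewrite ltrBlDr ltrDl.
have h : (fun u => `|l t - y u|) u @[u --> s^'-] --> `|l t - l s|.
  by apply: cvg_norm; apply: cvgB; [exact: cvg_cst|exact: yl].
apply: cvgr_to_le h _; near=> u.
have us : u < s by near: u; exact: nbhs_left_lt.
have ru : t - r < u by near: u; exact: nbhs_left_gt.
have ut := lt_trans us st.
apply: hr => //=; rewrite gtr0_norm ?subr_gt0//.
by rewrite ltrBlDr addrC -ltrBlDr.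
Unshelve. all: by end_near. Qed.

(** Near [t], the bound is assembled from the right limit, the left limit and the value at [t];
    compactness makes it global. *)
Lemma cadlag_bounded y l (T : R) :
  (forall t, 0 <= t -> y s @[s --> t^'+] --> y t) ->
  (forall t, 0 < t -> y s @[s --> t^'-] --> l t) ->
  exists M, forall t, 0 <= t -> t <= T -> `|y t| <= M.
Proof.
move=> yr yl.
have /compact_near_coveringP cov := @segment_compact R 0 T.
have := cov nat \oo (fun i t => 0 <= t -> `|y t| <= i%:R) _.
case.
  move=> t; rewrite /= in_itv /= => /andP[t0 tT].
  have loc (F : set_system R) (a : R) : Filter F -> y s @[s --> F] --> a ->
      \forall s \near F, `|y s| <= `|a| + 1.
    move=> FF /cvgrPdist_le/(_ 1 ltr01); apply: filterS => s h.
    by rewrite -(subrK a (y s)) addrC (le_trans (ler_normD _ _))// lerD2l distrC.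
  have [c hc] : exists c, \forall s \near t, 0 <= s -> `|y s| <= c.
    have [r1 /= r10 h1] := loc _ _ _ (yr t t0).
    have [c2 [r2 r20 h2]] : exists c2, exists2 r2, 0 < r2 &
        forall s, `|t - s| < r2 -> s < t -> 0 <= s -> `|y s| <= c2.
      move: t0; rewrite le_eqVlt => /predU1P[<-|t0].
        by exists 0, 1 => // s _ s0; rewrite leNgt s0.
      have [r2 /= r20 h2] := loc _ _ _ (yl t t0).
      by exists (`|l t| + 1), r2 => // s s1 s2 _; exact: h2.
    exists (Num.max (Num.max (`|y t| + 1) c2) `|y t|).
    exists (Num.min r1 r2) => /=; first by rewrite lt_min r10.
    move=> s /=; rewrite lt_min => /andP[s1 s2] s0; rewrite !le_max.
    have [st|ts|<-] := ltgtP s t; last by rewrite lexx !orbT.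
      by rewrite h2// orbT.
    by rewrite h1.
  exists ([set s | 0 <= s -> `|y s| <= c], [set i | c <= i%:R]).
    by split => //; exact: nbhs_infty_ger.
  by move=> [s i] /= [h1 h2] s0; rewrite (le_trans (h1 s0)).
move=> N _ /(_ N (leqnn N)) h; exists N%:R => t t0 tT.
by apply: h => //=; rewrite in_itv /= t0.
Qed.

(** The function is a limit of step functions that take on each cell the value at its left end, a
    point strictly to the left of [t] that tends to [t]. *)
Lemma left_continuous_measurable f (T : R) : 0 < T ->
  (forall t, 0 < t -> t <= T -> f s @[s --> t^'-] --> f t) ->
  measurable_fun setT (fun t : R => if (0 < t) && (t <= T) then f t else 0).
Proof.
move=> T0 fl.
pose h n : R := T / n.+1%:R.
have h0 n : 0 < h n by rewrite divr_gt0.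
pose fn (n : nat) (t : R) := \sum_(k < n.+1)
  (if (k%:R * h n < t) && (t <= k.+1%:R * h n) then f (k%:R * h n) else 0).
have mfn n : measurable_fun setT (fn n).
  apply: measurable_sum => k; apply: measurable_fun_ifT => //.
  by apply: measurable_and; [exact: measurable_fun_ltr|exact: measurable_fun_ler].
apply: (measurable_fun_cvg (h := fn)) => // t _.
have tk n k : (0 < t) && (t <= k%:R * h n) -> exists2 j, (j < k)%N & (j%:R * h n < t) && (t <= j.+1%:R * h n).
  elim: k => [|k ih] /andP[t0 tk]; first by move: (lt_le_trans t0 tk); rewrite mul0r ltxx.
  have [kt|kt] := ltP (k%:R * h n) t; first by exists k => //; rewrite kt.
  have [|j jk jt] := ih; first by rewrite t0.
  by exists j => //; rewrite (ltn_trans jk).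
case: ifPn => [/andP[t0 tT]|tn]; last first.
  have -> : fn ^~ t = fun=> 0; last exact: cvg_cst.
  apply/funext => n; apply: big1 => k _; case: ifPn => // /andP[k1 k2].
  have kh : 0 <= k%:R * h n by rewrite mulr_ge0// ltW.
  case/negP: tn; rewrite (le_lt_trans kh k1) /=.
  rewrite (le_trans k2)// /h mulrCA ler_piMr ?(ltW T0)// ler_pdivrMr// mul1r ler_nat.
  exact: ltn_ord.
apply/cvgrPdist_le => e e0.
have /cvgrPdist_le/(_ e e0)[r /= r0 hr] := fl t t0 tT.
near=> n.
have [|j jn jt] := tk n n.+1; first by rewrite t0 /h mulrC divfK ?pnatr_eq0.
have -> : fn n t = f (j%:R * h n).
  rewrite /fn (bigD1 (Ordinal jn))//= jt big1 ?addr0// => k kj.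
  case: ifPn => // /andP[k1 k2]; case/negP: kj; apply/eqP/val_inj => /=.
  case/andP: jt => j1 j2.
  have := lt_le_trans k1 j2; have := lt_le_trans j1 k2.
  rewrite !ltr_pM2r// !ltr_nat !ltnS => a1 a2.
  by apply/eqP; rewrite eqn_leq a1 a2.
case/andP: jt => j1 j2; apply: hr => //=.
rewrite gtr0_norm ?subr_gt0//.
apply: (@le_lt_trans _ _ (h n)).
  by rewrite lerBlDl (le_trans j2)// -natr1 mulrDl mul1r.
rewrite /h ltr_pdivrMr// mulrC -ltr_pdivrMr// (lt_le_trans (_ : _ < n.+1%:R))//.
rewrite (@le_lt_trans _ _ n%:R)// ?ltr_nat//.
by near: n; exact: nbhs_infty_ger.
Unshelve. all: by end_near. Qed.

End cadlag_functions.

Lemma left_limit_cvg (R : realType) d (x : R -> 'cV[R]_d) k : cadlag x ->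
  forall t, 0 < t -> x s k 0 @[s --> t^'-] --> left_limit x t k 0.
Proof.
move=> cx t t0; have [_ /(_ t0) h] := cx t (ltW t0).
apply: (cvg_comp _ (fun M : 'cV[R]_d => M k 0) h).
exact: coord_continuous.
Qed.

(** * Jumps counted by a Poisson random measure *)

Section jumps.
Context (R : realType) (d : nat).
Implicit Types (s t T : R).

Definition strip s t : set (R * 'cV[R]_d) := `]s, t]%classic `*` @punctured R d.

Lemma measurable_punctured : measurable (@punctured R d).
Proof.
apply: measurableC.
rewrite (_ : [set 0] = [set v : 'cV[R]_d | forall j, ((fun v : 'cV[R]_d => v j 0) @^-1` [set (0 : R)]) v]).
  apply: measurable_forall_ord => j.
  by rewrite -[X in measurable X]setTI; exact: measurable_entry.
apply/seteqP; split => [v /= -> j|v /= h]; first by rewrite mxE.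
by apply/colP => j; rewrite h mxE.
Qed.

Lemma measurable_strip s t : measurable (strip s t).
Proof. by apply: measurableX => //; exact: measurable_punctured. Qed.

Lemma strip_mark_space s t : 0 <= s -> strip s t `<=` mark_space d.
Proof.
move=> s0 [u z] [/=]; rewrite !in_itv /= => /andP[su _] zp; split => //=.
by rewrite in_itv /= (le_trans s0 (ltW su)).
Qed.

Lemma stripU r s t : r <= s -> s <= t -> strip r t = strip r s `|` strip s t.
Proof.
move=> rs st; apply/seteqP; split => [[u z] [/=]|[u z]].
  rewrite !in_itv /= => /andP[ru ut] zp.
  by have [us|us] := leP u s; [left|right]; split => //=; rewrite in_itv /= ?ru ?us.
move=> [] [/=]; rewrite !in_itv /= => /andP[u1 u2] zp; split => //=; rewrite in_itv /=.
  by rewrite u1 (le_trans u2).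
by rewrite u2 (le_lt_trans rs).
Qed.

Lemma strip_disj r s t : strip r s `&` strip s t = set0.
Proof.
apply/seteqP; split => [[u z] [[/=]]|//]; rewrite !in_itv /= => /andP[_ us] _ [/=].
by rewrite in_itv /= ltNge us.
Qed.

Lemma measure_stripU (m : {measure set (R * 'cV[R]_d) -> \bar R}) r s t :
  r <= s -> s <= t -> m (strip r t) = (m (strip r s) + m (strip s t))%E.
Proof.
move=> rs st; rewrite (stripU rs st) measureU//; try exact: measurable_strip.
exact: strip_disj.
Qed.

(** The masses of the cells are natural numbers with sum [K], and each non-zero one is at least
    1. *)
Lemma jump_count (m : {measure set (R * 'cV[R]_d) -> \bar R}) h (n K : nat) :
  0 <= h -> (forall i, (i < n)%N -> exists k : nat, m (strip (i%:R * h) (i.+1%:R * h)) = k%:R%:E) ->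
  m (strip 0 (n%:R * h)) = K%:R%:E ->
  (\sum_(i < n) (m (strip (i%:R * h) (i.+1%:R * h)) != 0%E) <= K)%N.
Proof.
move=> h0 mk.
suff H j : (j <= n)%N -> exists2 k : nat, m (strip 0 (j%:R * h)) = k%:R%:E &
    (\sum_(i < j) (m (strip (i%:R * h) (i.+1%:R * h)) != 0%E) <= k)%N.
  have [k -> hk] := H n (leqnn n).
  by move=> [] /eqP; rewrite eqr_nat => /eqP <-.
elim: j => [_|j ih jn].
  exists 0%N; last by rewrite big_ord0.
  rewrite mul0r (_ : strip 0 0 = set0) ?measure0//.
  apply/seteqP; split => [[u z] [/=]|//]; rewrite in_itv /= => /andP[u1 u2].
  by move: (lt_le_trans u1 u2); rewrite ltxx.
have [k mk1 hk] := ih (ltnW jn); have [l ml] := mk j jn.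
exists (k + l)%N.
  rewrite (@measure_stripU m 0 (j%:R * h)) ?mulr_ge0//; last by rewrite ler_wpM2r// ler_nat.
  by rewrite mk1 ml -EFinD natrD.
rewrite big_ord_recr /= leq_add// ml.
by case: l {ml} => [|l]; rewrite ?eqxx//; case: (_ != _).
Qed.

(** The positive and negative parts are compared separately, so that the equality also holds when
    [g] is not integrable. *)
Lemma strip_integral_null (m : {measure set (R * 'cV[R]_d) -> \bar R})
    (g : R * 'cV[R]_d -> R) s t : 0 <= s -> s <= t ->
  measurable_fun (strip 0 t) g -> m (strip s t) = 0%E ->
  \int[m]_(x in strip 0 t) g x = \int[m]_(x in strip 0 s) g x.
Proof.
move=> s0 st mg m0.
have mge : measurable_fun (strip 0 t) (EFin \o g) by exact/measurable_EFinP.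
have -> : strip 0 s = strip 0 t `\` strip s t.
  by rewrite (stripU s0 st) setDUl setDv setU0 setDidl ?strip_disj.
have mst := measurable_strip.
rewrite /Rintegral integralE [in RHS]integralE.
congr (fine (_ - _)%E); apply: ge0_negligible_integral => //.
  exact: measurable_funepos.
exact: measurable_funeneg.
Qed.

Section poisson.
Context dsp (Omega : measurableType dsp) (P : probability Omega R).
Variables (F : R -> set (set Omega)) (mu : Omega -> {measure set (R * 'cV[R]_d) -> \bar R}).

Lemma intensity_strip_lty (lam : R) (f : 'cV[R]_d -> R) s t : 0 <= lam -> is_density f ->
  (intensity (fun z => lam * f z)%R (strip s t) < +oo)%E.
Proof.
move=> lam0 [mf f0 f1]; rewrite /intensity.
have mp := measurable_punctured.
pose g (x : R * 'cV[R]_d) : \bar R :=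
  ((\1_(`]s, t]%classic) x.1)%:E * ((fun z => (lam * f z)%:E) \_ (@punctured R d)) x.2)%E.
have mlf : measurable_fun (@punctured R d) (fun z => (lam * f z)%:E).
  by apply/measurable_EFinP; exact: measurable_funM.
have mr : measurable_fun setT ((fun z => (lam * f z)%:E) \_ (@punctured R d)).
  by apply/(measurable_restrictT _ mp).
have r0 z : (0 <= ((fun z => (lam * f z)%:E) \_ (@punctured R d)) z)%E.
  rewrite patchE; case: ifPn => // /set_mem pz.
  by rewrite lee_fin mulr_ge0// f0.
rewrite integral_mkcond (_ : _ \_ _ = g); last first.
  apply/funext => -[u z]; rewrite /g /= !patchE indicE.
  rewrite [(u, z) \in _](_ : _ = (u \in `]s, t]%classic) && (z \in @punctured R d)).
    by case: (u \in _); case: (z \in _); rewrite /= ?mul1e ?mul0e.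
  by apply/idP/andP => [/set_mem[/= a b]|[/set_mem a /set_mem b]]; rewrite ?mem_set.
rewrite fubini_tonelli1; first last.
- by move=> x; rewrite mule_ge0// lee_fin.
- apply: emeasurable_funM.
    by apply/measurable_EFinP; apply: measurableT_comp => //; exact: measurable_indic.
  exact: measurableT_comp mr _.
rewrite /fubini_F /g.
under eq_integral => x _ do rewrite /= ge0_integralZl//.
rewrite ge0_integralZr//; last 2 first.
- by apply/measurable_EFinP; exact: measurable_indic.
- exact: integral_ge0.
rewrite integral_indic// setIT -integral_mkcond.
under eq_integral do rewrite EFinM.
rewrite ge0_integralZl_EFin//; last exact/measurable_EFinP.
rewrite f1 mule1 /= lebesgue_measure_itv /=.
by case: ifPn => _; rewrite ?mul0e ?ltry// -EFinD -EFinM ltry.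
Qed.

(** The Poisson weights of the natural numbers sum to 1, so no probability is left for other values
    of the measure. *)
Lemma poisson_natural (f : 'cV[R]_d -> R) (A : set (R * 'cV[R]_d)) :
  is_poisson_random_measure P F mu f -> measurable A -> A `<=` mark_space d ->
  (intensity f A < +oo)%E -> {ae P, forall w, exists k : nat, mu w A = k%:R%:E}.
Proof.
move=> pm mA Am iA.
have mmu := prm_measurable pm mA Am.
pose B (k : nat) := [set w | mu w A = k%:R%:E].
have mB k : measurable (B k).
  rewrite -[B k]setTI; apply: (mmu measurableT [set (k%:R%:E : \bar R)]).
  exact: emeasurable_set1.
have tB : trivIset setT B.
  by move=> i j _ _ [w []]; rewrite /B /= => -> [] /eqP; rewrite eqr_nat => /eqP.
have PB : P (\bigcup_k B k) = 1%E.
  have PBk k : P (B k) = poisson_prob (fine (intensity f A)) 0%N [set k].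
    exact: (prm_poisson pm mA Am iA).
  rewrite measure_bigcup// (eq_eseriesr (fun k _ => PBk k)).
  pose q := poisson_prob (fine (intensity f A)) 0%N.
  rewrite -(@measure_bigcup _ _ _ [the measure _ _ of q] setT (fun k => [set k]))//.
    by rewrite bigcup_imset1 image_id; exact: (@probability_setT _ _ _ [the probability _ _ of q]).
  by move=> i j _ _ [x [/= -> ->]].
exists (~` \bigcup_k B k); split.
- by apply: measurableC; exact: bigcup_measurable.
- by rewrite probability_setC ?PB ?subee//; exact: bigcup_measurable.
by apply: subsetC => w [k _ h]; exists k.
Qed.

End poisson.
End jumps.

Lemma near_enorm_le (R : realType) d (T : Type) (F : set_system T) (FF : Filter F)
    (v : T -> 'cV[R]_d) (a : 'cV[R]_d) (e : R) : 0 < e ->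
  (forall k, v x k 0 @[x --> F] --> a k 0) -> \forall x \near F, enorm (a - v x) <= e.
Proof.
move=> e0 va; near=> x; apply: enorm_le_cV => [|k]; first exact: ltW.
rewrite !mxE; move: k; near: x; apply: filter_forall => k.
by move/cvgrPdist_le : (va k); apply; rewrite divr_gt0.
Unshelve. all: by end_near. Qed.

Lemma exists_bound_ord (R : realType) (T : Type) d (A : T -> Prop) (f : 'I_d -> T -> R) :
  (forall k, exists M, forall t, A t -> f k t <= M) ->
  exists M, forall k t, A t -> f k t <= M.
Proof.
move=> /choice[M hM]; exists (\sum_k `|M k|) => k t At.
rewrite (le_trans (hM k t At))// (le_trans (ler_norm _))// (bigD1 k)//= lerDl.
by apply: sumr_ge0 => *.
Qed.

(** * Increments of a latent process *)

Section latent_path.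
Context dsp (Omega : measurableType dsp) (R : realType) (P : probability Omega R).
Context (d r : nat) (F : R -> set (set Omega)).
Variables (a : 'cV[R]_d -> 'cV[R]_d) (Sg : 'M[R]_(d, r)).
Variables (c : 'cV[R]_d -> 'cV[R]_d -> 'cV[R]_d) (lambda0 : R) (dens : 'cV[R]_d -> R).
Variables (x0 : 'cV[R]_d) (W : R -> Omega -> 'cV[R]_r).
Variables (mu : Omega -> {measure set (R * 'cV[R]_d) -> \bar R}) (S : R -> Omega -> 'cV[R]_d).
Hypothesis latent : is_latent_process P F a Sg c lambda0 dens x0 W mu S.
Hypothesis lip : lipschitz_growth a c.
Variable T : R.
Hypothesis T_gt0 : 0 < T.

Local Notation strip := (@strip R d).
Local Notation ll w t := (left_limit (S ^~ w) t).

(** The cut-off outside ]0, T] makes the drift bounded and measurable on the whole line, as the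
    estimates on [left_avg] assume. *)
Definition latent_drift_path w (t : R) : 'cV[R]_d :=
  if (0 < t) && (t <= T) then a (ll w t) else 0.

Let llk w k t : 0 < t -> S s w k 0 @[s --> t^'-] --> ll w t k 0.
Proof. by apply: (@left_limit_cvg _ _ (S ^~ w)); exact: (latent_cadlag latent w). Qed.

Let ll_left w k t : 0 < t -> ll w s k 0 @[s --> t^'-] --> ll w t k 0.
Proof. exact: (@left_lim_left_continuous _ (fun s => S s w k 0) (fun s => ll w s k 0) (@llk w k)). Qed.

Let a_left w k t : 0 < t -> a (ll w s) k 0 @[s --> t^'-] --> a (ll w t) k 0.
Proof.
move=> t0; have [L [g [L0 _ _ aL _]]] := lip.
apply/cvgrPdist_le => e e0; near=> s.
have h : enorm (ll w t - ll w s) <= e / L.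
  by near: s; apply: near_enorm_le => [|k']; [rewrite divr_gt0|exact: ll_left].
have := entry_le_enorm (a (ll w t) - a (ll w s)) k 0.
rewrite !mxE => /le_trans; apply; apply: le_trans (aL _ _) _.
by rewrite mulrC -ler_pdivlMr.
Unshelve. all: by end_near. Qed.

Let ll_bounded w : exists M, forall k t, 0 < t -> t <= T -> `|ll w t k 0| <= M.
Proof.
have H k : exists M, forall t, 0 < t -> t <= T -> `|ll w t k 0| <= M.
  have [M hM] : exists M, forall t, 0 <= t -> t <= T -> `|S t w k 0| <= M.
    apply: (@cadlag_bounded _ (fun t => S t w k 0) (fun t => ll w t k 0)) => t t0; last exact: llk.
    have [h _] := latent_cadlag latent w t0.
    apply: (cvg_comp _ (fun M : 'cV[R]_d => M k 0) h); exact: coord_continuous.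
  exists M => t t0 tT; have h := cvg_norm (@llk w k t t0).
  apply: cvgr_to_le (h _) _; near=> s; apply: hM.
    by apply/ltW; near: s; exact: nbhs_left_gt.
  by rewrite (le_trans _ tT)// ltW//; near: s; exact: nbhs_left_lt.
have [M hM] : exists M, forall k t, 0 < t <= T -> `|ll w t k 0| <= M.
  by apply: exists_bound_ord => k; have [M hM] := H k; exists M => t /andP[]; exact: hM.
by exists M => k t t0 tT; apply: hM; rewrite t0.
Unshelve. all: by end_near. Qed.

Lemma latent_drift_bounded w : exists C, forall t k, `|latent_drift_path w t k 0| <= C.
Proof.
have [M hM] := ll_bounded w; have [L [g [L0 _ _ aL _]]] := lip.
have M0 : 0 <= `|M| * d.+1%:R by rewrite mulr_ge0.
exists (enorm (a 0) + L * (`|M| * d.+1%:R)) => t k; rewrite /latent_drift_path.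
have e0 : 0 <= enorm (a 0) by exact: sqrtr_ge0.
case: ifPn => [/andP[t0 tT]|_]; last first.
  by rewrite mxE normr0 addr_ge0// mulr_ge0// ltW.
rewrite -(subrK (a 0) (a (ll w t))) mxE (le_trans (ler_normD _ _))// addrC lerD//.
  exact: entry_le_enorm.
rewrite (le_trans (entry_le_enorm _ _ _))// (le_trans (aL _ _))// ler_wpM2l ?(ltW L0)//.
apply: enorm_le_cV => // j; rewrite subr0 mulfK// (le_trans (hM j t t0 tT))//.
exact: ler_norm.
Qed.

Lemma latent_drift_left w k t : 0 < t -> t <= T ->
  latent_drift_path w s k 0 @[s --> t^'-] --> latent_drift_path w t k 0.
Proof.
move=> t0 tT; rewrite {2}/latent_drift_path t0 tT /=.
apply: cvg_trans (@a_left w k t t0); apply: near_eq_cvg; near=> s.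
have s0 : 0 < s by near: s; exact: nbhs_left_gt.
have st : s <= t by apply/ltW; near: s; exact: nbhs_left_lt.
by rewrite /latent_drift_path s0 (le_trans st tT).
Unshelve. all: by end_near. Qed.

Let drift_entry w k : (fun t => latent_drift_path w t k 0) =
  fun t : R => if (0 < t) && (t <= T) then a (ll w t) k 0 else 0.
Proof. by apply/funext => t; rewrite /latent_drift_path; case: ifPn => _ //; rewrite mxE. Qed.

Lemma latent_drift_measurable w k :
  measurable_fun setT (fun t => latent_drift_path w t k 0).
Proof.
rewrite drift_entry; apply: (@left_continuous_measurable _ (fun t => a (ll w t) k 0)) => // t t0 _.
exact: a_left.
Qed.

Let jump_measurable w k t : t <= T ->
  measurable_fun (strip 0 t) (fun sz => c (ll w sz.1) sz.2 k 0).
Proof.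
(* [l] is the left limit set to 0 outside ]0, T], so that it is measurable on the whole line. *)
move=> tT; pose l (s : R) : 'cV[R]_d := \col_j (if (0 < s) && (s <= T) then ll w s j 0 else 0).
have ml : measurable_fun setT l.
  apply: measurable_fun_mx => i j; rewrite ord1 /l; under eq_fun do rewrite mxE.
  by apply: left_continuous_measurable => // s s0 _; exact: ll_left.
apply: (eq_measurable_fun (fun sz => c (l sz.1) sz.2 k 0)).
  move=> [s z] /set_mem[/=]; rewrite in_itv /= => /andP[s0 st] _.
  by congr (c _ z k 0); apply/colP => j; rewrite mxE s0 (le_trans st tT).
apply: (measurableT_comp (measurable_entry k 0)).
apply: (measurable_comp (F := [set: 'cV[R]_d] `*` @punctured R d) (f := fun xz => c xz.1 xz.2)
    (g := fun sz : R * 'cV[R]_d => (l sz.1, sz.2))).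
- by apply: measurableX => //; exact: measurable_punctured.
- by move=> _ [[s z] [_ zp] <-].
- exact: latent_jump latent.
apply: measurable_funTS; apply: measurable_fun_pair => //.
exact: measurableT_comp ml _.
Qed.

Lemma latent_increment_ae : {ae P, forall w, forall s t k, 0 <= s -> s <= t -> t <= T ->
  mu w (strip s t) = 0%E ->
  S t w k 0 - S s w k 0 = itv_int (fun u => latent_drift_path w u k 0) s t
    + (Sg *m (W t w - W s w)) k 0}.
Proof.
have := latent_sde latent; apply: filterS => w sde s t k s0 st tT m0.
have t0 := le_trans s0 st.
have [C hC] := latent_drift_bounded w; have md := latent_drift_measurable w k.
have drift u : 0 <= u -> u <= T -> \int[@lebesgue_measure R]_(v in `[0%R, u]) a (ll w v) k 0 =
    itv_int (fun v => latent_drift_path w v k 0) 0 u.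
  move=> u0 uT.
  have e v : v \in `]0%R, u]%classic -> latent_drift_path w v k 0 = a (ll w v) k 0.
    move=> /set_mem /=; rewrite in_itv /= => /andP[v0 vu].
    by rewrite /latent_drift_path v0 (le_trans vu uT).
  (* The equation integrates over a closed interval, whose left end point, where the left limit
     looks at negative times, is negligible. *)
  rewrite -Rintegral_itv_obnd_cbnd; first by apply: eq_Rintegral => v /e.
  have i := itv_integrable 0 u md (fun t => hC t k).
  by apply: eq_integrable i => // v ve /=; rewrite (e v ve).
have -> : (Sg *m (W t w - W s w)) k 0 = (Sg *m W t w) k 0 - (Sg *m W s w) k 0.
  by rewrite mulmxBr !mxE.
rewrite !sde// !mxE !drift ?(le_trans st tT)//.
(* The jump integrals up to [s] and up to [t] are equal, so they cancel whatever their value. *)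
rewrite -!/(strip 0 _) (strip_integral_null s0 st (jump_measurable w k tT) m0).
have := itv_int_add md (fun u => hC u k) s0 st => ->.
set i1 := itv_int _ 0 s; set i2 := itv_int _ s t.
set w1 := \sum_j Sg k j * W t w j 0; set w2 := \sum_j Sg k j * W s w j 0.
by set jj := Rintegral _ _ _; lra.
Qed.

Lemma latent_jumps_ae : {ae P, forall w,
  (forall n i, (i < n)%N -> exists k : nat,
     mu w (strip (i%:R * mesh T n) (i.+1%:R * mesh T n)) = k%:R%:E)}.
Proof.
apply/ae_foralln => n; apply/ae_foralln => i.
have h0 : 0 <= mesh T n by rewrite divr_ge0// ltW.
apply: filterS (poisson_natural (latent_poisson latent)
  (measurable_strip (i%:R * mesh T n) (i.+1%:R * mesh T n)) _ _).
- by [].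
- by apply: strip_mark_space; rewrite mulr_ge0.
- apply: intensity_strip_lty; last exact: latent_density latent.
  exact: ltW (latent_rate latent).
Qed.

Lemma latent_wiener_bounded_ae : {ae P, forall w, exists M, forall t k,
  0 <= t -> t <= T -> `|W t w k 0| <= M}.
Proof.
apply: filterS (wiener_continuous (latent_wiener latent)) => w cw.
have H k : exists M, forall t, 0 <= t -> t <= T -> `|W t w k 0| <= M.
  have cont : {within `[0, T], continuous (fun t => `|W t w k 0|)}.
    have cw' : {within `[0, T], continuous (fun t : R => W t w)}.
      apply: continuous_subspaceW cw => u /=; rewrite !in_itv /= => /andP[->] //.
    move=> u; apply: (@cvg_norm).
    apply: (cvg_comp _ (fun M : 'cV[R]_r => M k 0) (cw' u)); exact: coord_continuous.
  have [u _ hu] := EVT_max (ltW T_gt0) cont.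
  by exists (`|W u w k 0|) => t t0 tT; apply: hu; rewrite in_itv /= t0.
have [M hM] : exists M, forall k t, 0 <= t <= T -> `|W t w k 0| <= M.
  by apply: exists_bound_ord => k; have [M hM] := H k; exists M => t /andP[]; exact: hM.
by exists M => t k t0 tT; apply: hM; rewrite t0.
Qed.

End latent_path.

(** * Independence of the noise *)

Section grouped_independence.
Context dsp (Omega : measurableType dsp) (R : realType) (P : probability Omega R).
Context (I : finType) (G : I -> set (set Omega)).
Hypothesis indG : independent_sigma_fields P G.
Hypothesis G_setT : forall i, G i setT.
Hypothesis G_setI : forall i, setI_closed (G i).
Variable Q : pred I.
Hypothesis G_meas : forall i, Q i -> G i `<=` measurable.

(** A pi-system that generates the join of the fields selected by [Q]. *)
Definition joint_events : set (set Omega) :=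
  [set A | exists B : I -> set Omega, [/\ forall i, G i (B i),
     forall i, ~~ Q i -> B i = setT & A = \bigcap_(i in [set: I]) B i]].

Lemma sub_joint_events i : Q i -> G i `<=` joint_events.
Proof.
move=> Qi A GA; exists (fun k => if k == i then A else setT); split.
- by move=> k; case: eqP => [->|_].
- by move=> k nQ; case: eqP => // e; move: nQ; rewrite e Qi.
apply/seteqP; split => [w Aw k _|w /(_ i Logic.I)]; last by rewrite eqxx.
by case: eqP.
Qed.

Lemma joint_events_measurable : joint_events `<=` measurable.
Proof.
move=> _ [B [GB BT ->]]; apply: fin_bigcap_measurable => // i _.
by case: (boolP (Q i)) => Qi; [exact: (G_meas Qi)|rewrite BT].
Qed.

(** An event of [G i] meets an event of the pi-system in an intersection with one event per field,
    to which the joint independence applies; [indep_generated] extends this to the join. *)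
Lemma joint_events_indep i : ~~ Q i -> G i `<=` measurable ->
  indep P (G i) <<s joint_events >>.
Proof.
move=> nQ mG; apply: indep_generated => //; first exact: joint_events_measurable.
  move=> _ _ [B [GB BT ->]] [C [GC CT ->]]; exists (fun k => B k `&` C k); split.
  - by move=> k; exact: G_setI.
  - by move=> k nQk; rewrite BT// CT// setTI.
  by rewrite bigcapI.
move=> A _ GA [B [GB BT ->]].
pose C k := if k == i then A else B k.
have -> : A `&` \bigcap_(k in [set: I]) B k = \bigcap_(k in [set: I]) C k.
  apply/seteqP; split => [w [Aw Bw] k _|w Cw]; first by rewrite /C; case: eqP => // _; exact: Bw.
  split; first by have := Cw i Logic.I; rewrite /C eqxx.
  by move=> k _; have := Cw k Logic.I; rewrite /C; case: eqP => // -> _; rewrite BT.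
rewrite !indG//; last by move=> k; rewrite /C; case: eqP => [->|].
rewrite (bigD1 i)//= [X in (_ = _ * X)%E](bigD1 i)//= /C eqxx BT// probability_setT mul1e.
by congr (_ * _)%E; apply: eq_bigr => k /negbTE ->.
Qed.

Let H := g_sigma_algebraType joint_events.

Lemma joint_events_fun i d' (U : measurableType d') (f : Omega -> U) : Q i ->
  (forall A, measurable A -> G i (f @^-1` A)) ->
  measurable_fun [set: H] (f : H -> U).
Proof.
move=> Qi fG _ A mA; rewrite setTI; apply: sub_sigma_algebra.
by apply: (sub_joint_events Qi); exact: fG.
Qed.

Lemma joint_events_indep_rv i d1 d2 (U : measurableType d1) (V : measurableType d2)
    (f : Omega -> U) (g : Omega -> V) : ~~ Q i -> G i `<=` measurable ->
  (forall A, measurable A -> G i (f @^-1` A)) ->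
  measurable_fun [set: H] (g : H -> V) -> indep_rv P f g.
Proof.
move=> nQ mG fG mg A B mA mB; apply: (joint_events_indep nQ mG); first exact: fG.
by have := mg measurableT B mB; rewrite setTI.
Qed.

End grouped_independence.

Lemma indep_rv_sym dsp (Omega : measurableType dsp) (R : realType) (P : probability Omega R)
    d1 d2 (U : measurableType d1) (V : measurableType d2) (f : Omega -> U) (g : Omega -> V) :
  indep_rv P f g -> indep_rv P g f.
Proof. by move=> fg A B mA mB; rewrite setIC fg// muleC. Qed.

Section noise.
Context dsp (Omega : measurableType dsp) (R : realType) (P : probability Omega R).
Variables (F : R -> set (set Omega)) (d r : 'I_4 -> nat).
Variables (W : forall i, R -> Omega -> 'cV[R]_(r i)).
Variables (mu : forall i, Omega -> {measure set (R * 'cV[R]_(d i)) -> \bar R}).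
Hypothesis filtF : is_filtration F.
Hypothesis wienerW : forall i, is_wiener P F (W i).
Hypothesis noise_indep : forall t, 0 <= t ->
  independent_sigma_fields P (noise_sigma_fields F W mu t).
Variables (p : nat) (N : forall i, 'M[R]_(p, r i)).

Lemma wiener_measurable i t : 0 <= t -> measurable_fun setT (W i t).
Proof.
move=> t0 _ A mA; rewrite setTI; apply: (filtF.1 t t0).2.
by apply: (wiener_adapted (wienerW i) t0); exists A => //; rewrite setTI.
Qed.

Let noise t := noise_sigma_fields F W mu t.

Let sigma_noise t k : 0 <= t -> sigma_algebra setT (noise t k).
Proof.
by move=> t0; case: k => [[i|i]|] /=; [exact: smallest_sigma_algebra|exact: smallest_sigma_algebra|exact: (filtF.1 t t0).1].
Qed.

Let noise_setT t k : 0 <= t -> noise t k setT.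
Proof.
move=> t0; have [h0 hC _] := sigma_noise k t0.
by rewrite -(setD0 setT); exact: hC.
Qed.

Let noise_setI t k : 0 <= t -> setI_closed (noise t k).
Proof.
move=> t0 A B GA GB; have h := sigma_noise k t0.
have := sigma_algebra_id h; rewrite -/(noise t k) => e.
have : @measurable _ (g_sigma_algebraType (noise t k)) (A `&` B).
  by apply: measurableI; exact: sub_sigma_algebra.
by rewrite [X in X -> _](_ : _ = noise t k (A `&` B)) //= /measurable /= e.
Qed.

Let wiener_future_measurable t i : 0 <= t -> wiener_future (W i) t `<=` measurable.
Proof.
move=> t0; apply: smallest_sub; first exact: sigma_algebra_measurable.
move=> A [u /=]; rewrite in_itv /= andbT => tu [B mB <-].
have h : measurable_fun setT (fun w => W i u w - W i t w).
  apply: measurable_fun_mx => j k; under eq_fun do rewrite !mxE.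
  by apply: measurable_funB; apply: measurable_entryT; apply: wiener_measurable => //; exact: le_trans tu.
exact: h.
Qed.

Let future_incr t u i : t <= u -> forall A, measurable A ->
  noise t (Some (inl i)) ((fun w => W i u w - W i t w) @^-1` A).
Proof.
move=> tu A mA; apply: sub_sigma_algebra; exists u => /=; first by rewrite in_itv /= tu.
by exists A => //; rewrite setTI.
Qed.

Definition wiener_sum (t : R) (w : Omega) : 'cV[R]_p := \sum_i N i *m W i t w.

Lemma wiener_sumB s t w : wiener_sum t w - wiener_sum s w = \sum_i N i *m (W i t w - W i s w).
Proof. by rewrite -sumrB; apply: eq_bigr => i _; rewrite mulmxBr. Qed.

Lemma wiener_sum_adapted t u j : 0 <= t -> t <= u ->
  measurable_fun [set: g_sigma_algebraType (F u)]
    (fun w : g_sigma_algebraType (F u) => wiener_sum t w j 0).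
Proof.
move=> t0 tu; apply: measurable_entryT; rewrite /wiener_sum.
apply: measurable_fun_mx => k l; under eq_fun do rewrite summxE.
apply: measurable_sum => i; apply: measurable_entryT; apply: measurable_mulmx.
move=> _ A mA; rewrite setTI; apply: sub_sigma_algebra.
apply: (filtF.2 _ _ t0 tu); apply: (wiener_adapted (wienerW i) t0).
by exists A => //; rewrite setTI.
Qed.

(** Selects the future Wiener fields of index below [m], so that the four processes can be added one
    by one. *)
Let Qlt (m : nat) (k : option ('I_4 + 'I_4)) :=
  if k is Some (inl i) then (i < m)%N else false.

Let Qlt_meas t m k : 0 <= t -> Qlt m k -> noise t k `<=` measurable.
Proof. by move=> t0; case: k => [[i|i]|] //= _; exact: wiener_future_measurable. Qed.

Let partial_measurable s t m : 0 <= s -> s <= t ->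
  measurable_fun [set: g_sigma_algebraType (joint_events (noise s) (Qlt m))]
   ((fun w => \sum_(i < 4 | (i < m)%N) N i *m (W i t w - W i s w) : 'cV[R]_p)).
Proof.
move=> s0 st; apply: measurable_fun_mx => k l; under eq_fun do rewrite summxE.
under eq_fun do rewrite big_mkcond /=.
apply: measurable_sum => i; case im : (i < m)%N; last by [].
apply: measurable_entryT; apply: measurable_mulmx.
apply: (@joint_events_fun _ _ _ (noise s) (fun i => noise_setT i s0) (Qlt m) (Some (inl i))) => //.
exact: future_incr.
Qed.

(** The past [F s] is the field of index [None], and the increment is measurable for the join of the
    four future Wiener fields. *)
Lemma wiener_sum_indep s t d1 (U : measurableType d1) (f : Omega -> U) : 0 <= s -> s <= t ->
  (forall A, measurable A -> F s (f @^-1` A)) ->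
  indep_rv P f (fun w => wiener_sum t w - wiener_sum s w).
Proof.
move=> s0 st fF.
have := @joint_events_indep_rv _ _ _ P _ (noise s) (noise_indep s0)
  (fun i => @noise_setI s i s0) (Qlt 4)
  (fun i => @Qlt_meas s 4 i s0) None _ _ U _ f
  (fun w => wiener_sum t w - wiener_sum s w) isT (filtF.1 s s0).2 fF.
apply; have := @partial_measurable s t 4 s0 st.
apply: eq_measurable_fun => w _ /=; rewrite wiener_sumB.
by apply: eq_bigl => i; rewrite ltn_ord.
Qed.

(** The terms are added one at a time by [gaussianD]: the term of index [m] is independent of the
    earlier ones because it belongs to another future field at time [s]. *)
Lemma wiener_sum_gaussian s t (u : 'cV[R]_p) : 0 <= s -> s <= t ->
  (exists B, brownian P F B) ->
  gaussian P (fun w => (u^T *m (wiener_sum t w - wiener_sum s w)) 0 0)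
   ((t - s) * (u^T *m (\sum_i N i *m (N i)^T) *m u) 0 0).
Proof.
move=> s0 st [B brB].
have var i : (u^T *m (N i *m (N i)^T) *m u) 0 0 = \sum_k ((N i)^T *m u) k 0 ^+ 2.
  have -> : u^T *m (N i *m (N i)^T) *m u = ((N i)^T *m u)^T *m ((N i)^T *m u).
    by rewrite trmx_mul trmxK !mulmxA.
  by rewrite mxE; apply: eq_bigr => k _; rewrite [_^T _ _]mxE expr2.
have ge0 i : 0 <= (t - s) * (u^T *m (N i *m (N i)^T) *m u) 0 0.
  by rewrite var mulr_ge0 ?subr_ge0// sumr_ge0// => k _; exact: sqr_ge0.
have mW i : measurable_fun setT (fun w => W i t w - W i s w).
  apply: measurable_fun_mx => j k; under eq_fun do rewrite !mxE.
  by apply: measurable_funB; apply: measurable_entryT; apply: wiener_measurable => //; exact: le_trans st.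
have term i : gaussian P (fun w => (u^T *m (N i *m (W i t w - W i s w))) 0 0)
    ((t - s) * (u^T *m (N i *m (N i)^T) *m u) 0 0).
  split; first by apply: measurable_linear_form; exact: measurable_mulmx.
  move=> A mA; have := wiener_increment (wienerW i) s0 st ((N i)^T *m u) mA.
  rewrite /pushforward /= mulmx0 mxE mul_mx_scalar -scalemxAl trmx_mul trmxK.
  rewrite [X in normal1 _ X]mxE -!mulmxA => <-.
  by congr (P _); apply/seteqP; split => w /=; rewrite mulmxA.
suff H m : (m <= 4)%N -> gaussian P
    (fun w => (u^T *m \sum_(i < 4 | (i < m)%N) N i *m (W i t w - W i s w)) 0 0)
    (\sum_(i < 4 | (i < m)%N) (t - s) * (u^T *m (N i *m (N i)^T) *m u) 0 0).
  have := H 4 (leqnn 4).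
  have -> : \sum_(i < 4 | (i < 4)%N) (t - s) * (u^T *m (N i *m (N i)^T) *m u) 0 0 =
      (t - s) * (u^T *m (\sum_i N i *m (N i)^T) *m u) 0 0.
    rewrite mulmx_sumr mulmx_suml summxE mulr_sumr.
    by apply: eq_bigl => i; rewrite ltn_ord.
  congr gaussian; apply/funext => w; rewrite wiener_sumB.
  by congr ((_ *m _) 0 0); apply: eq_bigl => i; rewrite ltn_ord.
elim: m => [|m ih] m4.
  have := brownian_gaussian brB 0 (lexx 0) (lexx (0 : R)).
  rewrite expr0n mul0r big_pred0//; congr gaussian; apply/funext => w.
  by rewrite mul0r big_pred0// mulmx0 mxE.
pose i := Ordinal m4.
have bigS (V : nmodType) (g : 'I_4 -> V) :
    \sum_(j < 4 | (j < m.+1)%N) g j = \sum_(j < 4 | (j < m)%N) g j + g i.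
  rewrite (bigD1 i) //= addrC; congr (_ + _); apply: eq_bigl => j.
  by rewrite ltnS -val_eqE /= andbC -ltn_neqAle.
rewrite bigS; under eq_fun do rewrite bigS mulmxDr mxE.
apply: (gaussianD filtF brB) => //; first by apply: sumr_ge0 => *; exact: ge0.
- exact: ih (ltnW m4).
apply: indep_rv_sym.
apply: (@joint_events_indep_rv _ _ _ P _ (noise s) (noise_indep s0)
  (fun i => @noise_setI s i s0) (Qlt m)
  (fun i => @Qlt_meas s m i s0) (Some (inl i))) => /=.
- by rewrite ltnn.
- exact: wiener_future_measurable.
- move=> A mA.
  have mf : measurable_fun setT (fun x : 'cV[R]_(r i) => (u^T *m (N i *m x)) 0 0).
    by apply: measurable_linear_form; exact: measurable_mulmx.
  have := @future_incr s t i st _ (mf measurableT _ mA); rewrite setTI.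
  exact.
by apply: measurable_linear_form; exact: partial_measurable.
Qed.

Lemma wiener_brownian i (j : 'I_(r i)) : brownian P F (fun t w => W i t w j 0).
Proof.
have adW t A : 0 <= t -> measurable A -> F t (W i t @^-1` A).
  move=> t0 mA; apply: (wiener_adapted (wienerW i) t0).
  by exists A => //; rewrite setTI.
split.
- by move=> t t0; apply: measurable_entryT; exact: wiener_measurable.
- move=> t t0 A mA.
  have := adW t _ t0 (measurable_entry j 0 measurableT mA); rewrite setTI.
  exact.
- move=> c s t s0 st; split.
    apply: measurable_funM => //.
    by apply: measurable_funB; apply: measurable_entryT; apply: wiener_measurable => //; exact: le_trans st.
  move=> A mA; have := wiener_increment (wienerW i) s0 st (c *: delta_mx j 0) mA.
  have form (x : 'cV[R]_(r i)) : ((c *: delta_mx j 0)^T *m x) 0 0 = c * x j 0.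
    rewrite mxE (bigD1 j)//= big1 => [|l lj]; rewrite !mxE ?eqxx ?mulr1 ?addr0//.
    by rewrite (negbTE lj) mulr0 mul0r.
  rewrite /pushforward /= mulmx0 mxE mul_mx_scalar -scalemxAl [X in normal1 _ X]mxE form.
  rewrite !mxE !eqxx mulr1 mulrC -expr2 => <-.
  by congr (P _); apply/seteqP; split => w /=; rewrite form !mxE.
move=> s t s0 st A C FA mC.
have := wiener_independent (wienerW i) s0 st.
move=> /(_ (fun b => if b then A else (fun w => W i t w j 0 - W i s w j 0) @^-1` C)).
have -> : \bigcap_(b in [set: bool]) (if b then A else (fun w => W i t w j 0 - W i s w j 0) @^-1` C)
    = A `&` (fun w => W i t w j 0 - W i s w j 0) @^-1` C.
  apply/seteqP; split => [w h|w [h1 h2] [] //]; split; [exact: (h true)|exact: (h false)].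
rewrite big_bool /=; apply => -[] //.
exists ((fun x : 'cV[R]_(r i) => x j 0) @^-1` C).
  by rewrite -[X in measurable X]setTI; exact: measurable_entry.
by rewrite setTI; apply/seteqP; split => w /=; rewrite !mxE.
Qed.

End noise.

(** * Realised covariance of the Gaussian part *)

Lemma pow4D_le (R : realFieldType) (a b : R) : (a + b) ^+ 4 <= 8 * (a ^+ 4 + b ^+ 4).
Proof.
have h1 : (a + b) ^+ 2 <= 2 * (a ^+ 2 + b ^+ 2).
  by have := sqr_ge0 (a - b); rewrite sqrrB sqrrD; lra.
have h2 : (a ^+ 2 + b ^+ 2) ^+ 2 <= 2 * (a ^+ 4 + b ^+ 4).
  have := sqr_ge0 (a ^+ 2 - b ^+ 2); rewrite sqrrB sqrrD -!exprM; lra.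
have ab0 : 0 <= 2 * (a ^+ 2 + b ^+ 2) by rewrite mulr_ge0// addr_ge0// sqr_ge0.
have h3 : ((a + b) ^+ 2) ^+ 2 <= (2 * (a ^+ 2 + b ^+ 2)) ^+ 2.
  by rewrite lerXn2r// nnegrE sqr_ge0.
rewrite -[4%N]/(2 * 2)%N exprM (le_trans h3)// exprMn.
by move: h2; rewrite [(2 * 2)%N]/=; lra.
Qed.

(** The constant comes from splitting off one summand at a time; only its independence of [x]
    matters. *)
Lemma sum_pow4_le (R : realFieldType) m (x : 'I_m -> R) :
  (\sum_i x i) ^+ 4 <= 8 ^+ m * \sum_i x i ^+ 4.
Proof.
elim: m x => [|m ih] x; first by rewrite !big_ord0 expr0n mulr0.
rewrite !big_ord_recl (le_trans (pow4D_le _ _))// [8 ^+ m.+1]exprS -[leRHS]mulrA ler_wpM2l// mulrDr lerD//.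
have x0 : 0 <= x ord0 ^+ 4 by rewrite -[4%N]/(2 * 2)%N exprM sqr_ge0.
by rewrite ler_peMl// exprn_ege1// ler1n.
Qed.

Section quad_fourth_moment.
Context dsp (Omega : measurableType dsp) (R : realType) (P : probability Omega R).
Variables (F : R -> set (set Omega)) (B : R -> Omega -> R).
Hypothesis brB : brownian P F B.
Variables (p : nat) (S Q : 'M[R]_p).
Hypothesis psdS : forall u : 'cV[R]_p, 0 <= (u^T *m S *m u) 0 0.

Lemma gaussian_coord (Z : Omega -> 'cV[R]_p) i :
  (forall u : 'cV[R]_p, gaussian P (fun w => (u^T *m Z w) 0 0) ((u^T *m S *m u) 0 0)) ->
  gaussian P (fun w => Z w i 0) (S i i).
Proof.
move=> /(_ (delta_mx i 0)).
have e (k : nat) (x : 'M[R]_(p, k)) j : ((delta_mx i 0 : 'cV[R]_p)^T *m x) 0 j = x i j.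
  by rewrite trmx_delta -rowE mxE.
have -> : ((delta_mx i 0 : 'cV[R]_p)^T *m S *m (delta_mx i 0 : 'cV[R]_p)) 0 0 = S i i.
  by rewrite trmx_delta -rowE -colE !mxE.
by congr gaussian; apply/funext => w; rewrite e.
Qed.

Lemma psd_diag i : 0 <= S i i.
Proof.
have := psdS (delta_mx i 0).
by rewrite trmx_delta -rowE -colE !mxE.
Qed.

(** The bound does not depend on [Z], so it serves all cells and all n at once. It is obtained from
    eighth moments of the coordinates. *)
Lemma centred_quad_fourth : exists m4 : R, forall Z : Omega -> 'cV[R]_p,
  (forall u : 'cV[R]_p, gaussian P (fun w => (u^T *m Z w) 0 0) ((u^T *m S *m u) 0 0)) ->
  Rintegral P setT (fun w => centred_quad S Q (Z w) ^+ 4) <= m4.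
Proof.
pose N8 i := Num.sqrt (S i i) ^+ 8 * Rintegral P setT (fun w => (B 1 w - B 0 w) ^+ 8).
exists (8 ^+ p * \sum_i (8 ^+ p * \sum_j (8 * Q i j ^+ 4 * ((N8 i + N8 j) / 2 + S i j ^+ 4)))) => Z gZ.
have aZ i := gaussian_coord_allmom brB gZ psdS i.
have a8 i := allmomX 8 (aZ i).
have e8 i : Rintegral P setT (fun w => Z w i 0 ^+ 8) = N8 i.
  exact: (gaussian_moment brB 8 (psd_diag i) (gaussian_coord i gZ)).
pose bnd i j w := 8 * Q i j ^+ 4 * ((Z w i 0 ^+ 8 + Z w j 0 ^+ 8) / 2 + S i j ^+ 4).
have abnd i j : allmom P (bnd i j).
  apply: allmomZ; apply: allmomD; last exact: allmom_cst.
  have := allmomZ 2^-1 (allmomD (a8 i) (a8 j)).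
  by under eq_fun do rewrite mulrC.
have ebnd i j : Rintegral P setT (bnd i j) = 8 * Q i j ^+ 4 * ((N8 i + N8 j) / 2 + S i j ^+ 4).
  have a1 := allmomD (a8 i) (a8 j); have a2 := allmomZ 2^-1 a1.
  rewrite /bnd.
  have -> : (fun w => 8 * Q i j ^+ 4 * ((Z w i 0 ^+ 8 + Z w j 0 ^+ 8) / 2 + S i j ^+ 4)) =
    (fun w => 8 * Q i j ^+ 4 * (2^-1 * (Z w i 0 ^+ 8 + Z w j 0 ^+ 8) + S i j ^+ 4)).
    by apply/funext => w; rewrite [X in _ * (X + _)]mulrC.
  rewrite ExpZ; last by apply: allmom_integrable; apply: allmomD => //; exact: allmom_cst.
  rewrite ExpD; [|exact: allmom_integrable|exact: integrable_cstr].
  rewrite ExpZ; last exact: allmom_integrable.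
  rewrite ExpD; [|exact: allmom_integrable|exact: allmom_integrable].
  by rewrite Exp_cst !e8 [2^-1 * _]mulrC.
pose up w := 8 ^+ p * \sum_i (8 ^+ p * \sum_j bnd i j w).
have arow i : allmom P (fun w => 8 ^+ p * \sum_j bnd i j w).
  by apply: allmomZ; apply: allmom_sum => j _; exact: abnd.
have aup : allmom P up by apply: allmomZ; apply: allmom_sum => i _; exact: arow.
apply: (@le_trans _ _ (Rintegral P setT up)).
  apply: Exp_le.
  - by apply: allmom_integrable; apply: allmomX; exact: (centred_quad_allmom brB gZ psdS Q).
  - exact: allmom_integrable.
  move=> w; rewrite /up (le_trans (sum_pow4_le _))// ler_wpM2l ?exprn_ge0//.
  apply: ler_sum => i _; rewrite (le_trans (sum_pow4_le _))// ler_wpM2l ?exprn_ge0//.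
  apply: ler_sum => j _; rewrite /bnd exprMn.
  set x := Z w i 0; set y := Z w j 0; set s := S i j.
  have q0 : 0 <= Q i j ^+ 4 by rewrite -[4%N]/(2 * 2)%N exprM sqr_ge0.
  rewrite [8 * _]mulrC -[leRHS]mulrA ler_wpM2l//.
  have h (a b : R) : (a - b) ^+ 4 <= 8 * (a ^+ 4 + b ^+ 4).
    have -> : b ^+ 4 = (- b) ^+ 4 by rewrite -[4%N]/(2 * 2)%N !exprM sqrrN.
    exact: pow4D_le.
  rewrite (le_trans (h _ _))// ler_wpM2l// lerD2r exprMn ler_pdivlMr//.
  have := sqr_ge0 (x ^+ 4 - y ^+ 4); rewrite sqrrB -!exprM; lra.
rewrite /up ExpZ; last by apply: allmom_integrable; apply: allmom_sum => i _; exact: arow.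
rewrite Exp_sum; last by move=> i _; exact: arow.
rewrite ler_wpM2l ?exprn_ge0//; apply: ler_sum => i _.
rewrite ExpZ; last by apply: allmom_integrable; apply: allmom_sum => j _; exact: abnd.
rewrite Exp_sum; last by move=> j _; exact: abnd.
by rewrite ler_wpM2l ?exprn_ge0//; apply: ler_sum => j _; rewrite ebnd.
Qed.

End quad_fourth_moment.

Section realized_covariance.
Context dsp (Omega : measurableType dsp) (R : realType) (P : probability Omega R).
Variables (F : R -> set (set Omega)) (B : R -> Omega -> R).
Hypothesis filtF : is_filtration F.
Hypothesis brB : brownian P F B.
Variables (p : nat) (G : R -> Omega -> 'cV[R]_p) (S : 'M[R]_p) (T : R).
Hypothesis G_adapted : forall t u j, 0 <= t -> t <= u ->
  measurable_fun [set: g_sigma_algebraType (F u)]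
    (fun w : g_sigma_algebraType (F u) => G t w j 0).
Hypothesis G_gaussian : forall s t (u : 'cV[R]_p), 0 <= s -> s <= t ->
  gaussian P (fun w => (u^T *m (G t w - G s w)) 0 0) ((t - s) * (u^T *m S *m u) 0 0).
Hypothesis G_indep : forall s t (f : Omega -> R), 0 <= s -> s <= t ->
  (forall A, measurable A -> F s (f @^-1` A)) -> indep_rv P f (fun w => G t w - G s w).
Hypothesis symS : S^T = S.
Hypothesis psdS : forall u : 'cV[R]_p, 0 <= (u^T *m S *m u) 0 0.
Hypothesis T_gt0 : 0 < T.
Local Notation E := (Rintegral P setT).
Local Notation h n := (mesh T n).
Local Notation dG n i w := (path_incr T (G ^~ w) n i).

(** The scaling gives every increment the covariance [S], whatever n. *)
Let Z n i w : 'cV[R]_p := (Num.sqrt (h n))^-1 *: dG n i w.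

Let h_ge0 n : 0 <= h n. Proof. by rewrite divr_ge0// ltW. Qed.

Let grid_le n (i j : nat) : (i <= j)%N -> i%:R * h n <= j%:R * h n.
Proof. by move=> ij; rewrite ler_wpM2r// ler_nat. Qed.

Let grid_ge0 n (i : nat) : 0 <= i%:R * h n.
Proof. by rewrite mulr_ge0. Qed.

Lemma path_incr_gaussian n i (u : 'cV[R]_p) :
  gaussian P (fun w => (u^T *m dG n i w) 0 0) (h n * (u^T *m S *m u) 0 0).
Proof.
have := G_gaussian u (grid_ge0 n i) (grid_le n (leqnSn i)).
have -> // : i.+1%:R * h n - i%:R * h n = h n.
by rewrite -mulrBl -natr1 addrAC subrr add0r mul1r.
Qed.

Let Zg n i : (0 < n)%N -> forall u : 'cV[R]_p,
  gaussian P (fun w => (u^T *m Z n i w) 0 0) ((u^T *m S *m u) 0 0).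
Proof.
move=> n0 u; set c := (Num.sqrt (h n))^-1.
have hn := mesh_gt0 T_gt0 n0.
have := path_incr_gaussian n i (c *: u).
have -> : h n * ((c *: u)^T *m S *m (c *: u)) 0 0 = (u^T *m S *m u) 0 0.
  have -> : (c *: u)^T = c *: u^T by rewrite linearZ.
  rewrite -!scalemxAl -scalemxAr scalerA mxE mulrA -expr2 exprVn sqr_sqrtr//.
  by rewrite divff ?mul1r// gt_eqF.
congr gaussian; apply/funext => w; rewrite /Z.
have -> : (c *: u)^T = c *: u^T by rewrite linearZ.
by rewrite -scalemxAl -scalemxAr.
Qed.

Variable Q : 'M[R]_p.
Let v n i w := centred_quad S Q (Z n i w).
Let s2 := \sum_i \sum_j \sum_k \sum_l Q i j * Q k l * (S i k * S j l + S i l * S j k).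

Let measurable_centred_quad c : measurable_fun setT (fun x : 'cV[R]_p => centred_quad S Q (c *: x)).
Proof.
apply: measurable_sum => i; apply: measurable_sum => j; apply: measurable_funM => //.
apply: measurable_funB => //; under eq_fun do rewrite !mxE.
by apply: measurable_funM; apply: measurable_funM => //; exact: measurable_entry.
Qed.

Let v_adapted n i t : (i.+1%:R * h n <= t) ->
  measurable_fun [set: g_sigma_algebraType (F t)] (v n i : g_sigma_algebraType (F t) -> R).
Proof.
move=> it; apply: (measurableT_comp (measurable_centred_quad _)).
apply: measurable_fun_mx => j k; rewrite ord1; under eq_fun do rewrite !mxE.
apply: measurable_funB; apply: G_adapted => //.
by rewrite (le_trans _ it)// grid_le.
Qed.

Let v_indep n k : indep_rv P (fun w => \sum_(i < k) v n i w) (v n k).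
Proof.
move=> A C mA mC.
have mC' : measurable ((fun x : 'cV[R]_p => centred_quad S Q ((Num.sqrt (h n))^-1 *: x)) @^-1` C).
  by rewrite -[X in measurable X]setTI; exact: measurable_centred_quad.
have := @G_indep (k%:R * h n) (k.+1%:R * h n) (fun w => \sum_(i < k) v n i w)
  (grid_ge0 n k) (grid_le n (leqnSn k)).
move=> /(_ _ A _ mA mC'); apply.
apply/(adapted_funP filtF) => //.
by apply: measurable_sum => i; apply: v_adapted; exact: grid_le.
Qed.

Let v_allmom n i : (0 < n)%N -> allmom P (v n i).
Proof. by move=> n0; exact: (centred_quad_allmom brB (Zg i n0) psdS Q). Qed.

Let v_mean n i : (0 < n)%N -> E (v n i) = 0.
Proof. by move=> n0; exact: (centred_quad_mean brB (Zg i n0) symS psdS Q). Qed.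

Let v_var n i : (0 < n)%N -> E (fun w => v n i w ^+ 2) = s2.
Proof. by move=> n0; exact: (centred_quad_var filtF brB (Zg i n0) symS psdS Q). Qed.

Definition quad_error n w : R :=
  Num.sqrt n%:R * \sum_i \sum_j Q i j * (path_qvar T (G ^~ w) n i j - S i j).

Let quad_errorE n w : (0 < n)%N ->
  quad_error n w = (Num.sqrt n%:R)^-1 * \sum_(k < n) v n k w.
Proof.
move=> n0; have hn := mesh_gt0 T_gt0 n0.
have nn0 : 0 < n%:R :> R by rewrite ltr0n.
have sn0 : 0 < Num.sqrt n%:R :> R by rewrite sqrtr_gt0.
apply: (mulfI (lt0r_neq0 sn0)); rewrite [RHS]mulrA divff ?gt_eqF// mul1r.
rewrite /quad_error mulrA -expr2 sqr_sqrtr ?ltW// mulr_sumr /v /centred_quad.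
rewrite exchange_big /=; apply: eq_bigr => i _; rewrite mulr_sumr exchange_big /=.
apply: eq_bigr => j _; rewrite -mulr_sumr mulrCA; congr (_ * _).
have cn : \sum_(k < n) S i j = n%:R * S i j by rewrite sumr_const card_ord -[LHS]mulr_natl.
rewrite sumrB cn mulrBr; congr (_ - _).
rewrite mxE summxE mulrA mulr_sumr; apply: eq_bigr => k _.
have zE l : Z n k w l 0 = (Num.sqrt (h n))^-1 * dG n k w l 0 by rewrite mxE.
have -> : n%:R * T^-1 = (Num.sqrt (h n))^-1 * (Num.sqrt (h n))^-1.
  by rewrite -invfM -expr2 sqr_sqrtr ?ltW// invf_div.
by rewrite !zE mxE big_ord1 [_^T _ _]mxE mulrACA.
Qed.

Lemma quad_error_cos t :
  E (fun w => cos (t + quad_error n w)) @[n --> \oo] --> cos t * expR (- (s2 / 2)).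
Proof.
have [m4 hm4] := centred_quad_fourth brB Q psdS.
apply/cvgrPdist_le => e e0; near=> n.
have n0 : (0 < n)%N by near: n; exact: nbhs_infty_gt.
under eq_Rintegral do rewrite (quad_errorE _ n0).
rewrite distrC.
apply: le_trans (@cos_clt_bound _ _ _ P n (v n) s2 m4 n0 (fun k _ => v_allmom k n0)
  (fun k _ => v_mean k n0) (fun k _ => v_var k n0) (fun k _ => hm4 _ (Zg k n0))
  (fun k _ => v_indep n k) t) _.
rewrite ler_pdivrMr ?sqrtr_gt0 ?ltr0n// [e * _]mulrC -ler_pdivrMr//.
by near: n; exact: near_sqrt_ge.
Unshelve. all: by end_near. Qed.

Lemma quad_error_allmom n : (0 < n)%N -> allmom P (quad_error n).
Proof.
move=> n0; have -> : quad_error n = fun w => (Num.sqrt n%:R)^-1 * \sum_(k < n) v n k w.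
  by apply/funext => w; exact: quad_errorE.
by apply: allmomZ; apply: allmom_sum => k _; exact: v_allmom.
Qed.

(** Since this is exact for all n > 0, Chebyshev's inequality yields tightness; it also shows that
    the limiting variance is non-negative. *)
Lemma quad_error_second_moment n : (0 < n)%N -> E (fun w => quad_error n w ^+ 2) = s2.
Proof.
move=> n0.
have aS k : allmom P (fun w => \sum_(i < k) v n i w).
  by apply: allmom_sum => i _; exact: v_allmom.
have eS k : E (fun w => (\sum_(i < k) v n i w) ^+ 2) = k%:R * s2.
  elim: k => [|k ih].
    under eq_Rintegral do rewrite big_ord0 expr0n /=.
    by rewrite Exp_cst mul0r.
  under eq_Rintegral do rewrite big_ord_recr /= sqrrD -mulr_natl.
  have [_ eM] := integral_indepM (v_indep n k) (allmom_integrable (aS k))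
    (allmom_integrable (v_allmom k n0)).
  have a1 := allmomX 2 (aS k); have a2 := allmomM (aS k) (v_allmom k n0).
  have a3 := allmomX 2 (v_allmom k n0); have a4 := allmomZ 2 a2.
  rewrite ExpD; [|apply: allmom_integrable; exact: allmomD|exact: allmom_integrable].
  rewrite ExpD; [|exact: allmom_integrable|exact: allmom_integrable].
  rewrite ExpZ; last exact: allmom_integrable.
  by rewrite ih eM v_var// v_mean// !mulr0 addr0 -natr1 mulrDl mul1r.
under eq_Rintegral do rewrite (quad_errorE _ n0) exprMn.
have a1 := allmomX 2 (aS n).
rewrite ExpZ; last exact: allmom_integrable.
by rewrite eS exprVn sqr_sqrtr// mulrA mulVf ?mul1r// pnatr_eq0 -lt0n.
Qed.

End realized_covariance.

(** * From the realised covariance to the estimator *)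

Section probability_bounds.
Context dsp (Omega : measurableType dsp) (R : realType) (P : probability Omega R).
Implicit Types (A : set Omega).

Lemma measurable_exists_ord m (A : 'I_m -> set Omega) : (forall i, measurable (A i)) ->
  measurable [set w | exists i, A i w].
Proof.
move=> mA; rewrite (_ : [set _ | _] = \bigcup_(i in [set: 'I_m]) A i).
  by apply: fin_bigcup_measurable.
by apply/seteqP; split => w [i]; [exists i|move=> _ ?; exists i].
Qed.

Lemma probability_exists_le m (A : 'I_m -> set Omega) (c : R) :
  (forall i, measurable (A i)) -> (forall i, P (A i) <= c%:E)%E ->
  (P [set w | exists i, A i w] <= (m%:R * c)%:E)%E.
Proof.
move=> mA; elim: m A mA => [|m ih] A mA Ac.
  rewrite (_ : [set _ | _] = set0) ?measure0 ?mul0r//.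
  by apply/seteqP; split => [w [[]]|].
have -> : [set w | exists i, A i w] = A ord0 `|` [set w | exists i, A (lift ord0 i) w].
  apply/seteqP; split => w /=.
    by move=> [i]; case: (unliftP ord0 i) => [j ->|->]; [right; exists j|left].
  by move=> [h|[j h]]; [exists ord0|exists (lift ord0 j)].
have mU : measurable [set w | exists i, A (lift ord0 i) w] by exact: measurable_exists_ord.
apply: (le_trans (measureU2 _ (mA ord0) mU)).
rewrite -natr1 mulrDl mul1r addrC EFinD leeD//.
  by apply: ih => i.
exact: Ac.
Qed.

Lemma probability_le_sub A A' : measurable A -> measurable A' -> A `<=` A' ->
  (P A <= P A')%E.
Proof. by move=> mA mA' AA'; rewrite le_measure ?inE. Qed.

(** The tail unions decrease to the limsup set, which is null. This turns statements that hold from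
    a path-dependent index on into statements in probability. *)
Lemma ae_eventually_probability (B : nat -> set Omega) : (forall n, measurable (B n)) ->
  {ae P, forall w, \forall n \near \oo, ~ B n w} ->
  forall e : R, 0 < e -> \forall n \near \oo, (P (B n) <= e%:E)%E.
Proof.
move=> mB [N [mN N0 BN]] e e0.
have cv : P (\bigcup_(k >= n) B k) @[n --> \oo] --> P (lim_sup_set B).
  apply: lim_sup_set_cvg => //; rewrite (le_lt_trans (probability_le1 _ _)) ?ltry//.
  exact: bigcup_measurable.
have : P (lim_sup_set B) = 0%E.
  apply/eqP; rewrite eq_le measure_ge0 andbT -N0; apply: probability_le_sub => //.
    by apply: bigcap_measurable => // k _; exact: bigcup_measurable.
  move=> w Bw; apply: BN => -[n _ hn].
  by have [k /= nk Bk] := Bw n Logic.I; exact: (hn k nk).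
move=> l0; rewrite l0 in cv.
have /fine_cvgP[_ /cvgrPdist_le/(_ e e0) h] := cv.
near=> n; apply: (@le_trans _ _ (P (\bigcup_(k >= n) B k))).
  apply: probability_le_sub => //; first exact: bigcup_measurable.
  by move=> w Bw; exists n => /=.
rewrite -[X in (X <= _)%E]fineK; last by apply: fin_num_measure; exact: bigcup_measurable.
rewrite lee_fin; have : `|0 - fine (P (\bigcup_(k >= n) B k))| <= e by near: n.
by rewrite sub0r normrN; apply: le_trans; exact: ler_norm.
Unshelve. all: by end_near. Qed.

End probability_bounds.

Section small_increments.
Context dsp (Omega : measurableType dsp) (R : realType) (P : probability Omega R).
Variables (F : R -> set (set Omega)) (B : R -> Omega -> R).
Hypothesis brB : brownian P F B.
Variables (p : nat) (G : R -> Omega -> 'cV[R]_p) (S : 'M[R]_p) (T : R).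
Hypothesis G_gaussian : forall s t (u : 'cV[R]_p), 0 <= s -> s <= t ->
  gaussian P (fun w => (u^T *m (G t w - G s w)) 0 0) ((t - s) * (u^T *m S *m u) 0 0).
Hypothesis psdS : forall u : 'cV[R]_p, 0 <= (u^T *m S *m u) 0 0.
Hypothesis T_gt0 : 0 < T.
Local Notation h n := (mesh T n).
Local Notation dG n i w := (path_incr T (G ^~ w) n i).

Definition small_incr (n : nat) (x : R) : set Omega :=
  [set w | forall i k, (i < n)%N -> `|dG n i w k 0| <= x].

Let dG_gaussian n i k : gaussian P (fun w => dG n i w k 0) (h n * S k k).
Proof.
have e : h n * S k k = (h n *: S) k k by rewrite mxE.
rewrite e; apply: (@gaussian_coord _ _ _ P _ (h n *: S)) => u.
have -> : (u^T *m (h n *: S) *m u) 0 0 = h n * (u^T *m S *m u) 0 0.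
  by rewrite -scalemxAr -scalemxAl mxE.
exact: path_incr_gaussian.
Qed.

Lemma small_incr_measurable n x : measurable (small_incr n x).
Proof.
rewrite (_ : small_incr n x = [set w | forall i : 'I_n, [set w | forall k, `|dG n i w k 0| <= x] w]).
  apply: measurable_forall_ord => i; apply: measurable_box.
  by apply: measurable_fun_mx => k l; rewrite ord1; case: (dG_gaussian n i k).
apply/seteqP; split => w /= hw i; first by move=> k; exact: hw.
by move=> k ni; exact: (hw (Ordinal ni)).
Qed.

(** Markov's inequality with the moment of order 2 m bounds each of the n p probabilities by a
    multiple of h^(m (1 - 2 rho)). The choice of m makes this at most h^2 when h <= 1, and the union
    bound is of order 1 / n. *)
Lemma small_incr_probability (tau rho e : R) : 0 < tau -> rho < 2^-1 -> 0 < e ->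
  \forall n \near \oo, (P (~` small_incr n (tau * h n `^ rho)) <= e%:E)%E.
Proof.
move=> tau0 rho2 e0.
have r0 : 0 < 1 - 2 * rho by lra.
have [m hm] : exists m : nat, 2 / (1 - 2 * rho) <= m%:R.
  have : \forall m \near \oo, 2 / (1 - 2 * rho) <= m%:R by exact: nbhs_infty_ger.
  by move=> [m _ /(_ m (leqnn m))]; exists m.
have hm2 : 2 + 2 * m%:R * rho <= m%:R.
  by move: hm; rewrite ler_pdivrMr// mulrBr mulr1; lra.
pose c := Rintegral P setT (fun w => (B 1 w - B 0 w) ^+ m.*2).
pose sS := \sum_k S k k.
have Skk k : 0 <= S k k by exact: psd_diag.
have Sk k : S k k <= sS.
  by rewrite /sS (bigD1 k)//= lerDl; apply: sumr_ge0 => *; exact: Skk.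
have c0 : 0 <= c.
  by apply: Rintegral_ge0 => w _; rewrite -muln2 exprM sqr_ge0.
have sS0 : 0 <= sS by apply: sumr_ge0 => *; exact: Skk.
pose C := (tau ^+ m.*2)^-1 * (sS ^+ m * c).
have C0 : 0 <= C by rewrite mulr_ge0 ?invr_ge0 ?exprn_ge0 ?(ltW tau0)// mulr_ge0// exprn_ge0.
near=> n; have n0 : (0 < n)%N by near: n; exact: nbhs_infty_gt.
have hn := mesh_gt0 T_gt0 n0; have nh := mulr_mesh T n0.
have hle1 : h n <= 1 by near: n; exact: near_mesh_le1.
have hr0 : 0 < h n `^ rho by rewrite powR_gt0.
have x0 : 0 < tau * h n `^ rho by rewrite mulr_gt0.
have hpow : h n ^+ m <= h n ^+ 2 * (h n `^ rho) ^+ m.*2.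
  have -> : h n ^+ m = h n `^ m%:R by rewrite powR_mulrn ?(ltW hn).
  have -> : h n ^+ 2 * (h n `^ rho) ^+ m.*2 = h n `^ (2 + rho * m.*2%:R).
    by rewrite powRD ?(gt_eqF hn) ?implybT// powRrM !powR_mulrn ?(ltW hn) ?(ltW hr0).
  apply: ger_powR; first by rewrite hn.
  by rewrite -muln2 natrM; lra.
have one i k : (P [set w | tau * h n `^ rho <= `|dG n i w k 0|]%R <= (C * h n ^+ 2)%:E)%E.
  have v0 : 0 <= h n * S k k by rewrite mulr_ge0 ?(ltW hn).
  apply: le_trans (markov_pow m (gaussian_allmom brB v0 (dG_gaussian n i k)) x0) _.
  rewrite lee_fin (gaussian_moment brB m.*2 v0 (dG_gaussian n i k)) -/c.
  have -> : Num.sqrt (h n * S k k) ^+ m.*2 = h n ^+ m * S k k ^+ m.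
    by rewrite -mul2n exprM sqr_sqrtr// exprMn.
  rewrite exprMn invfM /C -[leLHS]mulrA -[leRHS]mulrA.
  rewrite ler_wpM2l ?invr_ge0 ?exprn_ge0 ?(ltW tau0)//.
  rewrite mulrC ler_pdivrMr ?exprn_gt0//.
  apply: (@le_trans _ _ (h n ^+ m * (sS ^+ m * c))).
    rewrite -[leLHS]mulrA ler_wpM2l ?exprn_ge0 ?(ltW hn)//.
    by rewrite ler_wpM2r// lerXn2r// nnegrE.
  apply: le_trans (ler_wpM2r _ hpow) _; first by rewrite mulr_ge0// exprn_ge0.
  by rewrite le_eqVlt; apply/orP; left; apply/eqP; ring.
have mone i k : measurable [set w | tau * h n `^ rho <= `|dG n i w k 0|].
  apply: measurable_leset => //; apply: measurableT_comp => //.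
  by case: (dG_gaussian n i k).
apply: (@le_trans _ _ (P [set w | exists i : 'I_n, [set w | exists k : 'I_p,
    [set w | tau * h n `^ rho <= `|dG n i w k 0|] w] w])).
  apply: probability_le_sub.
  - by apply: measurableC; exact: small_incr_measurable.
  - by apply: measurable_exists_ord => i; exact: measurable_exists_ord.
  move=> w /= nw; apply: contrapT => H; apply: nw => i k ni.
  rewrite leNgt; apply/negP => lt; apply: H; exists (Ordinal ni); exists k => /=.
  exact: ltW.
apply: (@le_trans _ _ (n%:R * (p%:R * (C * h n ^+ 2)))%:E).
  apply: probability_exists_le; last by move=> i; exact: probability_exists_le.
  by move=> i; exact: measurable_exists_ord.
rewrite lee_fin.
have -> : n%:R * (p%:R * (C * h n ^+ 2)) = p%:R * C * T ^+ 2 / n%:R.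
  have -> : T ^+ 2 = n%:R ^+ 2 * h n ^+ 2 by rewrite -exprMn nh.
  by field; rewrite pnatr_eq0 -lt0n.
rewrite ler_pdivrMr ?ltr0n// [e * _]mulrC -ler_pdivrMr//.
by near: n; exact: near_natr_ge.
Unshelve. all: by end_near. Qed.

End small_increments.

Lemma norm_sin_le (R : realType) (x : R) : `|sin x| <= `|x|.
Proof.
have h y : 0 <= y -> `|sin y| <= y.
  move=> y0; rewrite -[leRHS]ger0_norm// -ler_sqr ?nnegrE// !real_normK ?num_real//.
  have := cos_ge_taylor2 y0; have := cos_le1 y; have := cos_geN1 y.
  by rewrite sin2cos2; set c := cos y; nra.
have [x0|x0] := leP 0 x; first by rewrite (ger0_norm x0) h.
by rewrite -normrN -sinN (ltr0_norm x0) h// oppr_ge0 ltW.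
Qed.

Lemma cos_lipschitz (R : realType) (x y : R) : `|cos x - cos y| <= `|x - y|.
Proof.
pose a := (x + y) / 2; pose b := (x - y) / 2.
have -> : x = a + b by rewrite /a /b; field.
have -> : y = a - b by rewrite /a /b; field.
have -> : a + b - (a - b) = 2 * b by ring.
have -> : cos (a + b) - cos (a - b) = - 2 * (sin a * sin b) by rewrite cosD cosB; ring.
clearbody a b; rewrite !normrM normrN ler_wpM2l// (le_trans (ler_wpM2r _ (_ : _ <= 1)))//.
  by rewrite ler_norml sin_geN1 sin_le1.
by rewrite mul1r norm_sin_le.
Qed.

Lemma enorm_le_mx (R : realType) q (A : 'M[R]_q) (M : R) : 0 <= M ->
  (forall i j, `|A i j| <= M / q.+1%:R) -> enorm A <= M.
Proof.
move=> M0 AM; rewrite -[leRHS]ger0_norm// -sqrtr_sqr ler_wsqrtr//.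
have M1 : 0 <= M / q.+1%:R by rewrite divr_ge0.
apply: (@le_trans _ _ (\sum_(i < q) \sum_(j < q) (M / q.+1%:R) ^+ 2)).
  apply: ler_sum => i _; apply: ler_sum => j _; rewrite -real_normK ?num_real//.
  by rewrite lerXn2r// nnegrE.
have -> : \sum_(i < q) \sum_(j < q) (M / q.+1%:R) ^+ 2 = (q%:R * (M / q.+1%:R)) ^+ 2.
  under eq_bigr do rewrite sumr_const card_ord.
  by rewrite sumr_const card_ord -mulrnA -[LHS]mulr_natl natrM -expr2 -exprMn.
rewrite lerXn2r ?nnegrE ?mulr_ge0// mulrCA ler_piMr// ler_pdivrMr ?ltr0n// mul1r ler_nat.
exact: leqnSn.
Qed.

Section estimator_limits.
Context dsp (Omega : measurableType dsp) (R : realType) (P : probability Omega R).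
Variables (F : R -> set (set Omega)) (B : R -> Omega -> R).
Hypothesis filtF : is_filtration F.
Hypothesis brB : brownian P F B.
Variables (p : nat) (G : R -> Omega -> 'cV[R]_p) (S : 'M[R]_p) (T : R).
Hypothesis G_adapted : forall t u j, 0 <= t -> t <= u ->
  measurable_fun [set: g_sigma_algebraType (F u)]
    (fun w : g_sigma_algebraType (F u) => G t w j 0).
Hypothesis G_gaussian : forall s t (u : 'cV[R]_p), 0 <= s -> s <= t ->
  gaussian P (fun w => (u^T *m (G t w - G s w)) 0 0) ((t - s) * (u^T *m S *m u) 0 0).
Hypothesis G_indep : forall s t (f : Omega -> R), 0 <= s -> s <= t ->
  (forall A, measurable A -> F s (f @^-1` A)) -> indep_rv P f (fun w => G t w - G s w).
Hypothesis symS : S^T = S.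
Hypothesis psdS : forall u : 'cV[R]_p, 0 <= (u^T *m S *m u) 0 0.
Hypothesis T_gt0 : 0 < T.
Local Notation E := (Rintegral P setT).
Local Notation h n := (mesh T n).
Variables (X : R -> Omega -> 'cV[R]_p) (D rho : R).
Hypothesis D_gt0 : 0 < D.
Hypothesis rho_lt : rho < 2^-1.
Hypothesis mX : forall t, 0 <= t -> measurable_fun setT (X t).
Local Notation Sh n w := (Sigma_hat X T D rho n w).
Local Notation Qn n w := (path_qvar T (G ^~ w) n).
Local Notation tau := (D / (2 * p.+1%:R)).
Hypothesis path_close : {ae P, forall w, forall e : R, 0 < e -> \forall n \near \oo,
  (forall i k, (i < n)%N -> `|path_incr T (G ^~ w) n i k 0| <= tau * h n `^ rho) ->
  forall k l, `|Num.sqrt n%:R * (Sh n w k l - Qn n w k l)| <= e * (1 + \tr (Qn n w))}.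

Let h_ge0 n : 0 <= h n. Proof. by rewrite divr_ge0// ltW. Qed.

Let incr_measurable n i : measurable_fun setT (fun w => increment X T n w i).
Proof.
apply: measurable_fun_mx => j k; under eq_fun do rewrite !mxE.
by apply: measurable_funB; apply: measurable_entryT; apply: mX; rewrite mulr_ge0.
Qed.

Lemma enorm_measurable d' (O : measurableType d') m n (f : O -> 'M[R]_(m, n)) :
  measurable_fun setT f -> measurable_fun setT (fun w => enorm (f w)).
Proof.
move=> mf; apply: (@measurableT_comp _ _ _ _ _ _ (@Num.sqrt R)).
  apply: continuous_measurable_fun; exact: sqrt_continuous.
apply: measurable_sum => i; apply: measurable_sum => j; apply: measurable_funX.
exact: measurable_entryT.
Qed.

Let below_measurable n i : measurable_fun setT (fun w => below_threshold X T D rho n w i).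
Proof. by apply: measurable_fun_ler => //; exact: enorm_measurable. Qed.

Lemma Sigma_hat_measurable n : measurable_fun setT (fun w => Sh n w).
Proof.
apply: measurable_fun_mx => j k.
pose N w : R := \sum_(1 <= i < n.+1) if below_threshold X T D rho n w i then 1 else 0.
have mN : measurable_fun setT N.
  by apply: measurable_sum => i; apply: measurable_fun_ifT.
pose M w : R := \sum_(1 <= i < n.+1) if below_threshold X T D rho n w i
  then increment X T n w i j 0 * increment X T n w i k 0 else 0.
have mM : measurable_fun setT M.
  apply: measurable_sum => i; apply: measurable_fun_ifT => //.
  by apply: measurable_funM; exact: measurable_entryT.
have NE w : N w = (kept_count X T D rho n w)%:R.
  rewrite /kept_count natr_sum; apply: eq_bigr => i _; by case: below_threshold.
have Nn w : (kept_count X T D rho n w <= n)%N by exact: kept_count_le.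
(* The random normalisation takes finitely many values, so the estimator is a finite sum over the
   possible counts m; equality of counts is expressed by two inequalities of measurable
   functions. *)
have -> : (fun w => Sh n w j k) = fun w => \sum_(m < n.+1)
    if (N w <= m%:R) && (m%:R <= N w)
    then ((if (m : nat) == 0%N then n else m)%:R * h n)^-1 * M w else 0.
  apply/funext => w; have kn : (kept_count X T D rho n w < n.+1)%N by rewrite ltnS.
  rewrite (bigD1 (Ordinal kn))//= NE lexx /= big1 ?addr0 => [|i ik].
    rewrite mxE summxE /M big_mkcond /=; congr (_ * _); apply: eq_bigr => i _.
    by case: ifPn => // _; rewrite mxE big_ord1 [_^T _ _]mxE.
  rewrite !ler_nat -eqn_leq; case: eqP => // e; case/eqP: ik.
  by apply/val_inj.
apply: measurable_sum => m; apply: measurable_fun_ifT => //; last exact: measurable_funM.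
by apply: measurable_and; exact: measurable_fun_ler.
Qed.

Let G_measurable t : 0 <= t -> measurable_fun setT (G t).
Proof.
move=> t0; apply: measurable_fun_mx => j k; rewrite ord1 => _ A mA; rewrite setTI.
apply: (filtF.1 t t0).2; move: A mA; apply/(adapted_funP filtF) => //.
exact: G_adapted.
Qed.

Let Qn_measurable n : measurable_fun setT (fun w => Qn n w).
Proof.
have mi i k : measurable_fun setT (fun w => path_incr T (G ^~ w) n i k 0).
  under eq_fun do rewrite !mxE.
  by apply: measurable_funB; apply: measurable_entryT; apply: G_measurable; rewrite mulr_ge0.
apply: measurable_fun_mx => j k; under eq_fun do rewrite mxE summxE.
apply: measurable_funM => //; apply: measurable_sum => i; under eq_fun do rewrite mxE.
apply: measurable_sum => l; rewrite (ord1 l); apply: measurable_funM; first exact: mi.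
by under eq_fun do rewrite mxE; exact: mi.
Qed.

Let tr_measurable n : measurable_fun setT (fun w => \tr (Qn n w)).
Proof. by apply: measurable_sum => i; apply: measurable_entryT; exact: Qn_measurable. Qed.

Let err n w : 'M[R]_p := Num.sqrt n%:R *: (Qn n w - S).
Let dif n w : 'M[R]_p := Num.sqrt n%:R *: (Sh n w - Qn n w).

Let err_measurable n : measurable_fun setT (err n).
Proof.
apply: measurable_fun_mx => i j.
rewrite (_ : (fun w => _) = fun w => Num.sqrt n%:R * (Qn n w i j - S i j)); last first.
  by apply/funext => w; rewrite !mxE.
apply: measurable_funM => //; apply: measurable_funB => //.
by apply: measurable_entryT; exact: Qn_measurable.
Qed.

Let dif_measurable n : measurable_fun setT (dif n).
Proof.
apply: measurable_fun_mx => i j.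
rewrite (_ : (fun w => _) = fun w => Num.sqrt n%:R * (Sh n w i j - Qn n w i j)); last first.
  by apply/funext => w; rewrite !mxE.
apply: measurable_funM => //; apply: measurable_funB; apply: measurable_entryT.
  exact: Sigma_hat_measurable.
exact: Qn_measurable.
Qed.

Let big_mx (Y : Omega -> 'M[R]_p) (K : R) : set Omega :=
  [set w | exists i : 'I_p, [set w | exists j : 'I_p, [set w | K < `|Y w i j|] w] w].

Let big_mx_measurable Y K : measurable_fun setT Y -> measurable (big_mx Y K).
Proof.
move=> mY; apply: measurable_exists_ord => i; apply: measurable_exists_ord => j.
apply: measurable_ltset => //; apply: measurableT_comp => //; exact: measurable_entryT.
Qed.

Let big_mxP Y K w : ~ big_mx Y K w -> forall i j, `|Y w i j| <= K.
Proof.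
move=> nb i j; rewrite leNgt; apply/negP => lt; apply: nb; exists i; exists j.
exact: lt.
Qed.

(** Each entry of the error is [quad_error] for a matrix unit, with second moment [V i j] for all n
    > 0. *)
Let err_tight (e : R) : 0 < e -> exists K : R, 0 < K /\
  \forall n \near \oo, (P (big_mx (err n) K) <= e%:E)%E.
Proof.
move=> e0.
pose V i j : R := \sum_i' \sum_j' \sum_k \sum_l
  (delta_mx i j : 'M[R]_p) i' j' * (delta_mx i j : 'M[R]_p) k l * (S i' k * S j' l + S i' l * S j' k).
pose c : R := 1 + \sum_i \sum_j `|V i j|.
have c1 : 1 <= c by rewrite lerDl; apply: sumr_ge0 => *; apply: sumr_ge0 => *.
have c0 : 0 < c by rewrite (lt_le_trans ltr01).
have Vc i j : V i j <= c.
  apply: (le_trans (ler_norm _)); apply: (@le_trans _ _ (\sum_i \sum_j `|V i j|)).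
    rewrite (bigD1 i)//= (bigD1 j)//= -addrA lerDl.
    rewrite addr_ge0//; first by apply: sumr_ge0 => *.
    by apply: sumr_ge0 => *; apply: sumr_ge0 => *.
  by rewrite lerDr.
(* Chebyshev's inequality and a union bound over the p^2 entries give probability p^2 c / K2, below
   [e]; adding 1 keeps [K2] positive. *)
pose K2 : R := p%:R * (p%:R * c) / e + 1.
have K20 : 0 < K2 by rewrite ltr_wpDl// divr_ge0 ?mulr_ge0 ?(ltW c0) ?(ltW e0).
exists (Num.sqrt K2); rewrite sqrtr_gt0; split => //.
near=> n; have n0 : (0 < n)%N by near: n; exact: nbhs_infty_gt.
have one i j : (P [set w | Num.sqrt K2 < `|err n w i j|]%R <= (K2^-1 * c)%:E)%E.
  have eE : (fun w => err n w i j) = quad_error G S T (delta_mx i j) n.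
    apply/funext => w; rewrite /quad_error.
    rewrite (bigD1 i) //= [X in _ + X]big1 ?addr0 => [|k ki]; last first.
      by apply: big1 => l _; rewrite mxE (negbTE ki) mul0r.
    rewrite (bigD1 j)//= big1 ?addr0 => [|l lj]; last by rewrite mxE (negbTE lj) andbF mul0r.
    by rewrite [delta_mx i j i j]mxE !eqxx mul1r !mxE.
  have a := quad_error_allmom brB G_gaussian psdS T_gt0 (delta_mx i j) n0.
  have v2 := quad_error_second_moment filtF brB G_adapted G_gaussian G_indep symS psdS T_gt0 (delta_mx i j) n0.
  have sK : 0 < Num.sqrt K2 by rewrite sqrtr_gt0.
  have := markov_pow 1 a sK; rewrite v2 sqr_sqrtr ?(ltW K20)// => mk.
  apply: (@le_trans _ _ (P [set w | Num.sqrt K2 <= `|quad_error G S T (delta_mx i j) n w|]%R)).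
    apply: probability_le_sub.
    - by apply: measurable_ltset => //; apply: measurableT_comp => //; exact: measurable_entryT.
    - by apply: measurable_leset => //; apply: measurableT_comp => //; exact: allmom_measurable a.
    by move=> w /=; rewrite -eE => /ltW.
  apply: le_trans mk _; rewrite lee_fin ler_wpM2l ?invr_ge0 ?(ltW K20)//.
  exact: Vc.
apply: (@le_trans _ _ (p%:R * (p%:R * (K2^-1 * c)))%:E).
  have m1 i j : measurable [set w | Num.sqrt K2 < `|err n w i j|].
    by apply: measurable_ltset => //; apply: measurableT_comp => //; exact: measurable_entryT.
  apply: probability_exists_le => i; first exact: measurable_exists_ord.
  exact: probability_exists_le.
rewrite lee_fin [K2^-1 * _]mulrC 2!mulrA ler_pdivrMr// -mulrA [e * _]mulrC.
by rewrite -ler_pdivrMr// lerDl.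
Unshelve. all: by end_near. Qed.

(** Three events are excluded: a large error of the realised covariance, a Gaussian increment that
    is not small, and [bad], where the pathwise bound fails although the increments are small. Off
    them the trace is at most tr S + p K, because sqrt n >= 1, and [eps] is chosen to turn the
    pathwise bound into [eta]. *)
Let dif_small (eta e : R) : 0 < eta -> 0 < e ->
  \forall n \near \oo, (P (big_mx (dif n) eta) <= e%:E)%E.
Proof.
move=> eta0 e0; have e3 : 0 < e / 3 by rewrite divr_gt0.
have [K [K0 tight]] := err_tight e3.
have trS0 : 0 <= \tr S by apply: sumr_ge0 => i _; exact: psd_diag.
have c0 : 0 < 1 + (\tr S + p%:R * K).
  by rewrite ltr_pwDl// addr_ge0// mulr_ge0// ltW.
pose eps := eta / (1 + (\tr S + p%:R * K)).
have eps0 : 0 < eps by rewrite divr_gt0.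
pose bad n : set Omega := small_incr G T n (tau * h n `^ rho) `&`
  [set w | exists k : 'I_p, [set w | exists l : 'I_p,
     [set w | eps * (1 + \tr (Qn n w)) < `|dif n w k l|] w] w].
have mbad n : measurable (bad n).
  apply: measurableI; first exact: (small_incr_measurable G_gaussian T_gt0).
  apply: measurable_exists_ord => k; apply: measurable_exists_ord => l.
  apply: measurable_ltset; first by apply: measurable_funM => //; exact: measurable_funD.
  by apply: measurableT_comp => //; exact: measurable_entryT.
have bad_ae : {ae P, forall w, \forall n \near \oo, ~ bad n w}.
  apply: filterS path_close => w /(_ eps eps0); apply: filterS => n H [small [k [l /=]]].
  by rewrite ltNge => /negP; apply; rewrite !mxE; have := H small k l; rewrite ?mxE.
have badP := ae_eventually_probability mbad bad_ae e3.
have tau0 : 0 < tau by rewrite divr_gt0// mulr_gt0.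
have smallP := small_incr_probability brB G_gaussian psdS T_gt0 tau0 rho_lt e3.
near=> n; have n0 : (0 < n)%N by near: n; exact: nbhs_infty_gt.
have h1 : (P (big_mx (err n) K) <= (e / 3)%:E)%E by near: n.
have h2 : (P (bad n) <= (e / 3)%:E)%E by near: n.
have h3 : (P (~` small_incr G T n (tau * h n `^ rho)) <= (e / 3)%:E)%E by near: n.
have msm : measurable (~` small_incr G T n (tau * h n `^ rho)).
  by apply: measurableC; exact: (small_incr_measurable G_gaussian T_gt0).
have mer := @big_mx_measurable (err n) K (err_measurable n).
apply: (@le_trans _ _ (P (big_mx (err n) K `|` (bad n `|` ~` small_incr G T n (tau * h n `^ rho))))).
  apply: probability_le_sub; first exact: big_mx_measurable.
    by apply: measurableU => //; exact: measurableU.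
  move=> w [k [l /= big]]; apply: contrapT => /not_orP[/big_mxP ne /not_orP[nbad /contrapT sm]].
  apply: nbad; split => //; exists k; exists l => /=; apply: le_lt_trans big.
  rewrite /eps mulrAC ler_pdivrMr// ler_wpM2l ?(ltW eta0)// lerD2l.
  have s1 : 1 <= Num.sqrt n%:R :> R by rewrite -[leLHS](@sqrtr1 R) ler_wsqrtr// ler1n.
  have s0 : 0 < Num.sqrt n%:R :> R by rewrite (lt_le_trans ltr01).
  rewrite /mxtrace -lerBlDl -sumrB.
  apply: (@le_trans _ _ (\sum_(i < p) K)); last by rewrite sumr_const card_ord -[leLHS]mulr_natl.
  apply: ler_sum => i _; have := ne i i; rewrite !mxE normrM (gtr0_norm s0) => hi.
  rewrite (le_trans (ler_norm _))// (le_trans _ hi)// ler_peMl//.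
apply: (le_trans (measureU2 _ mer (measurableU _ _ (mbad n) msm))).
have -> : e = e / 3 + (e / 3 + e / 3) by field.
rewrite EFinD leeD// (le_trans (measureU2 _ (mbad n) msm))// EFinD leeD//.
Unshelve. all: by end_near. Qed.

Let tot n w : 'M[R]_p := Num.sqrt n%:R *: (Sh n w - S).

Let totE n w : tot n w = err n w + dif n w.
Proof. by rewrite /tot /err /dif -scalerDr [X in _ = _ *: X]addrC addrA subrK. Qed.

Let tot_measurable n : measurable_fun setT (tot n).
Proof.
apply: measurable_fun_mx => i j.
rewrite (_ : (fun w => _) = fun w => err n w i j + dif n w i j).
  by apply: measurable_funD; apply: measurable_entryT.
by apply/funext => w; rewrite totE mxE.
Qed.

Let tot_tight (e : R) : 0 < e -> exists K : R, 0 < K /\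
  \forall n \near \oo, (P (big_mx (tot n) K) <= e%:E)%E.
Proof.
move=> e0; have e2 : 0 < e / 2 by rewrite divr_gt0.
have [K [K0 tight]] := err_tight e2; have small := dif_small (@ltr01 R) e2.
exists (K + 1); split; first by rewrite addr_gt0.
near=> n.
have h1 : (P (big_mx (err n) K) <= (e / 2)%:E)%E by near: n.
have h2 : (P (big_mx (dif n) 1) <= (e / 2)%:E)%E by near: n.
have m1 := @big_mx_measurable (err n) K (err_measurable n).
have m2 := @big_mx_measurable (dif n) 1 (dif_measurable n).
apply: (@le_trans _ _ (P (big_mx (err n) K `|` big_mx (dif n) 1))).
  apply: probability_le_sub; [exact: big_mx_measurable|exact: measurableU|].
  move=> w [k [l /= big]]; apply: contrapT => /not_orP[/big_mxP a /big_mxP b].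
  move: big; rewrite ltNge => /negP; apply; rewrite totE mxE.
  by rewrite (le_trans (ler_normD _ _))// lerD.
apply: (le_trans (measureU2 _ m1 m2)).
by rewrite [e in (_ <= e%:E)%E](splitr e) EFinD leeD.
Unshelve. all: by end_near. Qed.

(** The error multiplied by sqrt n is tight, so the error itself tends to 0 in probability. *)
Lemma Sigma_hat_consistent : cvg_in_probability P (Sigma_hat X T D rho) S.
Proof.
move=> eps eps0.
have mE n : measurable [set w | eps < enorm (Sh n w - S)].
  apply: measurable_ltset => //; apply: enorm_measurable; apply: measurable_fun_mx => i j.
  rewrite (_ : (fun w => _) = fun w => Sh n w i j - S i j); last by apply/funext => w; rewrite !mxE.
  by apply: measurable_funB => //; apply: measurable_entryT; exact: Sigma_hat_measurable.
apply/fine_cvgP; split; first by near=> n; exact: fin_num_measure.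
apply/cvgrPdist_le => e e0; have [K [K0 tight]] := tot_tight e0.
near=> n; have n0 : (0 < n)%N by near: n; exact: nbhs_infty_gt.
have h1 : (P (big_mx (tot n) K) <= e%:E)%E by near: n.
have sn : K * p.+1%:R / eps <= Num.sqrt n%:R by near: n; exact: near_sqrt_ge.
have sn0 : 0 < Num.sqrt n%:R :> R by rewrite sqrtr_gt0 ltr0n.
rewrite sub0r normrN ger0_norm ?fine_ge0// -lee_fin fineK ?fin_num_measure//.
apply: le_trans h1; apply: probability_le_sub => //; first exact: big_mx_measurable.
move=> w /= big; apply: contrapT => /big_mxP h; move: big; rewrite ltNge => /negP; apply.
apply: enorm_le_mx => [|i j]; first exact: ltW.
rewrite ler_pdivlMr ?ltr0n// -(ler_pM2l sn0) mulrA.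
move: sn; rewrite ler_pdivrMr// => sn; apply: le_trans sn; rewrite ler_wpM2r//.
by have := h i j; rewrite mxE normrM (gtr0_norm sn0).
Unshelve. all: by end_near. Qed.

(** A factor [N] of [S] makes the tensor square of [N] a factor of that of [S], from which the limit
    law is constructed. A linear form of the vech error is [quad_error] for [unvech_form u] up to a
    negligible term, and cosines are Lipschitz. *)
Lemma vech_Sigma_hat_normal (m : nat) (N : 'M[R]_(p, m)) : S = N *m N^T ->
  cvg_in_law_normal P (fun n w => Num.sqrt n%:R *: (vech (Sh n w) - vech S)) 0
    (2 *: (duplication_pinv p *m tensmx S S *m (duplication_pinv p)^T)).
Proof.
move=> SN; set V := 2 *: _.
have [nu nuV] := @gaussian_vector_exists _ _ _ P F B filtF brB _ _
  (Num.sqrt 2 *: (duplication_pinv p *m tensmx N N)).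
have {}nuV : is_normal_law nu 0 V.
  suff <- : Num.sqrt 2 *: (duplication_pinv p *m tensmx N N) *m
     (Num.sqrt 2 *: (duplication_pinv p *m tensmx N N))^T = V by [].
  have -> : (Num.sqrt 2 *: (duplication_pinv p *m tensmx N N))^T =
      Num.sqrt 2 *: (duplication_pinv p *m tensmx N N)^T by rewrite linearZ.
  rewrite -scalemxAl -scalemxAr scalerA -expr2 sqr_sqrtr//.
  rewrite trmx_mul mulmxA -[_ *m tensmx N N *m _]mulmxA trmx_tens tensmx_mul.
  by rewrite -SN.
(* By [unvech_form_var] this is the second moment of [quad_error] at n = 1. *)
have V0 (u : 'cV[R]__) : 0 <= (u^T *m V *m u) 0 0.
  have := quad_error_second_moment filtF brB G_adapted G_gaussian G_indep symS psdS T_gt0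
    (unvech_form u) (ltn0Sn 0).
  rewrite /V unvech_form_var => <-; apply: Rintegral_ge0 => w _; exact: sqr_ge0.
have nu_gauss (u : 'cV[R]_(p * p.+1)./2) : gaussian nu (fun x => (u^T *m x) 0 0) ((u^T *m V *m u) 0 0).
  split; first exact: measurable_linear_form.
  by move=> A mA; have := nuV u A mA; rewrite mulmx0 [X in normal1 X]mxE.
exists nu => //.
have mY n : measurable_fun setT (fun w => Num.sqrt n%:R *: (vech (Sh n w) - vech S)).
  apply: measurable_fun_mx => i j.
  rewrite (_ : (fun w => _) = fun w => tot n w (vech_index i).2 (vech_index i).1).
    exact: measurable_entryT.
  by apply/funext => w; rewrite !mxE.
have YE n w j : (Num.sqrt n%:R *: (vech (Sh n w) - vech S)) j 0 =
    tot n w (vech_index j).2 (vech_index j).1 by rewrite !mxE.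
apply: cvg_in_law_trig => // [t u|e e0]; last first.
  have [K1 [K10 tight]] := tot_tight e0.
  have v0 j := psd_diag V0 j.
  have nu_coord j : gaussian nu (fun x => x j 0) (V j j).
    exact: (@gaussian_coord _ _ _ nu _ V id j nu_gauss).
  pose c : R := \sum_j V j j.
  have c0 : 0 <= c by apply: sumr_ge0 => j _.
  have Vc j : V j j <= c by rewrite /c (bigD1 j)//= lerDl sumr_ge0.
  pose K2 : R := (p * p.+1)./2%:R * c / e + 1.
  have K20 : 0 < K2 by rewrite ltr_wpDl// divr_ge0 ?mulr_ge0 ?(ltW e0).
  have s20 : 0 < Num.sqrt K2 by rewrite sqrtr_gt0.
  exists (K1 + Num.sqrt K2); split; first by rewrite addr_gt0.
    near=> n; have h1 : (P (big_mx (tot n) K1) <= e%:E)%E by near: n.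
    apply: le_trans h1; apply: probability_le_sub.
    - by apply: measurableC; exact: measurable_box.
    - exact: big_mx_measurable.
    move=> w nY; apply: contrapT => /big_mxP h; apply: nY => j; rewrite YE.
    by rewrite (le_trans (h _ _))// lerDl ltW.
  have mbig j : measurable [set x : 'cV[R]_(p * p.+1)./2 | Num.sqrt K2 <= `|x j 0|].
    by apply: measurable_leset => //; apply: measurableT_comp => //; exact: measurable_entry.
  apply: (@le_trans _ _ (nu [set x : 'cV[R]_(p * p.+1)./2 | exists j,
      [set x : 'cV[R]_(p * p.+1)./2 | Num.sqrt K2 <= `|x j 0|] x])).
    apply: probability_le_sub.
    - by apply: measurableC; apply: measurable_box.
    - exact: measurable_exists_ord.
    move=> x nx; apply: contrapT => H; apply: nx => j; rewrite leNgt; apply/negP => lt.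
    apply: H; exists j => /=; rewrite (le_trans _ (ltW lt))// lerDr ltW//.
  apply: (@le_trans _ _ ((p * p.+1)./2%:R * (K2^-1 * c))%:E).
    apply: probability_exists_le => // j.
    have := markov_pow 1 (gaussian_allmom brB (v0 j) (nu_coord j)) s20.
    rewrite sqr_sqrtr ?(ltW K20)// (gaussian_moment2 brB (v0 j) (nu_coord j)).
    move=> /le_trans; apply; rewrite lee_fin ler_wpM2l ?invr_ge0 ?(ltW K20)//.
  rewrite lee_fin [K2^-1 * _]mulrC [leLHS]mulrA ler_pdivrMr// [e * _]mulrC.
  by rewrite -ler_pdivrMr// lerDl.
have -> : Rintegral nu setT (fun x => cos (t + (u^T *m x) 0 0)) =
    cos t * expR (- ((u^T *m V *m u) 0 0 / 2)).
  exact: (gaussian_cos filtF brB).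
have cv : E (fun w => cos (t + quad_error G S T (unvech_form u) n w)) @[n --> \oo] -->
    cos t * expR (- ((u^T *m V *m u) 0 0 / 2)).
  by rewrite /V unvech_form_var; exact: (quad_error_cos filtF brB G_adapted G_gaussian G_indep symS psdS T_gt0).
apply/cvgrPdist_le => e e0; have e4 : 0 < e / 4 by rewrite divr_gt0.
(* Entries of [dif] below e / (4 U) change the linear form by at most e / 4; adding 1 covers
   [u = 0]. *)
pose U : R := 1 + \sum_j `|u j 0|.
have U0 : 0 < U by rewrite ltr_pwDl// sumr_ge0.
have eU : 0 < e / 4 / U by rewrite divr_gt0.
have small := dif_small eU e4.
move/cvgrPdist_le : cv => /(_ _ e4) cv.
near=> n; have n0 : (0 < n)%N by near: n; exact: nbhs_infty_gt.
have h1 : (P (big_mx (dif n) (e / 4 / U)) <= (e / 4)%:E)%E by near: n.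
have h2 : `|cos t * expR (- ((u^T *m V *m u) 0 0 / 2)) -
    E (fun w => cos (t + quad_error G S T (unvech_form u) n w))| <= e / 4 by near: n.
(* The functional [unvech_form u] represents the linear form only on symmetric matrices, hence the
   symmetry of the realised error. *)
have linE w : (u^T *m (Num.sqrt n%:R *: (vech (Sh n w) - vech S))) 0 0 =
    quad_error G S T (unvech_form u) n w +
    \sum_j u j 0 * dif n w (vech_index j).2 (vech_index j).1.
  have symQ : (Qn n w - S)^T = Qn n w - S.
    rewrite linearB /= symS /path_qvar linearZ /= linear_sum /=; congr (_ *: _ - _).
    by apply: eq_bigr => i _; rewrite trmx_mul trmxK.
  have subE (A C : 'M[R]_p) i j : (A - C) i j = A i j - C i j by rewrite !mxE.
  have := unvech_formE u symQ.
  rewrite /quad_error => e1.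
  have -> : \sum_i \sum_j unvech_form u i j * (path_qvar T (G ^~ w) n i j - S i j) =
      (u^T *m vech (Qn n w - S)) 0 0.
    by rewrite e1; apply: eq_bigr => i _; apply: eq_bigr => j _; rewrite subE.
  rewrite mxE [X in _ = _ * X + _]mxE mulr_sumr -big_split /=; apply: eq_bigr => j _.
  rewrite [_^T _ _]mxE YE totE [(err n w + _) _ _]mxE [vech _ _ _]mxE.
  have -> : err n w (vech_index j).2 (vech_index j).1 =
      Num.sqrt n%:R * (Qn n w - S) (vech_index j).2 (vech_index j).1 by rewrite mxE.
  by rewrite mulrDr; congr (_ + _); rewrite mulrCA.
have muq : measurable_fun setT (quad_error G S T (unvech_form u) n).
  exact: allmom_measurable (quad_error_allmom brB G_gaussian psdS T_gt0 _ n0).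
have mcos (f : Omega -> R) : measurable_fun setT f -> measurable_fun setT (fun w => cos (t + f w)).
  by move=> mf; have := measurable_cosD t 1 mf; under eq_fun do rewrite mul1r.
have bcos (x : R) : `|cos x| <= 1 by rewrite ler_norml cos_geN1 cos_le1.
have h3 : `|E (fun w => cos (t + quad_error G S T (unvech_form u) n w)) -
   E (fun w => cos (t + (u^T *m (Num.sqrt n%:R *: (vech (Sh n w) - vech S))) 0 0))| <=
   e / 4 + 2 * 1 * (e / 4).
  apply: (Exp_diff_le (A := big_mx (dif n) (e / 4 / U))) => //.
  - exact: mcos.
  - by apply: mcos; exact: measurable_linear_form.
  - exact: big_mx_measurable.
  - exact: ltW.
  move=> w /big_mxP hb; apply: (le_trans (cos_lipschitz _ _)).
  rewrite linE addrA [t + _ + _]addrC addrK.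
  apply: (le_trans (ler_norm_sum _ _ _)).
  apply: (@le_trans _ _ (\sum_j `|u j 0| * (e / 4 / U))).
    by apply: ler_sum => j _; rewrite normrM ler_wpM2l.
  rewrite -mulr_suml mulrCA ler_piMr ?(ltW e4)// ler_pdivrMr// mul1r /U lerDr//.
have := le_trans (ler_distD (E (fun w => cos (t + quad_error G S T (unvech_form u) n w))) _ _) (lerD h2 h3).
by move=> /le_trans; apply; lra.
Unshelve. all: by end_near. Qed.

End estimator_limits.

(** * The structural model *)

Section itv_int_linear.
Context (R : realType).
Implicit Types (s t C : R).

Lemma itv_intZ c (f : R -> R) C s t : measurable_fun setT f -> (forall u, `|f u| <= C) ->
  itv_int (fun u => c * f u) s t = c * itv_int f s t.
Proof. by move=> mf fC; rewrite /itv_int RintegralZl//; exact: itv_integrable mf fC. Qed.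

Lemma itv_int_sum (I : Type) (l : seq I) (f : I -> R -> R) (C : I -> R) s t :
  (forall i, measurable_fun setT (f i)) -> (forall i u, `|f i u| <= C i) ->
  itv_int (fun u => \sum_(i <- l) f i u) s t = \sum_(i <- l) itv_int (f i) s t.
Proof.
move=> mf fC; elim: l => [|i l ih].
  rewrite big_nil /itv_int; under eq_Rintegral do rewrite big_nil.
  by rewrite Rintegral_cst// mul0r.
rewrite big_cons -ih /itv_int; under eq_Rintegral do rewrite big_cons.
rewrite RintegralD//; first exact: itv_integrable (mf i) (fC i).
apply: (@itv_integrable _ _ (\sum_(i <- l) C i)); first exact: measurable_sum.
by move=> u; rewrite (le_trans (ler_norm_sum _ _ _))// ler_sum.
Qed.

Lemma itv_int_mulmx q d (A : 'M[R]_(q, d)) (f : R -> 'cV[R]_d) C s t k :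
  (forall j, measurable_fun setT (fun u => f u j 0)) -> (forall u j, `|f u j 0| <= C) ->
  itv_int (fun u => (A *m f u) k 0) s t = \sum_j A k j * itv_int (fun u => f u j 0) s t.
Proof.
move=> mf fC; rewrite /itv_int; under eq_Rintegral do rewrite mxE.
rewrite -/(itv_int _ s t) (@itv_int_sum _ _ _ (fun j => `|A k j| * C)).
- by apply: eq_bigr => j _; exact: itv_intZ.
- by move=> j; exact: measurable_funM.
by move=> j u; rewrite normrM ler_wpM2l.
Qed.

End itv_int_linear.

Lemma sum_I4 (V : nmodType) (f : 'I_4 -> V) :
  \sum_i f i = f iXi + f iDelta + f iEpsilon + f iZeta.
Proof.
rewrite !big_ord_recl big_ord0 addr0 !addrA.
by congr (f _ + f _ + f _ + f _); exact/val_inj.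
Qed.

Section loadings.
Context {R : realType} (p1 p2 k1 k2 : nat).
Variables (L1 : 'M[R]_(p1, k1)) (L2 : 'M[R]_(p2, k2)) (Gam : 'M[R]_(k2, k1)) (Psi : 'M[R]_k2).
Local Notation d := (latent_dim k1 p1 p2 k2).

(* The reduced form [X = \sum_i loading i *m S^i] of the structural equations. *)
Definition loading (i : 'I_4) : 'M[R]_(p1 + p2, d i) :=
  let: Ordinal m _ := i in
  match m return 'M[R]_(p1 + p2, nth 0%N [:: k1; p1; p2; k2] m) with
  | 0 => col_mx L1 (L2 *m invmx Psi *m Gam)
  | 1 => col_mx 1%:M 0
  | 2 => col_mx 0 1%:M
  | 3 => col_mx 0 (L2 *m invmx Psi)
  | _ => 0
  end.

Lemma loading_covariance (r : 'I_4 -> nat) (Sg : forall i, 'M[R]_(d i, r i)) :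
  model_covariance L1 L2 Gam Psi (Sg iXi *m (Sg iXi)^T) (Sg iDelta *m (Sg iDelta)^T)
    (Sg iEpsilon *m (Sg iEpsilon)^T) (Sg iZeta *m (Sg iZeta)^T) =
  \sum_i (loading i *m Sg i) *m (loading i *m Sg i)^T.
Proof.
have E i : (loading i *m Sg i) *m (loading i *m Sg i)^T =
    loading i *m (Sg i *m (Sg i)^T) *m (loading i)^T by rewrite trmx_mul !mulmxA.
under eq_bigr do rewrite E.
rewrite sum_I4 /model_covariance /loading /=.
have sym i : (Sg i *m (Sg i)^T)^T = Sg i *m (Sg i)^T by rewrite trmx_mul trmxK.
move: (sym iXi) (Sg iDelta *m _) (Sg iEpsilon *m _) (Sg iZeta *m _).
move: (Sg iXi *m _) => A /= symA Bm Cm Dm.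
rewrite !tr_col_mx !mul_col_mx !mul_mx_row -!/(block_mx _ _ _ _) !add_block_mx.
rewrite !trmx1 !trmx0 !mul1mx !mulmx1 !mul0mx !mulmx0 ?mul0mx !addr0 ?add0r.
congr block_mx; rewrite ?trmx_mul ?trmxK ?symA ?mulmxA //.
rewrite mulmxDr !mulmxDl !mulmxA -!addrA; congr (_ + _); by rewrite addrC.
Qed.

Lemma loading_observation (eta : 'cV[R]_k2) (S : forall i, 'cV[R]_(d i)) (B0 : 'M[R]_k2) :
  Psi = 1%:M - B0 -> Psi \in unitmx -> eta = B0 *m eta + Gam *m S iXi + S iZeta ->
  col_mx (L1 *m S iXi + S iDelta) (L2 *m eta + S iEpsilon) = \sum_i loading i *m S i.
Proof.
move=> PsiE uPsi etaE.
(* The structural equation is Psi eta = Gamma xi + zeta, solved here for eta. *)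
have -> : eta = invmx Psi *m (Gam *m S iXi + S iZeta).
  apply: (canRL (mulKmx uPsi)); rewrite PsiE mulmxBl mul1mx {1}etaE -addrA.
  by rewrite addrC addrA subrK addrC.
rewrite sum_I4 /loading /= !mul_col_mx !add_col_mx !mul1mx !mul0mx !addr0 ?add0r.
congr col_mx; rewrite mulmxDr mulmxDr !mulmxA -!addrA; congr (_ + _).
by rewrite addrC.
Qed.

End loadings.

Section observed_path.
Context dsp (Omega : measurableType dsp) (R : realType) (P : probability Omega R).
Variables (F : R -> set (set Omega)) (d r : 'I_4 -> nat).
Variables (a : forall i, 'cV[R]_(d i) -> 'cV[R]_(d i)) (Sg : forall i, 'M[R]_(d i, r i)).
Variables (c : forall i, 'cV[R]_(d i) -> 'cV[R]_(d i) -> 'cV[R]_(d i)).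
Variables (lambda0 : 'I_4 -> R) (dens : forall i, 'cV[R]_(d i) -> R) (x0 : forall i, 'cV[R]_(d i)).
Variables (W : forall i, R -> Omega -> 'cV[R]_(r i)).
Variables (mu : forall i, Omega -> {measure set (R * 'cV[R]_(d i)) -> \bar R}).
Variables (S : forall i, R -> Omega -> 'cV[R]_(d i)).
Hypothesis latent : forall i, is_latent_process P F (@a i) (Sg i) (@c i) (lambda0 i) (@dens i)
  (x0 i) (W i) (mu i) (S i).
Hypothesis lip : forall i, lipschitz_growth (@a i) (@c i).
Variables (p : nat) (M : forall i, 'M[R]_(p, d i)) (X : R -> Omega -> 'cV[R]_p).
Hypothesis XE : forall t w, 0 <= t -> X t w = \sum_i M i *m S i t w.
Variables (T D rho : R).
Hypothesis T_gt0 : 0 < T.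
Hypothesis D_gt0 : 0 < D.
Hypothesis rho_range : 3^-1 <= rho < 2^-1.
Local Notation h n := (mesh T n).
Local Notation drift i := (latent_drift_path (@a i) (S i) T).
Local Notation G := (wiener_sum W (fun i => M i *m Sg i)).

Lemma observed_path_close : {ae P, forall w, forall e : R, 0 < e -> \forall n \near \oo,
  (forall i k, (i < n)%N ->
     `|path_incr T (G ^~ w) n i k 0| <= D / (2 * p.+1%:R) * h n `^ rho) ->
  forall k l, `|Num.sqrt n%:R * (Sigma_hat X T D rho n w k l - path_qvar T (G ^~ w) n k l)| <=
    e * (1 + \tr (path_qvar T (G ^~ w) n))}.
Proof.
have h_ge0 n : 0 <= h n by rewrite divr_ge0// ltW.
have inc : {ae P, forall w, forall i s t k, 0 <= s -> s <= t -> t <= T ->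
    mu i w (strip s t) = 0%E -> S i t w k 0 - S i s w k 0 =
    itv_int (fun u => drift i w u k 0) s t + (Sg i *m (W i t w - W i s w)) k 0}.
  by apply: filter_forall => i; exact: (latent_increment_ae (latent i) (lip i) T_gt0).
have jmp : {ae P, forall w, forall i n j, (j < n)%N -> exists k : nat,
    mu i w (strip (j%:R * h n) (j.+1%:R * h n)) = k%:R%:E}.
  by apply: filter_forall => i; exact: (latent_jumps_ae (latent i) T_gt0).
have bnd : {ae P, forall w, forall i, exists B, forall t k, 0 <= t -> t <= T -> `|W i t w k 0| <= B}.
  by apply: filter_forall => i; exact: (latent_wiener_bounded_ae (latent i) T_gt0).
apply: filterS3 inc jmp bnd => w inc jmp bnd e e0.
have {bnd} /choice [BW hBW] := bnd.
have bd i : exists C, forall t k, `|drift i w t k 0| <= C.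
  exact: (latent_drift_bounded (latent i) (lip i) T w).
have {bd} /choice [C hC] := bd.
have mdr i := latent_drift_measurable (latent i) (lip i) T_gt0 w.
(* For n = 1 the only cell is ]0, T], so its mass is a natural number too. *)
have jT i : exists K : nat, mu i w (strip 0 T) = K%:R%:E.
  by have := jmp i 1%N 0%N isT; rewrite mul0r mul1r /mesh divr1.
have {jT} /choice [K hK] := jT.
pose al t : 'cV[R]_p := \sum_i M i *m drift i w t.
(* A cell is a jump cell if one of the four measures charges it. The number of such cells is at most
   the sum of the total masses [K i], a bound that does not depend on n. *)
pose jump n k := [exists i, mu i w (strip (k%:R * h n) (k.+1%:R * h n)) != 0%E].
pose CM := \sum_i \sum_k \sum_j `|M i k j| * C i.
pose BM := \sum_i \sum_k \sum_j `|(M i *m Sg i) k j| * BW i.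
have C0 i (k : 'I_(d i)) : 0 <= C i by apply: le_trans (hC i 0 k).
have B0 i (k : 'I_(r i)) : 0 <= BW i by apply: le_trans (hBW i 0 k (lexx 0) (ltW T_gt0)).
have mulmx_le q m (A : 'M[R]_(q, m)) (x : 'cV[R]_m) b k : (forall j, `|x j 0| <= b) ->
    `|(A *m x) k 0| <= \sum_k \sum_j `|A k j| * b.
  move=> xb; rewrite mxE (le_trans (ler_norm_sum _ _ _))//.
  apply: (@le_trans _ _ (\sum_j `|A k j| * b)).
    by apply: ler_sum => j _; rewrite normrM ler_wpM2l.
  rewrite [leRHS](bigD1 k)//= lerDl; apply: sumr_ge0 => l _; apply: sumr_ge0 => j _.
  by rewrite mulr_ge0// (le_trans _ (xb j)).
apply: (@path_error R p Omega X T D rho w (G ^~ w) al jump (\sum_i K i) BM CM) => //.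
- move=> k; under eq_fun do rewrite /al summxE.
  apply: measurable_sum => i; under eq_fun do rewrite mxE.
  by apply: measurable_sum => j; apply: measurable_funM => //; exact: mdr.
- move=> t k; rewrite /al summxE (le_trans (ler_norm_sum _ _ _))// ler_sum// => i _.
  exact: mulmx_le.
- move=> k t t0 tT; rewrite /al summxE; under eq_fun do rewrite summxE.
  apply: cvg_big => [|i _]; first exact: add_continuous.
  rewrite mxE; under eq_fun do rewrite mxE.
  apply: cvg_big => [|j _]; first exact: add_continuous.
  by apply: cvgM; [exact: cvg_cst|exact: (latent_drift_left (latent i) (lip i))].
- move=> t k t0 tT; rewrite /wiener_sum summxE (le_trans (ler_norm_sum _ _ _))// ler_sum// => i _.
  by apply: mulmx_le => j; exact: hBW.
- move=> n; case: (posnP n) => [->|n0]; first by rewrite big_ord0.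
  apply: (@leq_trans (\sum_(k < n) \sum_i
      (mu i w (strip (k%:R * h n) (k.+1%:R * h n)) != 0%E))%N).
    apply: leq_sum => k _; rewrite /jump; case: existsP => // -[i ni].
    by rewrite (bigD1 i)//= ni.
  rewrite exchange_big /=; apply: leq_sum => i _; apply: jump_count => //.
    by move=> k kn; exact: jmp.
  by rewrite mulr_mesh.
move=> n k j n0 kn; rewrite negb_exists => /forallP nj.
have t0 m : 0 <= m%:R * h n by rewrite mulr_ge0.
have tS : k%:R * h n <= k.+1%:R * h n by rewrite ler_wpM2r// ler_nat.
have tT : k.+1%:R * h n <= T by rewrite -[leRHS](mulr_mesh T n0) ler_wpM2r// ler_nat.
rewrite /increment !XE//= wiener_sumB -sumrB !summxE.
have alE : (fun t => al t j 0) = fun t => \sum_i (M i *m drift i w t) j 0.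
  by apply/funext => t; rewrite /al summxE.
rewrite alE (@itv_int_sum _ _ _ (fun i u => (M i *m drift i w u) j 0)
   (fun i => \sum_k \sum_j `|M i k j| * C i)); first last.
- by move=> i u; exact: mulmx_le.
- move=> i; under eq_fun do rewrite mxE.
  by apply: measurable_sum => l; apply: measurable_funM => //; exact: mdr.
rewrite -big_split /=; apply: eq_bigr => i _.
rewrite (itv_int_mulmx _ _ _ _ (mdr i) (hC i)) -mulmxA -mulmxBr !mxE -big_split /=.
apply: eq_bigr => l _; rewrite -mulrDr; congr (_ * _).
rewrite [LHS](_ : _ = S i (k.+1%:R * h n) w l 0 - S i (k%:R * h n) w l 0); last by rewrite !mxE.
by apply: inc => //; apply/eqP; have := nj i; rewrite negbK.
Qed.

End observed_path.

Theorem theorem1 (R : realType) (dsp : measure_display)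
  (Omega : measurableType dsp) (P : probability Omega R)
  (F : R -> set (set Omega))
  (p1 p2 k1 k2 : nat) (d := latent_dim k1 p1 p2 k2) (r : 'I_4 -> nat)
  (a : forall i, 'cV[R]_(d i) -> 'cV[R]_(d i))
  (Sg : forall i, 'M[R]_(d i, r i))
  (c : forall i, 'cV[R]_(d i) -> 'cV[R]_(d i) -> 'cV[R]_(d i))
  (lambda0 : 'I_4 -> R) (dens : forall i, 'cV[R]_(d i) -> R)
  (x0 : forall i, 'cV[R]_(d i))
  (W : forall i, R -> Omega -> 'cV[R]_(r i))
  (mu : forall i, Omega -> {measure set (R * 'cV[R]_(d i)) -> \bar R})
  (S : forall i, R -> Omega -> 'cV[R]_(d i))
  (Lambda1 : 'M[R]_(p1, k1)) (Lambda2 : 'M[R]_(p2, k2))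
  (Gamma : 'M[R]_(k2, k1)) (B0 : 'M[R]_k2)
  (eta : R -> Omega -> 'cV[R]_k2) (X : R -> Omega -> 'cV[R]_(p1 + p2))
  (T D rho : R)
  (xi : R -> Omega -> 'cV[R]_k1 := S iXi)
  (delta : R -> Omega -> 'cV[R]_p1 := S iDelta)
  (epsilon : R -> Omega -> 'cV[R]_p2 := S iEpsilon)
  (zeta : R -> Omega -> 'cV[R]_k2 := S iZeta)
  (Psi := 1%:M - B0)
  (Sigma0 := model_covariance Lambda1 Lambda2 Gamma Psi
     (Sg iXi *m (Sg iXi)^T) (Sg iDelta *m (Sg iDelta)^T)
     (Sg iEpsilon *m (Sg iEpsilon)^T) (Sg iZeta *m (Sg iZeta)^T))
  (p := (p1 + p2)%N)
  (k1_gt0 : (0 < k1)%N) (k2_gt0 : (0 < k2)%N)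
  (k1_le_p1 : (k1 <= p1)%N) (k2_le_p2 : (k2 <= p2)%N)
  (basis : is_filtration F)
  (latent : forall i, is_latent_process P F (a i) (Sg i) (c i) (lambda0 i) (dens i)
     (x0 i) (W i) (mu i) (S i))
  (noise_independent : forall t, 0 <= t ->
     independent_sigma_fields P (noise_sigma_fields F W mu t))
  (Lambda1_rank : \rank Lambda1 = k1) (Lambda2_rank : \rank Lambda2 = k2)
  (B0_diag : forall j, B0 j j = 0) (Psi_unit : Psi \in unitmx)
  (eta_def : forall t w, 0 <= t ->
     eta t w = B0 *m eta t w + Gamma *m xi t w + zeta t w)
  (X_def : forall t w, 0 <= t -> X t w =
     col_mx (Lambda1 *m xi t w + delta t w) (Lambda2 *m eta t w + epsilon t w))
  (Sigma0_posdef : posdef Sigma0)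
  (T_gt0 : 0 < T) (D_gt0 : 0 < D) (rho_range : 3^-1 <= rho < 2^-1)
  (cond1 : forall i, lipschitz_growth (a i) (c i))
  (cond2 : forall i, smooth_drift (a i))
  (cond3 : forall i, jump_intensity_bounds (fun z => lambda0 i * dens i z))
  (cond4 : forall i, jump_lower_bound (c i)) :
  cvg_in_probability P (Sigma_hat X T D rho) Sigma0 /\
  cvg_in_law_normal P
    (fun n w => Num.sqrt n%:R *: (vech (Sigma_hat X T D rho n w) - vech Sigma0))
    0
    (2 *: (duplication_pinv p *m tensmx Sigma0 Sigma0 *m (duplication_pinv p)^T)).

Proof.
pose M := loading Lambda1 Lambda2 Gamma Psi.
pose N i := M i *m Sg i.
have XE t w : 0 <= t -> X t w = \sum_i M i *m S i t w.
  move=> t0; rewrite X_def//.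
  apply: (@loading_observation R p1 p2 k1 k2 Lambda1 Lambda2 Gamma Psi (eta t w)
    (fun i => S i t w) B0) => //.
  exact: eta_def.
have SN : Sigma0 = \sum_i N i *m (N i)^T by exact: loading_covariance.
have [symS posS] := Sigma0_posdef.
have psdS (u : 'cV[R]_p) : 0 <= (u^T *m Sigma0 *m u) 0 0.
  by have [->|/posS/ltW//] := eqVneq u 0; rewrite mulmx0 mxE.
have wienerW i := latent_wiener (latent i).
have p_gt0 : (0 < p)%N by rewrite addn_gt0 (leq_trans k1_gt0 k1_le_p1).
(* If all the Wiener processes had dimension 0, Sigma0 would be 0, against positive definiteness in
   the positive dimension p. *)
have [i ri] : exists i, (0 < r i)%N.
  apply: contrapT => nr.
  have N0 i : N i *m (N i)^T = 0.
    apply/matrixP => j k; rewrite !mxE; apply: big1 => l _.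
    by case: nr; exists i; apply: leq_ltn_trans (ltn_ord l).
  have S0 : Sigma0 = 0 by rewrite SN big1.
  pose v : 'cV[R]_p := const_mx 1.
  have v0 : v != 0.
    by apply/eqP => /matrixP/(_ (Ordinal p_gt0) 0); rewrite !mxE; apply/eqP; rewrite oner_eq0.
  by have := posS v v0; rewrite S0 mulmx0 mul0mx mxE ltxx.
have brB := wiener_brownian basis wienerW (Ordinal ri).
pose G := wiener_sum W N.
have G_gaussian s t (u : 'cV[R]_p) : 0 <= s -> s <= t ->
    gaussian P (fun w => (u^T *m (G t w - G s w)) 0 0) ((t - s) * (u^T *m Sigma0 *m u) 0 0).
  move=> s0 st; rewrite SN.
  by apply: (wiener_sum_gaussian basis wienerW noise_independent) => //; eexists; exact: brB.
have G_indep s t (f : Omega -> R) : 0 <= s -> s <= t ->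
    (forall A, measurable A -> F s (f @^-1` A)) -> indep_rv P f (fun w => G t w - G s w).
  exact: (wiener_sum_indep basis wienerW noise_independent).
have G_adapted t u j : 0 <= t -> t <= u -> measurable_fun [set: g_sigma_algebraType (F u)]
    (fun w : g_sigma_algebraType (F u) => G t w j 0).
  exact: (wiener_sum_adapted basis wienerW).
have mX t : 0 <= t -> measurable_fun setT (X t).
  move=> t0; have -> : X t = fun w => \sum_i M i *m S i t w by apply/funext => w; exact: XE.
  apply: measurable_fun_mx => j k; under eq_fun do rewrite summxE.
  apply: measurable_sum => l; apply: measurable_entryT; apply: measurable_mulmx.
  move=> _ A mA; rewrite setTI; apply: (basis.1 t t0).2.
  by apply: (latent_adapted (latent l) t0); exists A => //; rewrite setTI.
have close := observed_path_close latent cond1 XE T_gt0 D_gt0 rho_range.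
have rho_lt : rho < 2^-1 by case/andP: rho_range.
split; first exact: (Sigma_hat_consistent basis brB G_adapted G_gaussian G_indep symS psdS
  T_gt0 D_gt0 rho_lt mX close).
(* Placing the four factors side by side turns the sum of Gram matrices into a single one. *)
pose NN := row_mx (row_mx (N iXi) (N iDelta)) (row_mx (N iEpsilon) (N iZeta)).
have SNN : Sigma0 = NN *m NN^T.
  by rewrite SN sum_I4 /NN !tr_row_mx !mul_row_col !addrA.
exact: (vech_Sigma_hat_normal basis brB G_adapted G_gaussian G_indep symS psdS
  T_gt0 D_gt0 rho_lt mX close SNN).
Qed.
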